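(* Let $\Omega\subset\mathbb{R}^d$ be a bounded Lipschitz domain and let $u,v\in H^1_0(\Lambda)$ for some bounded set $\Lambda$ containing $\Omega$. Then $$\lim_{s\to\frac12^-}a_u(u,v)=\int_\Omega\frac{\nabla u(x)\cdot\nabla v(x)}{\sqrt{1+|\nabla u(x)|^2}}\,dx.$$
   Context: Functions in $H_0^1(\Lambda)$ are extended by zero to $\mathbb{R}^d$. $\Omega^c=\mathbb{R}^d\setminus\Omega$, $Q_\Omega=(\mathbb{R}^d\times\mathbb{R}^d)\setminus(\Omega^c\times\Omega^c)$. For $s\in(0,1/2)$ the (rescaled, $s$-dependent) form is $$a_u(w,v)=C_{d,s}\iint_{Q_\Omega}\widetilde G_s\Big(\frac{u(x)-u(y)}{|x-y|}\Big)\frac{(w(x)-w(y))(v(x)-v(y))}{|x-y|^{d+1+2s}}\,dx\,dy,$$ where $\widetilde G_s(\rho)=\int_0^1(1+\rho^2r^2)^{-(d+1+2s)/2}dr$ and $C_{d,s}=\frac{1-2s}{\alpha_d}$, with $\alpha_d$ the volume of the $d$-dimensional unit ball. *)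

(* Defs.v *)
From HB Require Import structures.
From mathcomp Require Import all_boot all_order all_algebra.
From mathcomp Require Import all_classical all_reals all_analysis.

Set Implicit Arguments.
Unset Strict Implicit.
Unset Printing Implicit Defensive.
Import Order.TTheory GRing.Theory Num.Theory.
Import numFieldNormedType.Exports.

Local Open Scope classical_set_scope.
Local Open Scope ring_scope.

(* R^n is 'rV[R]_n. Its measurable sets form the sigma-algebra generated by
   the coordinates, i.e. the product (equivalently Borel) sigma-algebra. *)
Definition measure_rV_display : measure_display.
Proof. exact. Qed.

Section measurable_rV.
Context (R : realType) (n : nat).

Let coord_rV (i : 'I_n) (x : 'rV[R]_n) : measurableTypeR R := x 0 i.

Let rV_set0 : g_sigma_preimage coord_rV set0.
Proof. exact: sigma_algebra0. Qed.

Let rV_setC A : g_sigma_preimage coord_rV A -> g_sigma_preimage coord_rV (~` A).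
Proof. exact: sigma_algebraC. Qed.

Let rV_bigcup (F : _^nat) : (forall i, g_sigma_preimage coord_rV (F i)) ->
  g_sigma_preimage coord_rV (\bigcup_i (F i)).
Proof. exact: sigma_algebra_bigcup. Qed.

HB.instance Definition _ := @isMeasurable.Build measure_rV_display
  'rV[R]_n (g_sigma_preimage coord_rV) rV_set0 rV_setC rV_bigcup.

Lemma measurable_coord_rV (i : 'I_n) :
  measurable_fun [set: 'rV[R]_n] (fun x : 'rV[R]_n => x 0 i : measurableTypeR R).
Proof.
move=> _ Y mY; rewrite setTI; apply: sub_sigma_algebra => /=.
rewrite -bigcup_seq/=; exists i => /=; first by rewrite mem_index_enum.
by exists Y => //; rewrite setTI.
Qed.

Lemma measurable_fun_rVP d (T : measurableType d) (f : T -> 'rV[R]_n) :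
  (forall i, measurable_fun [set: T] (fun t => f t 0 i : measurableTypeR R)) ->
  measurable_fun [set: T] f.
Proof.
move=> mf.
have : g_sigma_preimage (fun i => @coord_rV i \o f) `<=` measurable.
  apply: smallest_sub; first exact: sigma_algebra_measurable.
  rewrite -bigcup_seq; apply: bigcup_sub => i _ A [B mB <-]; exact: mf.
by rewrite g_sigma_preimage_comp => sub _ A mA; apply: sub; exists A.
Qed.

End measurable_rV.

Lemma product_sigma_finite d1 d2 (T1 : measurableType d1) (T2 : measurableType d2)
    (R : realType) (m1 : {sigma_finite_measure set T1 -> \bar R})
    (m2 : {sigma_finite_measure set T2 -> \bar R}) :
  sigma_finite setT (m1 \x m2)%E.
Proof.
have /sigma_finiteP[F [TF ndF Foo]] := sigma_finiteT m1.
have /sigma_finiteP[G [TG ndG Goo]] := sigma_finiteT m2.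
exists (fun n => F n `*` G n).
  rewrite -setXTT TF TG predeqE => -[x y]; split.
    move=> [/= [n _ Fnx] [k _ Gky]]; exists (maxn n k) => //; split.
    - by move: x Fnx; exact/subsetPset/ndF/leq_maxl.
    - by move: y Gky; exact/subsetPset/ndG/leq_maxr.
  by move=> [n _ []/= ? ?]; split; exists n.
move=> k; have [? ?] := Foo k; have [? ?] := Goo k.
split; first exact: measurableX.
by rewrite product_measure1E// lte_mul_pinfty// ge0_fin_numE.
Qed.

Section sigma_finite_measure_ex.
Context d (T : measurableType d) (R : realType) (q : set T -> \bar R).
Hypotheses (q0 : q set0 = 0%E) (q_ge0 : forall A, (0 <= q A)%E)
  (q_sigma_additive : semi_sigma_additive q) (q_fin : sigma_finite setT q).

Let q' := q.
HB.instance Definition _ := isMeasure.Build _ _ _ q' q0 q_ge0 q_sigma_additive.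
HB.instance Definition _ := Measure_isSigmaFinite.Build _ _ _ q' q_fin.

Lemma sigma_finite_measure_ex :
  exists m : {sigma_finite_measure set T -> \bar R}, m = q :> (_ -> _).
Proof. by exists q'. Qed.

End sigma_finite_measure_ex.

Section lebesgue_rV.
Context (R : realType).

Definition cons_rV n (z : measurableTypeR R * 'rV[R]_n) : 'rV[R]_n.+1 :=
  row_mx (const_mx z.1 : 'rV_1) z.2.

(* Lebesgue measure on R^n, as the n-fold product of Lebesgue measure on R. *)
Fixpoint lebesgue_rV (n : nat) : set 'rV[R]_n -> \bar R :=
  match n return set 'rV[R]_n -> \bar R with
  | 0%N => dirac (0 : 'rV[R]_0)
  | n'.+1 => pushforward (lebesgue_measure \x @lebesgue_rV n')%E
               (@cons_rV n')
  end.
Arguments lebesgue_rV : clear implicits.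

Let uncons_rV n (x : 'rV[R]_n.+1) : measurableTypeR R * 'rV[R]_n :=
  (x 0 0, \row_i x 0 (lift 0 i)).

Let uncons_rVK n : cancel (@uncons_rV n) (@cons_rV n).
Proof.
move=> x; apply/rowP => i; rewrite /cons_rV /= mxE.
case: splitP => j ij; rewrite mxE; first by congr (x 0 _); apply/val_inj; rewrite /= ij ord1.
by congr (x 0 _); apply/val_inj; rewrite /= ij.
Qed.

Let cons_rVK n : cancel (@cons_rV n) (@uncons_rV n).
Proof.
move=> [a v]; congr pair; rewrite /cons_rV /=.
  transitivity (row_mx (const_mx a : 'rV[R]_1) v 0 (lshift n 0)).
    by congr (row_mx _ _ _ _); apply/val_inj.
  by rewrite row_mxEl mxE.
apply/rowP => i; rewrite mxE.
transitivity (row_mx (const_mx a : 'rV[R]_1) v 0 (rshift 1 i)).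
  by congr (row_mx _ _ _ _); apply/val_inj.
by rewrite row_mxEr.
Qed.

Let measurable_cons_rV n : measurable_fun setT (@cons_rV n).
Proof.
apply: measurable_fun_rVP => i; rewrite /cons_rV.
case: (@splitP 1 n i) => j ij.
  have -> : i = lshift n j by apply: val_inj.
  rewrite (_ : (fun _ => _) = fst); first exact: measurable_fst.
  by apply/funext => z; rewrite [LHS]row_mxEl mxE.
have -> : i = rshift 1 j by apply: val_inj.
rewrite (_ : (fun _ => _) =
  (fun x : 'rV[R]_n => x 0 j : measurableTypeR R) \o snd).
  exact: (measurableT_comp (measurable_coord_rV j) measurable_snd).
by apply/funext => z; rewrite [LHS]row_mxEr.
Qed.

Let measurable_uncons_rV n : measurable_fun setT (@uncons_rV n).
Proof.
apply/measurable_fun_pairP; split; first exact: measurable_coord_rV.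
apply: measurable_fun_rVP => i.
rewrite (_ : (fun _ => _) =
  (fun x : 'rV[R]_n.+1 => x 0 (lift 0 i) : measurableTypeR R)).
  exact: measurable_coord_rV.
by apply/funext => x; rewrite /= mxE.
Qed.

Let lebesgue_rV_measure n :
  exists m : {sigma_finite_measure set 'rV[R]_n -> \bar R},
    m = lebesgue_rV n :> (_ -> _).
Proof.
elim: n => [|n [m mE]]; first by exists (dirac (0 : 'rV[R]_0)).
pose p : {measure set (measurableTypeR R * 'rV[R]_n)%type -> \bar R} :=
  (@lebesgue_measure R \x m)%E.
pose q := pushforward p (@cons_rV n).
have mcons := @measurable_cons_rV n.
have mpre (A : set _) : measurable A -> measurable (@cons_rV n @^-1` A).
  by move=> mA; rewrite -[_ @^-1` _]setTI; exact: mcons.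
have q0 : q set0 = 0%E by rewrite /q /pushforward preimage_set0 measure0.
have qge0 A : (0 <= q A)%E by exact: (measure_ge0 p).
have qsig : semi_sigma_additive q.
  move=> F mF tF mUF; rewrite /q /pushforward preimage_bigcup.
  apply: measure_semi_sigma_additive.
  - by move=> k; exact: mpre.
  - apply/trivIsetP => /= i j _ _ ij; rewrite -preimage_setI.
    by move/trivIsetP : tF => /(_ _ _ _ _ ij) ->//; rewrite preimage_set0.
  - by rewrite -preimage_bigcup; exact: mpre.
have qfin : sigma_finite setT q.
  have [F FT mF] : sigma_finite setT p by exact: (@product_sigma_finite _ _ _ _ _ (@lebesgue_measure R) m).
  exists (fun k => @uncons_rV n @^-1` F k).
    by rewrite -preimage_bigcup -FT preimage_setT.
  move=> k; split.
    by rewrite -[_ @^-1` _]setTI; apply: measurable_uncons_rV => //; case: (mF k).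
  rewrite /q /pushforward -comp_preimage (_ : _ \o _ = id) ?preimage_id.
    by case: (mF k).
  by apply/funext => z; exact: cons_rVK.
have [Q QE] := sigma_finite_measure_ex q0 qge0 qsig qfin.
by exists Q; rewrite QE /= -mE.
Qed.

Let lebesgue_rV0 n : lebesgue_rV n set0 = 0%E.
Proof. by have [m <-] := lebesgue_rV_measure n; exact: measure0. Qed.

Let lebesgue_rV_ge0 n A : (0 <= lebesgue_rV n A)%E.
Proof. by have [m <-] := lebesgue_rV_measure n; exact: measure_ge0. Qed.

Let lebesgue_rV_semi_sigma_additive n : semi_sigma_additive (lebesgue_rV n).
Proof.
by have [m <-] := lebesgue_rV_measure n; exact: measure_semi_sigma_additive.
Qed.

Let lebesgue_rV_sigma_finite n : sigma_finite setT (lebesgue_rV n).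
Proof. by have [m <-] := lebesgue_rV_measure n; exact: sigma_finiteT. Qed.

HB.instance Definition _ n := isMeasure.Build _ _ _ (lebesgue_rV n)
  (lebesgue_rV0 n) (@lebesgue_rV_ge0 n) (@lebesgue_rV_semi_sigma_additive n).

HB.instance Definition _ n := Measure_isSigmaFinite.Build _ _ _ (lebesgue_rV n)
  (lebesgue_rV_sigma_finite n).

End lebesgue_rV.
Arguments lebesgue_rV {R} n.
Arguments cons_rV {R} n z.

Section lipschitz_domain.
Context (R : realType) (d : nat).
Implicit Types (x y : 'rV[R]_d) (Omega : set 'rV[R]_d).

(* The library norm `|x| on 'rV[R]_d is the sup norm. *)
Definition dot x y : R := \sum_(i < d) x 0 i * y 0 i.

Definition enorm x : R := Num.sqrt (dot x x).

(* Near each boundary point, in suitable orthonormal coordinates x *m A, the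
   set is the strict epigraph of a Lipschitz function of the coordinates
   other than the i-th. *)
Definition lipschitz_boundary Omega : Prop :=
  forall x0, (closure Omega `\` interior Omega) x0 ->
  exists (A : 'M[R]_d) (i : 'I_d) (g : 'rV[R]_d.-1 -> R) (k : R),
    [/\ A *m A^T = 1%:M, k.-lipschitz g &
      \forall x \near x0,
        Omega x <-> g (col' i (x *m A)) < (x *m A) 0 i].

Definition bounded_lipschitz_domain Omega : Prop :=
  [/\ Omega !=set0, open Omega, connected Omega, bounded_set Omega &
      lipschitz_boundary Omega].

End lipschitz_domain.

Section sobolev.
Context (R : realType) (d : nat).
Implicit Types (f phi u : 'rV[R]_d -> R) (Lambda : set 'rV[R]_d).

Definition partial (i : 'I_d) f : 'rV[R]_d -> R :=
  fun x => 'D_(delta_mx 0 i : 'rV[R]_d) f x.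

Definition smooth f : Prop := forall s : seq 'I_d,
  let g := foldr partial f s in
  continuous g /\ forall i x, derivable g x (delta_mx 0 i : 'rV[R]_d).

Definition supp f : set 'rV[R]_d := closure [set x | f x != 0].

(* Elements of C_c^oo(Lambda), extended by zero to the whole space. *)
Definition test_function Lambda phi : Prop :=
  [/\ smooth phi, compact (supp phi) & supp phi `<=` Lambda].

Definition weak_gradient u (Du : 'rV[R]_d -> 'rV[R]_d) : Prop :=
  forall (i : 'I_d) phi, test_function setT phi ->
    (\int[lebesgue_rV d]_x (u x * partial i phi x)%:E =
     - \int[lebesgue_rV d]_x (Du x 0 i * phi x)%:E)%E.

(* u belongs to H^1(R^d) and Du is its weak gradient. *)
Definition sobolev_H1 u (Du : 'rV[R]_d -> 'rV[R]_d) : Prop :=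
  [/\ u \in Lfun (lebesgue_rV d) 2%:E,
      (forall i, (fun x => Du x 0 i) \in Lfun (lebesgue_rV d) 2%:E) &
      weak_gradient u Du].

(* u is the extension by zero of an element of H^1_0(Lambda), the closure of
   C_c^oo(Lambda) for the H^1 norm, and Du is its weak gradient. Since test
   functions vanish off Lambda, convergence in H^1(R^d) amounts to
   convergence in H^1(Lambda) together with u = 0 a.e. off Lambda. *)
Definition sobolev_H10 Lambda u (Du : 'rV[R]_d -> 'rV[R]_d) : Prop :=
  sobolev_H1 u Du /\
  exists phi : nat -> 'rV[R]_d -> R,
    [/\ forall k, test_function Lambda (phi k),
        'N[lebesgue_rV d]_2%:E[(fun x => (u x - phi k x)%:E)]%E
          @[k --> \oo] --> 0%E &
        forall i, 'N[lebesgue_rV d]_2%:E[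
            (fun x => (Du x 0 i - partial i (phi k) x)%:E)]%E
          @[k --> \oo] --> 0%E].

End sobolev.

Section nonlocal_form.
Context (R : realType) (d : nat).
Implicit Types (Omega : set 'rV[R]_d) (s rho : R) (u w v : 'rV[R]_d -> R).

Definition QOmega Omega : set ('rV[R]_d * 'rV[R]_d) :=
  ~` ((~` Omega) `*` (~` Omega)).

Definition Gtilde s rho : R :=
  \int[lebesgue_measure]_(r in `[0, 1])
    ((1 + rho ^+ 2 * r ^+ 2) `^ (- ((d%:R + 1 + 2 * s) / 2))).

Definition alpha : R :=
  fine (lebesgue_rV d [set x : 'rV[R]_d | enorm x < 1]).

Definition Cds s : R := (1 - 2 * s) / alpha.

(* Extended-real valued: it is finite exactly when the double integral
   converges absolutely. On the null set x = y the integrand is 0, because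
   division by 0 yields 0. *)
Definition nonlocal_form Omega s u w v : \bar R :=
  ((Cds s)%:E *
   \int[lebesgue_rV d \x lebesgue_rV d]_(z in QOmega Omega)
     (Gtilde s ((u z.1 - u z.2) / enorm (z.1 - z.2)) *
      ((w z.1 - w z.2) * (v z.1 - v z.2)) /
      enorm (z.1 - z.2) `^ (d%:R + 1 + 2 * s))%:E)%E.

End nonlocal_form.

(* Main.v *)
(** Put y = x + h. Up to the factor C_{d,s} |h|^2 / |h|^(d+1+2s), written
[weight s h], the integrand of the form is F_s(p) q, where p and q are the
difference quotients of u and v in the direction h / |h| and
F_s(p) = p G_s(p). As s tends to 1/2 the weights concentrate at h = 0 with mass
d on the unit ball, so p, q and F_s may be replaced by the directional
derivatives p', q' and by F_{1/2}. The form then becomes, for each s exactly,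
the integral over Omega of the spherical average
(d / alpha_d) int_{|h| < 1} F_{1/2}(a.h/|h|) (b.h/|h|) dh = a.b / sqrt (1 + |a|^2)
at a = grad u, b = grad v.

The replacement is controlled by the integrals over x of (p - p')^2, which are
bounded and vanish as h tends to 0: for test functions by Taylor expansion, and
in general by density and the bound int (u(x+h) - u(x))^2 dx <= 8 |h|^2
int |grad u|^2. For test functions the latter follows by iterating
e(2h) <= 4 e(h) down to infinitesimal h. The pairs x, x + h with one point
outside Omega contribute o(1) since Omega is open, and those with |h| >= 1 since
C_{d,s} tends to 0.

The spherical average reduces, by reflections, to a = b along a coordinate axis,
where it is computed by an anisotropic scaling of the ball. *)

From HB Require Import structures.
Require Import Defs.
From mathcomp Require Import all_boot all_order all_algebra.
From mathcomp Require Import all_classical all_reals all_analysis.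
From mathcomp Require Import measurable_realfun ring lra.

Set Implicit Arguments.
Unset Strict Implicit.
Unset Printing Implicit Defensive.
Import Order.TTheory GRing.Theory Num.Theory.
Import numFieldNormedType.Exports.

Local Open Scope classical_set_scope.
Local Open Scope ring_scope.

(** The integrand is quadratic in functions that are only in L^2, so the two densities are compared
    in L^1 of the product space, through a pointwise bound by squares. A parameter [eta] from
    Young's inequality puts a small factor on the squared slopes and a factor of order [1 / eta] on
    the squares [(p - p')^2]; [eta] is fixed first, and only then does s tend to 1/2. The same bound
    yields the integrability of the form, which is not known beforehand.

    Dominated convergence does not apply directly to the pairs that cross the boundary: difference
    quotients vary with h, and a point outside Omega may lie on its boundary, within reach of
    arbitrarily small h. Exchanging the end points puts the base point inside Omega, and trading
    quotients for slopes gives a majorant free of h.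

    Polar coordinates are avoided. Radial integrals come from writing a power or a logarithm as an
    integral over t, exchanging the integrals and rescaling balls. The factor 1 - 2s of C_{d,s} is
    exactly d minus the decay exponent of the weight, hence a mass independent of s. *)

Section generalities.
Context d (T : measurableType d) (R : realType) (mu : {measure set T -> \bar R}).

Lemma ge0_le_integralT (f g : T -> \bar R) :
  (forall x, 0 <= f x)%E -> (forall x, f x <= g x)%E ->
  (\int[mu]_x f x <= \int[mu]_x g x)%E.
Proof.
move=> f0 fg.
have g0 x : (0 <= g x)%E by exact: le_trans (f0 x) (fg x).
rewrite !ge0_integralTE//; apply: ereal_sup_le => _ [h hf <-]; exists h => // x.
exact: le_trans (hf x) (fg x).
Qed.

End generalities.

(** * Measurability on R^d *)

Section measurability.
Context (R : realType) (d : nat).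

(** The sigma-algebra is generated by the coordinates, so an open set is written as the countable
    union of the boxes with rational centre and half-side 1/(k+1) that it contains. A half-side
    below [e / 2] lets a box around a point fit in the ball of radius [e] at that point. *)
Lemma open_measurable_rV (U : set 'rV[R]_d) : open U -> measurable U.
Proof.
move=> oU.
pose box (p : 'rV[rat]_d * nat) : set 'rV[R]_d :=
  \bigcap_(i in [set: 'I_d]) [set x | `|x 0 i - ratr (p.1 0 i)| < p.2.+1%:R^-1].
have mbox p : measurable (box p).
  apply: fin_bigcap_measurable => [|i _]; first exact: finite_finset.
  have mf : measurable_fun setT (fun x : 'rV[R]_d => `|x 0 i - ratr (p.1 0 i)|).
    by apply: measurableT_comp => //; apply: measurable_funB => //;
      exact: measurable_coord_rV.
  have := mf measurableT _ (measurable_itv `]-oo, (p.2.+1%:R^-1)[).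
  congr (measurable _); rewrite setTI.
  by apply/seteqP; split => x /=; rewrite in_itv.
rewrite (_ : U = \bigcup_p (if `[< box p `<=` U >] then box p else set0)).
  apply: countable_bigcupT_measurable; first exact: countableP.
  by move=> p; case: ifP.
apply/seteqP; split => [x Ux|x [p _]]; last by case: asboolP => // + bx; exact.
have [e/= e0 xeU] : exists2 e : R, 0 < e & ball x e `<=` U.
  by move: (open_nbhs_nbhs (conj oU Ux)) => /nbhs_ballP[e /= e0 ?]; exists e.
have [n ne] : exists n, n.+1%:R^-1 < e / 2.
  exists (Num.truncn (2 / e)); rewrite invf_plt ?posrE ?divr_gt0//.
  by rewrite invf_div truncnS_gt.
have /choice[q qP] (i : 'I_d) : exists q : rat, `|x 0 i - ratr q| < n.+1%:R^-1.
  have /rat_in_itvoo[q] : x 0 i - n.+1%:R^-1 < x 0 i + n.+1%:R^-1.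
    by rewrite ltrBlDr -addrA ltrDl addr_gt0.
  by rewrite in_itv/= => /andP[q1 q2]; exists q; rewrite ltr_distlC q1.
exists (\row_i q i, n) => //.
case: asboolP => [_ i _ /=|]; first by rewrite mxE.
case=> y yb; apply: xeU; split => // i j.
rewrite -ball_normE/= (ord1 i).
have := yb j Logic.I; rewrite /= mxE => y1; have x1 := qP j.
rewrite (_ : _ - _ = (x 0 j - ratr (q j)) - (y 0 j - ratr (q j))); last by ring.
by apply: le_lt_trans (ler_normB _ _) _; apply: lt_trans (ltrD x1 y1) _; rewrite [e]splitr ltrD.
Qed.

Lemma continuous_measurable_rV (f : 'rV[R]_d -> R) :
  continuous f -> measurable_fun setT f.
Proof.
move=> cf; apply: (measurability _ (RGenOpens.measurableE R)).
move=> _ [_ [a [b ->] <-]]; rewrite setTI; apply: open_measurable_rV.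
by move/continuousP : cf; apply; exact: interval_open.
Qed.

Lemma measurable_rV_comp d' (T : measurableType d') (f : T -> 'rV[R]_d) i :
  measurable_fun setT f -> measurable_fun setT (fun t => f t 0 i).
Proof. by move=> mf; apply: (measurableT_comp (measurable_coord_rV i) mf). Qed.

End measurability.
Arguments measurable_rV_comp {R d d' T f} i.

(** * Euclidean geometry and reflections *)

Section euclidean.
Context (R : realType) (d : nat).
Implicit Types x y z : 'rV[R]_d.

Lemma dotC x y : dot x y = dot y x.
Proof. by rewrite /dot; apply: eq_bigr => i _; rewrite mulrC. Qed.

Lemma dotDl x y z : dot (x + y) z = dot x z + dot y z.
Proof. by rewrite /dot -big_split/=; apply: eq_bigr => i _; rewrite mxE mulrDl. Qed.

Lemma dotZl a x y : dot (a *: x) y = a * dot x y.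
Proof. by rewrite /dot mulr_sumr; apply: eq_bigr => i _; rewrite mxE mulrA. Qed.

Lemma dotNl x y : dot (- x) y = - dot x y.
Proof. by rewrite -scaleN1r dotZl mulN1r. Qed.

Lemma dotBl x y z : dot (x - y) z = dot x z - dot y z.
Proof. by rewrite dotDl dotNl. Qed.

Lemma dotDr x y z : dot x (y + z) = dot x y + dot x z.
Proof. by rewrite dotC dotDl !(dotC x). Qed.

Lemma dotZr a x y : dot x (a *: y) = a * dot x y.
Proof. by rewrite dotC dotZl (dotC x). Qed.

Lemma dotNr x y : dot x (- y) = - dot x y.
Proof. by rewrite dotC dotNl (dotC x). Qed.

Lemma dotBr x y z : dot x (y - z) = dot x y - dot x z.
Proof. by rewrite dotDr dotNr. Qed.

Lemma dot0l x : dot 0 x = 0.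
Proof. by rewrite -(scale0r 0) dotZl mul0r. Qed.

Lemma dot_ge0 x : 0 <= dot x x.
Proof. by apply: sumr_ge0 => i _; rewrite -expr2 sqr_ge0. Qed.

Lemma sqr_coord_le x i : x 0 i ^+ 2 <= dot x x.
Proof.
rewrite /dot (bigD1 i)//= -expr2 lerDl; apply: sumr_ge0 => j _.
by rewrite -expr2 sqr_ge0.
Qed.

Lemma dot_eq0 x : dot x x = 0 -> x = 0.
Proof.
move=> x0; apply/rowP => i; apply/eqP; rewrite mxE -sqrf_eq0 eq_le sqr_ge0.
by rewrite -{1}x0 sqr_coord_le.
Qed.

Lemma enorm_ge0 x : 0 <= enorm x.
Proof. exact: sqrtr_ge0. Qed.

Lemma sqr_enorm x : enorm x ^+ 2 = dot x x.
Proof. by rewrite sqr_sqrtr// dot_ge0. Qed.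

Lemma enorm0 : enorm (0 : 'rV[R]_d) = 0.
Proof. by rewrite /enorm dot0l sqrtr0. Qed.

Lemma enorm_eq0 x : enorm x = 0 -> x = 0.
Proof. by move=> x0; apply: dot_eq0; rewrite -sqr_enorm x0 expr0n. Qed.

Lemma enorm_gt0 x : x != 0 -> 0 < enorm x.
Proof.
by rewrite lt_def enorm_ge0 andbT; apply: contra => /eqP/enorm_eq0 ->.
Qed.

Lemma enormZ a x : enorm (a *: x) = `|a| * enorm x.
Proof.
by rewrite /enorm dotZl dotZr mulrA -expr2 sqrtrM ?sqr_ge0// sqrtr_sqr.
Qed.

Lemma enormN x : enorm (- x) = enorm x.
Proof. by rewrite -scaleN1r enormZ normrN1 mul1r. Qed.

Lemma coord_le_enorm x i : `|x 0 i| <= enorm x.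
Proof. by rewrite -sqrtr_sqr ler_sqrt ?dot_ge0// sqr_coord_le. Qed.

Lemma sqr_dot_le x y : dot x y ^+ 2 <= dot x x * dot y y.
Proof.
have [x0|x0] := eqVneq (dot x x) 0.
  by rewrite (dot_eq0 x0) !dot0l expr0n mul0r.
have xp : 0 < dot x x by rewrite lt_def x0 dot_ge0.
have := dot_ge0 (dot x x *: y - dot x y *: x).
rewrite !(dotBl, dotBr, dotZl, dotZr) (dotC y x).
rewrite (_ : _ - _ = dot x x * (dot x x * dot y y - dot x y ^+ 2)); last by ring.
by rewrite pmulr_rge0// subr_ge0.
Qed.

Lemma dot_le_enorm x y : `|dot x y| <= enorm x * enorm y.
Proof.
rewrite -[X in X <= _]sqrtr_sqr -sqrtrM ?dot_ge0// ler_sqrt ?mulr_ge0 ?dot_ge0//.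
exact: sqr_dot_le.
Qed.

(** Householder reflection in the hyperplane orthogonal to [w]; for [w = 0] it is the identity,
    since division by 0 yields 0. *)
Definition refl w x := x - (2 * dot w x / dot w w) *: w.

Lemma refl_additive w : {morph refl w : x y / x + y}.
Proof.
move=> x y; rewrite /refl dotDr mulrDr mulrDl scalerDl opprD.
by rewrite !addrA; congr (_ + _); rewrite addrAC.
Qed.

Lemma dot_refl w x y : dot (refl w x) (refl w y) = dot x y.
Proof.
have [w0|w0] := eqVneq (dot w w) 0.
  by rewrite /refl w0 invr0 !mulr0 !scale0r !subr0.
by rewrite !(dotBl, dotBr, dotZl, dotZr) (dotC x w); field.
Qed.

Lemma reflK w : involutive (refl w).
Proof.
move=> x; have [w0|w0] := eqVneq (dot w w) 0.
  by rewrite /refl w0 invr0 !mulr0 !scale0r !subr0.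
rewrite /refl dotBr dotZr -addrA -opprD -scalerDl.
rewrite (_ : 2 * _ / _ + _ = 0) ?scale0r ?subr0//; by field.
Qed.

Lemma enorm_refl w x : enorm (refl w x) = enorm x.
Proof. by rewrite /enorm dot_refl. Qed.

Lemma dot_refll w x y : dot (refl w x) y = dot x (refl w y).
Proof. by rewrite -[in RHS](reflK w x) dot_refl. Qed.

Lemma refl_self w : refl w w = - w.
Proof.
have [w0|w0] := eqVneq (dot w w) 0.
  by rewrite /refl (dot_eq0 w0) scaler0 subr0 oppr0.
by rewrite /refl mulfK// scaler_nat mulr2n opprD addrA subrr add0r.
Qed.

Lemma refl_orth w x : dot w x = 0 -> refl w x = x.
Proof. by move=> wx; rewrite /refl wx mulr0 mul0r scale0r subr0. Qed.

(** For vectors of equal length, the hyperplane orthogonal to [x - y] is the perpendicular bisector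
    of the segment from [x] to [y]. *)
Lemma refl_swap x y : enorm x = enorm y -> refl (x - y) x = y.
Proof.
move=> /(congr1 (fun r => r ^+ 2)); rewrite !sqr_enorm => xy.
have [w0|w0] := eqVneq (dot (x - y) (x - y)) 0.
  by rewrite /refl (dot_eq0 w0) scaler0 subr0; move/dot_eq0/subr0_eq : w0.
rewrite /refl; have -> : 2 * dot (x - y) x / dot (x - y) (x - y) = 1.
  apply: (mulIf w0); rewrite mulfVK// mul1r.
  by rewrite !(dotBl, dotBr) (dotC y x) xy; ring.
by rewrite scale1r opprB addrC subrK.
Qed.

Lemma measurable_dot d' (T : measurableType d') (f g : T -> 'rV[R]_d) :
  measurable_fun setT f -> measurable_fun setT g ->
  measurable_fun setT (fun t => dot (f t) (g t)).
Proof.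
move=> mf mg; apply: measurable_sum => i.
by apply: measurable_funM; exact: measurable_rV_comp.
Qed.

Lemma measurable_sqrtr d' (T : measurableType d') (f : T -> R) :
  measurable_fun setT f -> measurable_fun setT (fun t => Num.sqrt (f t)).
Proof.
move=> mf; apply: (measurableT_comp _ mf); apply: continuous_measurable_fun.
exact: sqrt_continuous.
Qed.

Lemma measurable_enorm d' (T : measurableType d') (f : T -> 'rV[R]_d) :
  measurable_fun setT f -> measurable_fun setT (fun t => enorm (f t)).
Proof. by move=> mf; apply: measurable_sqrtr; exact: measurable_dot. Qed.

Lemma measurable_addrV d' (T : measurableType d') (f g : T -> 'rV[R]_d) :
  measurable_fun setT f -> measurable_fun setT g ->
  measurable_fun setT (fun t => f t + g t).
Proof.
move=> mf mg; apply: measurable_fun_rVP => i.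
under eq_fun do rewrite mxE.
by apply: measurable_funD; exact: measurable_rV_comp.
Qed.

Lemma measurable_scalerV d' (T : measurableType d') (f : T -> R) (g : T -> 'rV[R]_d) :
  measurable_fun setT f -> measurable_fun setT g ->
  measurable_fun setT (fun t => f t *: g t).
Proof.
move=> mf mg; apply: measurable_fun_rVP => i.
under eq_fun do rewrite mxE.
by apply: measurable_funM => //; exact: measurable_rV_comp.
Qed.

Lemma measurable_opprV d' (T : measurableType d') (f : T -> 'rV[R]_d) :
  measurable_fun setT f -> measurable_fun setT (fun t => - f t).
Proof.
move=> mf; apply: measurable_fun_rVP => i.
under eq_fun do rewrite mxE.
by apply: measurable_funN => //; exact: measurable_rV_comp.
Qed.

End euclidean.

Lemma measurable_invr (R : realType) d' (T : measurableType d') (f : T -> R) :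
  measurable_fun setT f -> measurable_fun setT (fun t => (f t)^-1).
Proof.
move=> mf; rewrite (_ : (fun _ => _) = fun t => f t * (f t ^+ 2) `^ (-1)).
  apply: measurable_funM => //; apply: (measurableT_comp (measurable_powR _)).
  exact: measurable_funX.
apply/funext => t; rewrite powR_inv1 ?sqr_ge0// expr2 invfM mulrA.
by have [->|f0] := eqVneq (f t) 0; [rewrite invr0 mulr0 | rewrite mulfV// mul1r].
Qed.

(** * Changes of variables for Lebesgue measure on R^d *)

Section change_of_variables.
Context d1 d2 (T1 : measurableType d1) (T2 : measurableType d2) (R : realType).
Context (m1 : {measure set T1 -> \bar R}) (m2 : {measure set T2 -> \bar R}).

Lemma ge0_integral_comp_scaled (phi : T1 -> T2) (c : R) (f : T2 -> \bar R) :
  measurable_fun setT phi -> 0 <= c ->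
  (forall A, measurable A -> m1 (phi @^-1` A) = c%:E * m2 A)%E ->
  measurable_fun setT f -> (forall y, 0 <= f y)%E ->
  (\int[m1]_x f (phi x) = c%:E * \int[m2]_y f y)%E.
Proof.
move=> mphi c0 phiE mf f0.
rewrite -(@ge0_integral_mscale _ _ _ m2 _ measurableT (NngNum c0))//.
transitivity (\int[pushforward m1 phi]_y f y)%E.
  by rewrite ge0_integral_pushforward.
apply: eq_measure_integral => A mA _.
exact: phiE.
Qed.

Lemma ge0_integral_comp (phi : T1 -> T2) (f : T2 -> \bar R) :
  measurable_fun setT phi ->
  (forall A, measurable A -> m1 (phi @^-1` A) = m2 A)%E ->
  measurable_fun setT f -> (forall y, 0 <= f y)%E ->
  (\int[m1]_x f (phi x) = \int[m2]_y f y)%E.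
Proof.
move=> mphi phiE mf f0; rewrite -[RHS]mul1e; apply: ge0_integral_comp_scaled => //.
by move=> A mA; rewrite mul1e phiE.
Qed.

End change_of_variables.

(** Provides the pushforward as a measure known only through its values, the form in which the
    uniqueness theorems for measures are applied to it. *)
Lemma pushforward_measure_ex d1 d2 (T1 : measurableType d1) (T2 : measurableType d2)
    (R : realType) (m : {measure set T1 -> \bar R}) (f : T1 -> T2) :
  measurable_fun setT f ->
  exists m' : {measure set T2 -> \bar R}, forall A, m' A = m (f @^-1` A).
Proof. by move=> mf; unshelve eexists (pushforward m f : {measure set T2 -> \bar R}). Qed.

Lemma measurable_indic_comp d1 d2 (T1 : measurableType d1) (T2 : measurableType d2)
    (R : realType) (A : set T2) (f : T1 -> T2) :
  measurable A -> measurable_fun setT f ->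
  measurable_fun setT (fun x => \1_A (f x) : R).
Proof.
by move=> mA mf; apply: (@measurableT_comp _ _ _ _ _ _ (\1_A : T2 -> R)).
Qed.

Section cons_rV.
Context (R : realType) (n : nat).

Lemma cons_rV0 (z : measurableTypeR R * 'rV[R]_n) : cons_rV n z 0 0 = z.1.
Proof.
transitivity (cons_rV n z 0 (lshift n (0 : 'I_1))).
  by congr (cons_rV n z 0 _); apply/val_inj.
by rewrite [LHS]row_mxEl mxE.
Qed.

Lemma cons_rVS (z : measurableTypeR R * 'rV[R]_n) j :
  cons_rV n z 0 (lift 0 j) = z.2 0 j.
Proof.
transitivity (cons_rV n z 0 (rshift 1 j)).
  by congr (cons_rV n z 0 _); apply/val_inj.
by rewrite [LHS]row_mxEr.
Qed.

Lemma measurable_cons_rV : measurable_fun setT (@cons_rV R n).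
Proof.
apply: measurable_fun_rVP => i; have [j ->|->] := unliftP 0 i.
  under eq_fun do rewrite cons_rVS.
  exact: measurable_rV_comp.
by under eq_fun do rewrite cons_rV0; exact: measurable_fst.
Qed.

Lemma cons_rVD z w : cons_rV n z + cons_rV n w = cons_rV n (z.1 + w.1, z.2 + w.2) :> 'rV[R]_n.+1.
Proof.
apply/rowP => i; rewrite [LHS]mxE; have [j ->|->] := unliftP 0 i.
  by rewrite !cons_rVS mxE.
by rewrite !cons_rV0.
Qed.

Lemma cons_rV_uncons (x : 'rV[R]_n.+1) :
  x = cons_rV n (x 0 0, \row_i x 0 (lift 0 i)).
Proof.
apply/rowP => i; have [j ->|->] := unliftP 0 i; last by rewrite cons_rV0.
by rewrite cons_rVS mxE.
Qed.

End cons_rV.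

Lemma lebesgue_measure_translate (R : realType) (a : R) (A : set (measurableTypeR R)) :
  measurable A -> lebesgue_measure ((fun x => x + a) @^-1` A) = lebesgue_measure A.
Proof.
move=> mA.
have ma : measurable_fun setT (fun x : measurableTypeR R => x + a : measurableTypeR R).
  by apply: measurable_funD.
have [m mE] := pushforward_measure_ex (@lebesgue_measure R) ma.
rewrite -mE; apply/esym; apply: lebesgue_measure_unique => // _ [[b c]] _ <-.
rewrite mE.
have -> : (fun x : R => x + a) @^-1` `]b, c] = `]b - a, c - a]%classic.
  by apply/seteqP; split => x /=; rewrite !in_itv/= ltrBlDr lerBrDr.
rewrite [RHS](lebesgue_measure_itv `]b - a, c - a]) [LHS]lebesgue_measure_itv/=.
by rewrite !lte_fin ltrD2r -!EFinD opprB addrA subrK.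
Qed.

(** * Translation invariance and uniqueness of Lebesgue measure *)

Section lebesgue_rV.
Context (R : realType).
Local Notation lam := (@lebesgue_rV R).

Lemma lebesgue_rVS n (A : set 'rV[R]_n.+1) :
  lam n.+1 A = (lebesgue_measure \x lam n)%E (@cons_rV R n @^-1` A).
Proof. by []. Qed.

(** Induction on the dimension: through [cons_rV] the measure is a product, a translation acts on
    each factor, and a product measure is determined by its values on rectangles. *)
Lemma lebesgue_rV_translate d (a : 'rV[R]_d) (A : set 'rV[R]_d) :
  measurable A -> lam d ((fun x => x + a) @^-1` A) = lam d A.
Proof.
elim: d a A => [|n IH] a A mA.
  by congr (dirac _ _); apply/funext => x; rewrite /preimage/= (_ : x + a = x)//;
    apply/rowP => -[].
rewrite !lebesgue_rVS.
pose a1 : R := a 0 0; pose a2 : 'rV[R]_n := \row_i a 0 (lift 0 i).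
pose sh (z : measurableTypeR R * 'rV[R]_n) : measurableTypeR R * 'rV[R]_n :=
  (z.1 + a1, z.2 + a2).
have msh : measurable_fun setT sh.
  apply/measurable_fun_pairP; split => /=.
    by apply: measurable_funD; [exact: measurable_fst|exact: measurable_cst].
  by apply: measurable_addrV; [exact: measurable_snd|exact: measurable_cst].
rewrite (_ : _ @^-1` (_ @^-1` A) = sh @^-1` (@cons_rV R n @^-1` A)); last first.
  by apply/funext => z; rewrite /preimage/= [in LHS](cons_rV_uncons a) cons_rVD.
have [m mE] := pushforward_measure_ex (lebesgue_measure \x lam n)%E msh.
rewrite -mE; apply/esym; apply: product_measure_unique; last first.
  by rewrite -[X in measurable X]setTI; exact: measurable_cons_rV.
move=> B C mB mC; rewrite mE.
have -> : sh @^-1` (B `*` C) = ((fun x => x + a1) @^-1` B) `*` ((fun x => x + a2) @^-1` C).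
  by [].
etransitivity; first apply: product_measure1E; last first.
- by congr (_ * _)%E; [exact: lebesgue_measure_translate|exact: IH].
- rewrite -[X in measurable X]setTI.
  have : measurable_fun setT (fun x : 'rV[R]_n => x + a2) by apply: measurable_addrV.
  by apply.
- rewrite -[X in measurable X]setTI.
  have : measurable_fun setT (fun x : measurableTypeR R => x + a1 : measurableTypeR R).
    by apply: measurable_funD.
  by apply.
Qed.

Lemma ge0_integral_translate d (a : 'rV[R]_d) (f : 'rV[R]_d -> \bar R) :
  measurable_fun setT f -> (forall x, 0 <= f x)%E ->
  (\int[lam d]_x f (x + a)%R = \int[lam d]_x f x)%E.
Proof.
move=> mf f0; apply: (@ge0_integral_comp _ _ _ _ R (lam d) (lam d) (fun x => x + a) f) => //.
  by apply: measurable_addrV.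
by move=> A mA; exact: lebesgue_rV_translate.
Qed.

(* Uniqueness of Haar measure, by Tonelli applied to
   [fun '(x, y) => \1_E (phi x + y) * \1_F y]. *)
Lemma lebesgue_rV_additive_preimage d (phi psi : 'rV[R]_d -> 'rV[R]_d) (E F : set 'rV[R]_d) :
  measurable_fun setT phi -> {morph phi : x y / x + y} -> cancel psi phi ->
  measurable E -> measurable F ->
  (lam d (phi @^-1` E) * lam d F =
   lam d E * lam d ((fun x => - phi x)%R @^-1` F))%E.
Proof.
move=> mphi phiD psiK mE mF.
have mpre (f : 'rV[R]_d -> 'rV[R]_d) A : measurable_fun setT f -> measurable A ->
    measurable (f @^-1` A).
  by move=> mf mA; rewrite -[X in measurable X]setTI; exact: mf.
have mI A : measurable A -> measurable_fun setT (fun x : 'rV[R]_d => (\1_A x : R)%:E).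
  by move=> mA; apply/measurable_EFinP; exact: measurable_indic.
have mfst (f : 'rV[R]_d -> 'rV[R]_d) : measurable_fun setT f ->
    measurable_fun setT (fun z : 'rV[R]_d * 'rV[R]_d => f z.1).
  by move=> mf; exact: (measurableT_comp mf measurable_fst).
have intI (A B : set 'rV[R]_d) y : measurable A ->
    (\int[lam d]_x ((\1_A x : R) * \1_B y)%:E = lam d A * (\1_B y)%:E)%E.
  move=> mA; under eq_integral do rewrite EFinM muleC.
  by rewrite ge0_integralZl ?lee_fin//; [rewrite integral_indic// setIT muleC|exact: mI].
pose G (z : 'rV[R]_d * 'rV[R]_d) : \bar R := ((\1_E (phi z.1 + z.2) : R) * \1_F z.2)%:E.
have G0 z : (0 <= G z)%E by rewrite lee_fin mulr_ge0.
have mG : measurable_fun setT G.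
  apply/measurable_EFinP; apply: measurable_funM.
    apply: measurable_indic_comp => //.
    by apply: measurable_addrV; [exact: mfst|exact: measurable_snd].
  by apply: measurable_indic_comp => //; exact: measurable_snd.
pose H (z : 'rV[R]_d * 'rV[R]_d) : \bar R := ((\1_F (z.2 - phi z.1) : R) * \1_E z.2)%:E.
have H0 z : (0 <= H z)%E by rewrite lee_fin mulr_ge0.
have mH : measurable_fun setT H.
  apply/measurable_EFinP; apply: measurable_funM.
    apply: measurable_indic_comp => //.
    apply: measurable_addrV; first exact: measurable_snd.
    by apply: measurable_opprV; exact: mfst.
  by apply: measurable_indic_comp => //; exact: measurable_snd.
transitivity (\int[lam d]_y \int[lam d]_x G (x, y))%E.
  rewrite -[X in (_ * lam d X)%E]setIT -integral_indic//.
  rewrite -ge0_integralZl//; last exact: mI.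
  apply: eq_integral => y _; rewrite /G/=.
  (* As [y] is the image of [psi y], [phi x + y] equals [phi (x + psi y)], and adding [y] amounts to
     a translation of [x]. *)
  have -> : lam d (phi @^-1` E) = lam d ((fun x => phi x + y) @^-1` E).
    rewrite -(lebesgue_rV_translate (psi y)); last exact: mpre.
    by congr (lam d _); apply/funext => x; rewrite /preimage/= phiD psiK.
  by rewrite -intI//; apply: mpre => //; apply: measurable_addrV.
transitivity (\int[lam d]_y \int[lam d]_x H (x, y))%E.
  apply: etrans (esym (fubini_tonelli (m1 := lam d) (m2 := lam d) G mG G0)) _.
  apply: etrans _ (fubini_tonelli (m1 := lam d) (m2 := lam d) H mH H0).
  apply: eq_integral => x _.
  (* With [x] fixed, translating [y] by [phi x] moves [phi] from the indicator of [E] to that of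
     [F]. *)
  rewrite -(ge0_integral_translate (phi x) (f := fun y => H (x, y)))//; last first.
    exact: (measurable_fun_pair2 x mH).
  by apply: eq_integral => y _; rewrite /G /H/= addrK mulrC (addrC y).
rewrite -[X in (lam d X * _)%E]setIT -integral_indic//.
rewrite -ge0_integralZr//; last exact: mI.
apply: eq_integral => y _; rewrite /H/=.
have -> : lam d ((fun x => - phi x) @^-1` F) = lam d ((fun x => y - phi x) @^-1` F).
  rewrite -(lebesgue_rV_translate (psi y) (A := (fun x => y - phi x) @^-1` F)).
    congr (lam d _); apply/funext => x; rewrite /preimage/= phiD psiK.
    by rewrite opprD addrCA subrr addr0.
  by apply: mpre => //; apply: measurable_addrV => //; exact: measurable_opprV.
rewrite muleC -intI//; apply: mpre => //.
by apply: measurable_addrV => //; exact: measurable_opprV.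
Qed.

End lebesgue_rV.

(** * Boxes, balls and images under linear maps *)

Section lebesgue_rV_linear.
Context (R : realType).
Local Notation lam := (@lebesgue_rV R).

Lemma measurable_preimage d1 d2 (T1 : measurableType d1) (T2 : measurableType d2)
  (f : T1 -> T2) A : measurable_fun setT f -> measurable A -> measurable (f @^-1` A).
Proof. by move=> mf mA; rewrite -[X in measurable X]setTI; exact: mf. Qed.

Definition boxV n (b : 'I_n -> R) : set 'rV[R]_n := [set x | forall i, `|x 0 i| < b i].

Lemma boxVS n (b : 'I_n.+1 -> R) :
  @cons_rV R n @^-1` (boxV b) =
  (`]- b 0, b 0[%classic : set (measurableTypeR R)) `*` boxV (fun i => b (lift 0 i)).
Proof.
apply/seteqP; split => -[a v]; rewrite /boxV /=.
  move=> bav; split; first by have := bav 0; rewrite cons_rV0 in_itv/= ltr_norml.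
  by move=> i; have := bav (lift 0 i); rewrite cons_rVS.
move=> [+ bv] i; rewrite in_itv/= -ltr_norml => ba.
by have [j ->|->] := unliftP 0 i; rewrite ?cons_rVS ?cons_rV0.
Qed.

Lemma measurable_boxV n (b : 'I_n -> R) : measurable (boxV b).
Proof.
rewrite (_ : boxV b = \bigcap_(i in [set: 'I_n]) [set x | `|x 0 i| < b i]).
  apply: fin_bigcap_measurable => [|i _]; first exact: finite_finset.
  have mf : measurable_fun setT (fun x : 'rV[R]_n => `|x 0 i|).
    by apply: measurableT_comp => //; exact: measurable_coord_rV.
  have := measurable_preimage mf (measurable_itv `]-oo, (b i)[).
  by congr (measurable _); apply/seteqP; split => x /=; rewrite in_itv.
by apply/seteqP; split => x bx i; [move=> _; exact: bx|exact: (bx i Logic.I)].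
Qed.

Lemma lebesgue_rV_box n (b : 'I_n -> R) : (forall i, 0 <= b i) ->
  lam n (boxV b) = (\prod_(i < n) (2 * b i))%:E.
Proof.
elim: n b => [|n IH] b b0.
  by rewrite big_ord0 /= diracE mem_set// => -[].
rewrite lebesgue_rVS boxVS.
etransitivity; first apply: product_measure1E => //; first exact: measurable_boxV.
rewrite big_ord_recl EFinM -IH//; congr (_ * _)%E.
rewrite [LHS]lebesgue_measure_itv/= lte_fin opprK.
case: ltP => // b0'; last first.
  by congr EFin; have := b0 0; lra.
by rewrite -EFinD mulr_natl mulr2n.
Qed.

Definition ballV d (r : R) : set 'rV[R]_d := [set x | enorm x < r].
Arguments ballV d r%_R : clear implicits.

Lemma ball_boxV d r : ballV d r `<=` boxV (fun=> r).
Proof. by move=> x xr i; exact: le_lt_trans (coord_le_enorm x i) xr. Qed.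

Lemma measurable_ballV d r : measurable (ballV d r).
Proof.
have mf : measurable_fun setT (@enorm R d) by apply: measurable_enorm.
have := measurable_preimage mf (measurable_itv `]-oo, r[).
by congr (measurable _); apply/seteqP; split => x /=; rewrite in_itv.
Qed.

Lemma lebesgue_rV_ball_lty d r : (lam d (ballV d r) < +oo)%E.
Proof.
have [r0|r0] := leP 0 r; last first.
  rewrite (_ : ballV d r = set0) ?measure0//; apply/seteqP; split => x //=.
  by move=> xr; have := lt_trans xr r0; rewrite ltNge enorm_ge0.
apply: le_lt_trans (_ : lam d (boxV (fun=> r)) < _)%E.
  apply: le_measure; rewrite ?inE; [exact: measurable_ballV|exact: measurable_boxV|].
  exact: ball_boxV.
by rewrite lebesgue_rV_box// ltry.
Qed.

Lemma lebesgue_rV_ball_gt0 d : (0 < lam d (ballV d 1))%E.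
Proof.
(* The box of half-side 1/(d+1) fits in the unit ball because d/(d+1)^2 is at most d/(d+1), which is
   less than 1; this covers d = 0 as well. *)
pose b : 'I_d -> R := fun=> d.+1%:R^-1.
have b0 i : 0 <= b i by rewrite invr_ge0.
apply: lt_le_trans (_ : (lam d (boxV b) <= _)%E).
  by rewrite lebesgue_rV_box// lte_fin prodr_gt0// => i _; rewrite mulr_gt0// invr_gt0.
apply: le_measure; rewrite ?inE; [exact: measurable_boxV|exact: measurable_ballV|].
move=> x bx; rewrite /ballV /= -(@ltr_pXn2r _ 2) ?nnegrE ?enorm_ge0// sqr_enorm expr1n.
apply: le_lt_trans (_ : \sum_(i < d) d.+1%:R^-1 < 1).
  apply: ler_sum => i _; rewrite -expr2 -real_normK ?num_real//.
  apply: le_trans (ltW (bx i)).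
  rewrite expr2 ler_piMr//; apply: le_trans (ltW (bx i)) _.
  by rewrite invf_le1 ?ler1n.
by rewrite sumr_const card_ord -[X in X < _]mulr_natl ltr_pdivrMr ?mul1r ?ltr_nat// ltr0n.
Qed.

Lemma alphaE d : lam d (ballV d 1) = (alpha R d)%:E.
Proof. by rewrite /alpha fineK// ge0_fin_numE// lebesgue_rV_ball_lty. Qed.

Lemma alpha_gt0 d : 0 < alpha R d.
Proof. by rewrite -lte_fin -alphaE lebesgue_rV_ball_gt0. Qed.

Lemma measurable_refl d (w : 'rV[R]_d) : measurable_fun setT (refl w).
Proof.
apply: measurable_addrV => //; apply: measurable_opprV.
apply: measurable_scalerV => //; apply: measurable_funM => //.
by apply: measurable_funM => //; apply: measurable_dot.
Qed.

(** The unit ball is invariant under the reflection and under negation, and its measure is positive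
    and finite; taken as the test set [F] in [lebesgue_rV_additive_preimage], it forces the scaling
    factor to be 1. *)
Lemma lebesgue_rV_refl d (w : 'rV[R]_d) A : measurable A ->
  lam d (refl w @^-1` A) = lam d A.
Proof.
move=> mA.
have := lebesgue_rV_additive_preimage (measurable_refl w)
  (refl_additive w) (reflK w) mA (@measurable_ballV d 1).
rewrite (_ : (fun x => - refl w x) @^-1` _ = ballV d 1); last first.
  by apply/funext => x; rewrite /preimage/ballV/= enormN enorm_refl.
rewrite alphaE => /(congr1 (fun x => x * ((alpha R d)^-1)%:E)%E).
by rewrite -!muleA -!EFinM mulfV ?gt_eqF ?alpha_gt0// !mule1.
Qed.

Lemma ge0_integral_refl d (w : 'rV[R]_d) (f : 'rV[R]_d -> \bar R) :
  measurable_fun setT f -> (forall x, 0 <= f x)%E ->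
  (\int[lam d]_x f (refl w x) = \int[lam d]_x f x)%E.
Proof.
move=> mf f0; apply: (@ge0_integral_comp _ _ _ _ R (lam d) (lam d) (refl w) f) => //.
  exact: measurable_refl.
by move=> A mA; exact: lebesgue_rV_refl.
Qed.

Definition diagV d (c : 'I_d -> R) (x : 'rV[R]_d) : 'rV[R]_d := \row_i (c i * x 0 i).

Lemma measurable_diagV d (c : 'I_d -> R) : measurable_fun setT (diagV c).
Proof.
apply: measurable_fun_rVP => i; under eq_fun do rewrite mxE.
by apply: measurable_funM => //; exact: measurable_coord_rV.
Qed.

(** Here the test set is the unit cube: its preimage is a box, and the ratio of the two volumes is
    the Jacobian factor. *)
Lemma lebesgue_rV_diag d (c : 'I_d -> R) A : (forall i, 0 < c i) -> measurable A ->
  (lam d (diagV c @^-1` A) = (\prod_i (c i)^-1)%:E * lam d A)%E.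
Proof.
move=> c0 mA.
have cD : {morph diagV c : x y / x + y}.
  by move=> x y; apply/rowP => i; rewrite !mxE mulrDr.
have cK : cancel (diagV (fun i => (c i)^-1)) (diagV c).
  by move=> x; apply/rowP => i; rewrite !mxE mulVKf ?gt_eqF.
have := lebesgue_rV_additive_preimage (measurable_diagV c) cD cK mA
  (measurable_boxV (fun=> 1)).
rewrite (_ : (fun x => - diagV c x) @^-1` _ = boxV (fun i => (c i)^-1)); last first.
  apply/seteqP; split => x /= cx i; have := cx i; rewrite !mxE normrN normrM;
    by rewrite (gtr0_norm (c0 i)) -ltr_pdivlMl// mulr1.
rewrite !lebesgue_rV_box//; last by move=> i; rewrite invr_ge0 ltW.
have -> : \prod_(i < d) (2 * (c i)^-1) = (\prod_(i < d) (c i)^-1) * \prod_(i < d) (2 * 1).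
  by rewrite -big_split; apply: eq_bigr => i _; rewrite mulr1 mulrC.
have p0 : \prod_(i < d) (2 * 1) != 0 :> R by apply/prodf_neq0.
move=> /(congr1 (fun x => x * ((\prod_(i < d) (2 * 1))^-1)%:E)%E).
by rewrite -!muleA -!EFinM mulfK// mulfV// mule1 muleC.
Qed.

Lemma ge0_integral_diag d (c : 'I_d -> R) (f : 'rV[R]_d -> \bar R) :
  (forall i, 0 < c i) -> measurable_fun setT f -> (forall x, 0 <= f x)%E ->
  (\int[lam d]_x f (diagV c x) = (\prod_i (c i)^-1)%:E * \int[lam d]_x f x)%E.
Proof.
move=> c0 mf f0.
apply: (@ge0_integral_comp_scaled _ _ _ _ R (lam d) (lam d) (diagV c) _ f) => //.
- exact: measurable_diagV.
- by apply: prodr_ge0 => i _; rewrite invr_ge0 ltW.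
- by move=> A mA; exact: lebesgue_rV_diag.
Qed.

Lemma ge0_integral_scale d (r : R) (f : 'rV[R]_d -> \bar R) :
  0 < r -> measurable_fun setT f -> (forall x, 0 <= f x)%E ->
  (\int[lam d]_x f (r *: x) = ((r ^+ d)^-1)%:E * \int[lam d]_x f x)%E.
Proof.
move=> r0 mf f0.
have rE x : r *: x = diagV (fun=> r) x :> 'rV[R]_d.
  by apply/rowP => i; rewrite !mxE.
under eq_integral do rewrite rE.
by rewrite ge0_integral_diag// prodr_const card_ord exprVn.
Qed.

Lemma ge0_integral_opp d (f : 'rV[R]_d -> \bar R) :
  measurable_fun setT f -> (forall x, 0 <= f x)%E ->
  (\int[lam d]_x f (- x)%R = \int[lam d]_x f x)%E.
Proof.
move=> mf f0.
apply: (@ge0_integral_comp _ _ _ _ R (lam d) (lam d) (-%R) f) => //.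
  exact: measurable_opprV.
move=> A mA.
have oD : {morph (-%R : 'rV[R]_d -> 'rV[R]_d) : x y / x + y} by move=> x y; rewrite opprD.
have mo : measurable_fun setT (-%R : 'rV[R]_d -> 'rV[R]_d) by exact: measurable_opprV.
have := lebesgue_rV_additive_preimage mo oD (@opprK _) mA (@measurable_ballV d 1).
rewrite (_ : (fun x => - - x) @^-1` _ = ballV d 1); last first.
  by apply/funext => x; rewrite /preimage/= opprK.
rewrite alphaE => /(congr1 (fun x => x * ((alpha R d)^-1)%:E)%E).
by rewrite -!muleA -!EFinM mulfV ?gt_eqF ?alpha_gt0// !mule1.
Qed.

End lebesgue_rV_linear.
Arguments ballV {R} d r%_R.

(** * One-dimensional integrals *)

Section calculus.
Context (R : realType).

Lemma FTC2_is_derive (f F : R -> R) (a b : R) : a < b ->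
  (forall x, a <= x <= b -> is_derive x 1 F (f x)) ->
  (forall x, a <= x <= b -> {for x, continuous f}) ->
  (\int[lebesgue_measure]_(x in `[a, b]) (f x)%:E = (F b - F a)%:E)%E.
Proof.
move=> ab dF cf.
have cF x : a <= x <= b -> {for x, continuous F}.
  by move=> /dF dFx; apply/differentiable_continuous/derivable1_diffP; exact: ex_derive.
rewrite (continuous_FTC2 (F := F))//.
- by apply/continuous_in_subspaceT => x; rewrite inE/= in_itv/=; exact: cf.
- split.
  + by move=> x; rewrite in_itv/= => /andP[ax xb]; apply: (@ex_derive _ _ _ _ _ _ _ (dF x _)); rewrite !ltW.
  + by apply: cvg_at_right_filter; apply: cF; rewrite lexx ltW.
  + by apply: cvg_at_left_filter; apply: cF; rewrite lexx ltW.
- move=> x; rewrite in_itv/= => /andP[ax xb]; rewrite derive1E.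
  by apply: (@derive_val _ _ _ _ _ _ _ (dF x _)); rewrite !ltW.
Qed.

Lemma FTC2y_is_derive (f F : R -> R) (a l : R) :
  (forall x, a <= x -> 0 <= f x) ->
  (forall x, a <= x -> is_derive x 1 F (f x)) ->
  (forall x, a <= x -> {for x, continuous f}) ->
  F x @[x --> +oo] --> l ->
  (\int[lebesgue_measure]_(x in `[a, +oo[) (f x)%:E = (l - F a)%:E)%E.
Proof.
move=> f0 dF cf Fl.
rewrite (ge0_continuous_FTC2y (F := F) (l := l))//.
- by apply/continuous_in_subspaceT => x; rewrite inE/= in_itv/= andbT; exact: cf.
- by move=> x ax; apply: (@ex_derive _ _ _ _ _ _ _ (dF x _)); rewrite !ltW.
- apply: cvg_at_right_filter; apply/differentiable_continuous/derivable1_diffP.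
  exact: (@ex_derive _ _ _ _ _ _ _ (dF a _)).
- move=> x; rewrite in_itv/= andbT => ax; rewrite derive1E.
  by apply: (@derive_val _ _ _ _ _ _ _ (dF x _)); rewrite !ltW.
Qed.

Lemma continuous_powR (p x : R) : 0 < x -> {for x, continuous (fun t : R => t `^ p)}.
Proof.
move=> x0; apply/differentiable_continuous/derivable1_diffP.
by apply: derivable_powR; rewrite in_itv/= x0.
Qed.

Lemma powR_cvgy (p : R) : 0 < p -> x `^ (- p) @[x --> +oo] --> (0 : R).
Proof.
move=> p0; apply/cvgrPdist_lt => e e0; near=> x.
have x0 : 0 < x by near: x; exact: nbhs_pinfty_gt.
rewrite sub0r normrN ger0_norm ?powR_ge0// powRN invf_plt ?posrE ?powR_gt0//.
rewrite -[X in X < _](@powRr1 _ e^-1) ?invr_ge0 ?ltW// -(mulVf (lt0r_neq0 p0)) powRrM.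
by rewrite gt0_ltr_powR ?nnegrE ?powR_ge0 ?ltW//.
Unshelve. all: by end_near. Qed.

Lemma integral_powR (p x : R) : 1 <= x ->
  (\int[lebesgue_measure]_(t in `[1%R, x]) (p * t `^ (p - 1))%:E = (x `^ p - 1)%:E)%E.
Proof.
rewrite le_eqVlt => /predU1P[<-|x1].
  by rewrite set_itv1 integral_set1 powR1 subrr.
have -> : x `^ p - 1 = x `^ p - 1 `^ p by rewrite powR1.
apply: (@FTC2_is_derive _ (fun t => t `^ p)) => // t /andP[t1 _].
  by apply: is_derive1_powR; exact: lt_le_trans t1.
apply: continuousM; first exact: cst_continuous.
by apply: continuous_powR; exact: lt_le_trans t1.
Qed.

Lemma integral_powRy (p a : R) : 0 < p -> 0 < a ->
  (\int[lebesgue_measure]_(t in `[a, +oo[) (p * t `^ (- p - 1))%:E = (a `^ (- p))%:E)%E.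
Proof.
move=> p0 a0; have -> : a `^ (- p) = 0 - - a `^ (- p) by rewrite opprK add0r.
apply: (@FTC2y_is_derive _ (fun t => - t `^ (- p))) => [t at_|t at_|t at_|].
- by rewrite mulr_ge0 ?powR_ge0// ltW.
- rewrite -[p in p * _]opprK mulNr; apply: is_deriveN.
  by apply: is_derive1_powR; exact: lt_le_trans at_.
- apply: continuousM; first exact: cst_continuous.
  by apply: continuous_powR; exact: lt_le_trans at_.
- by rewrite -oppr0; apply: cvgN; exact: powR_cvgy.
Qed.

Lemma integral_inv (a b : R) : 0 < a -> a <= b ->
  (\int[lebesgue_measure]_(t in `[a, b]) (t^-1)%:E = (ln b - ln a)%:E)%E.
Proof.
move=> a0; rewrite le_eqVlt => /predU1P[<-|ab].
  by rewrite set_itv1 integral_set1 subrr.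
apply: (@FTC2_is_derive _ (@ln R)) => // t /andP[ta _].
  by apply: is_derive1_ln; exact: lt_le_trans ta.
by apply: inv_continuous; rewrite gt_eqF//; exact: lt_le_trans ta.
Qed.

End calculus.

(* [measurableT_comp] in eta-expanded form, so that unification with a goal
   never has to choose between unfolding [\o] and unfolding [u]. *)
Lemma measurable_compT d1 d2 d3 (T1 : measurableType d1) (T2 : measurableType d2)
    (T3 : measurableType d3) (u : T2 -> T3) (g : T1 -> T2) :
  measurable_fun setT u -> measurable_fun setT g -> measurable_fun setT (fun t => u (g t)).
Proof. exact: measurableT_comp. Qed.

Lemma measurable_natrb d (T : measurableType d) (R : realType) (b : T -> bool) :
  measurable_fun setT b -> measurable_fun setT (fun x => (b x)%:R : R).
Proof.
move=> mb; rewrite (_ : (fun _ => _) = fun x => if b x then 1 else 0).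
  exact: measurable_fun_ifT.
by apply/funext => x; case: (b x).
Qed.

Lemma measurable_powRl d (T : measurableType d) (R : realType) (f : T -> R) p :
  measurable_fun setT f -> measurable_fun setT (fun x => f x `^ p).
Proof. by move=> mf; apply: (measurableT_comp (measurable_powR p) mf). Qed.

(** Measurability by recursion on the syntax of the body of the function, one clause for each
    operation; a function outside the list must come with a measurability hypothesis in the
    context. *)
Ltac mfun_lambda :=
  lazymatch goal with
  | |- measurable_fun _ (fun x => (@?f x)%:E) => apply/measurable_EFinP
  | |- measurable_fun _ (EFin \o _) => apply/measurable_EFinP
  | |- measurable_fun _ (fun _ => ?c) => exact: measurable_cst
  | |- measurable_fun _ (fun x => x) => exact: measurable_id
  | |- measurable_fun _ (fun x => x.1) => exact: measurable_fst
  | |- measurable_fun _ (fun x => x.2) => exact: measurable_snd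
  | |- measurable_fun _ (fun x => (@?f x, @?g x)) => apply: measurable_fun_pair
  | |- measurable_fun _ (fun x => (@?f x) + - (@?g x)) =>
      first [apply: measurable_funB | apply: measurable_addrV]
  | |- measurable_fun _ (fun x => (@?f x) + (@?g x)) =>
      first [apply: measurable_funD | apply: measurable_addrV]
  | |- measurable_fun _ (fun x => - (@?f x)) =>
      first [apply: measurable_funN | apply: measurable_opprV]
  | |- measurable_fun _ (fun x => (@?f x) * (@?g x)) => apply: measurable_funM
  | |- measurable_fun _ (fun x => (@?f x)^-1) => apply: measurable_invr
  | |- measurable_fun _ (fun x => (@?f x) ^+ ?n) => apply: measurable_funX
  | |- measurable_fun _ (fun x => (@?f x) `^ ?n) => apply: measurable_powRl
  | |- measurable_fun _ (fun x => `|@?f x|) => apply: (measurableT_comp (@normr_measurable _ setT))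
  | |- measurable_fun _ (fun x => Num.sqrt (@?f x)) => apply: measurable_sqrtr
  | |- measurable_fun _ (fun x => dot (@?f x) (@?g x)) => apply: measurable_dot
  | |- measurable_fun _ (fun x => enorm (@?f x)) => apply: measurable_enorm
  | |- measurable_fun _ (fun x => (@?f x) *: (@?g x)) => apply: measurable_scalerV
  | |- measurable_fun _ (fun x => fun_of_matrix (@?f x) _ ?i) => apply: measurable_rV_comp
  | |- measurable_fun _ (fun x => \1_(_) (@?f x)) => apply: measurable_indic_comp => //
  | |- measurable_fun _ (fun x => (nat_of_bool (@?b x))%:R) => apply: measurable_natrb
  | |- measurable_fun _ (fun x => (@?f x < @?g x)%R) => apply: measurable_fun_ltr
  | |- measurable_fun _ (fun x => (@?f x <= @?g x)%R) => apply: measurable_fun_ler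
  | |- measurable_fun _ id => exact: measurable_id
  | |- measurable_fun _ (cst _) => exact: measurable_cst
  | |- measurable_fun _ (fun x => (@?f x) && (@?g x)) => apply: measurable_and
  | mu : measurable_fun _ ?u |- measurable_fun _ (fun t => ?u (@?g t)) =>
      refine (@measurable_compT _ _ _ _ _ _ u g mu _)
  end.
(* Non-linear Ltac patterns are matched up to conversion, which may unfold
   integrals, hence the syntactic comparison of atoms. *)
Ltac mfun_atom :=
  match goal with
  | mu : measurable_fun _ ?u |- measurable_fun _ ?v => constr_eq u v; exact: mu
  end.
Ltac mfun_step :=
  lazymatch goal with
  | |- measurable_fun ?D (?h ?a) =>
      first [mfun_atom | change (measurable_fun D (fun x => h a x)); mfun_lambda]
  | |- measurable_fun _ ?f =>
      tryif first [is_var f | is_const f] then mfun_atom else mfun_lambda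
  end.
Ltac mfun := repeat mfun_step.

(** * Tonelli's theorem and integrals of nonnegative real functions *)

Section tonelli.
Context d1 d2 (T1 : measurableType d1) (T2 : measurableType d2) (R : realType).
Context (m1 : {sigma_finite_measure set T1 -> \bar R}).
Context (m2 : {sigma_finite_measure set T2 -> \bar R}).

Lemma tonelli (f : T1 -> T2 -> R) :
  measurable_fun setT (fun z : T1 * T2 => f z.1 z.2) -> (forall x y, 0 <= f x y) ->
  (\int[m1]_x \int[m2]_y (f x y)%:E = \int[m2]_y \int[m1]_x (f x y)%:E)%E.
Proof.
move=> mf f0; apply: (fubini_tonelli (m1 := m1) (m2 := m2) (fun z => (f z.1 z.2)%:E)) => /=.
  exact/measurable_EFinP.
by move=> z; rewrite lee_fin.
Qed.

Lemma ge0_integral_prod (f : T1 * T2 -> R) :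
  measurable_fun setT f -> (forall z, 0 <= f z) ->
  (\int[m1 \x m2]_z (f z)%:E = \int[m1]_x \int[m2]_y (f (x, y))%:E)%E.
Proof.
move=> mf f0; apply: (fubini_tonelli1 (m1 := m1) (m2 := m2) (fun z => (f z)%:E)) => /=.
  exact/measurable_EFinP.
by move=> z; rewrite lee_fin.
Qed.

End tonelli.

Section ge0_real_integral.
Context d (T : measurableType d) (R : realType) (mu : {measure set T -> \bar R}).

Lemma ge0_intZl (c : R) (f : T -> R) : 0 <= c -> measurable_fun setT f -> (forall x, 0 <= f x) ->
  (\int[mu]_x (c * f x)%:E = c%:E * \int[mu]_x (f x)%:E)%E.
Proof.
move=> c0 mf f0; under eq_integral do rewrite EFinM.
by rewrite ge0_integralZl_EFin//; [move=> x _; rewrite lee_fin|exact/measurable_EFinP].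
Qed.

Lemma ge0_intD (f g : T -> R) : measurable_fun setT f -> measurable_fun setT g ->
  (forall x, 0 <= f x) -> (forall x, 0 <= g x) ->
  (\int[mu]_x (f x + g x)%:E = \int[mu]_x (f x)%:E + \int[mu]_x (g x)%:E)%E.
Proof.
move=> mf mg f0 g0; under eq_integral do rewrite EFinD.
by rewrite ge0_integralD//; (try by move=> x _; rewrite lee_fin); exact/measurable_EFinP.
Qed.

Lemma ge0_le_int (f g : T -> R) : (forall x, 0 <= f x) -> (forall x, f x <= g x) ->
  (\int[mu]_x (f x)%:E <= \int[mu]_x (g x)%:E)%E.
Proof. by move=> f0 fg; apply: ge0_le_integralT => x; rewrite lee_fin. Qed.

Lemma int_ge0 (f : T -> R) : (forall x, 0 <= f x) -> (0 <= \int[mu]_x (f x)%:E)%E.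
Proof. by move=> f0; apply: integral_ge0 => x _; rewrite lee_fin. Qed.

(** Domains of integration are written as boolean factors, so that one condition on a pair [(h, t)]
    can be read as a domain for either variable after an exchange of integrals. *)
Lemma int_natrb (D : set T) (b : T -> bool) (f : T -> R) :
  (forall x, D x <-> b x) ->
  (\int[mu]_x ((b x)%:R * f x)%:E = \int[mu]_(x in D) (f x)%:E)%E.
Proof.
move=> Db; rewrite [RHS]integral_mkcond; apply: eq_integral => x _.
rewrite patchE; case: (boolP (b x)) => bx; first by rewrite mem_set ?mul1r//; exact/Db.
by rewrite memNset ?mul0r// => /Db; rewrite (negbTE bx).
Qed.

End ge0_real_integral.

(** * Integrals of functions homogeneous of degree 0 *)

Section polar.
Context (R : realType) (d : nat).
Local Notation lam := (@lebesgue_rV R d).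
Local Notation leb := (@lebesgue_measure R).
Implicit Types (f g k : 'rV[R]_d -> R).

Lemma ge0_int_scale (t : R) g : 0 < t -> measurable_fun setT g -> (forall x, 0 <= g x) ->
  (\int[lam]_h (g h)%:E = (t ^+ d)%:E * \int[lam]_h (g (t *: h)%R)%:E)%E.
Proof.
move=> t0 mg g0; rewrite (@ge0_integral_scale _ _ _ (fun h => (g h)%:E))//.
- by rewrite muleA -EFinM mulfV ?mul1e// gt_eqF// exprn_gt0.
- exact/measurable_EFinP.
Qed.

Lemma int_itv_co (a b : R) (phi : R -> R) : a <= b -> measurable_fun setT phi ->
  (\int[leb]_t (((a <= t) && (t < b))%R%:R * phi t)%:E =
   \int[leb]_(t in `[a, b]) (phi t)%:E)%E.
Proof.
move=> ab mphi.
etransitivity; first (apply: (@int_natrb _ _ _ leb `[a, b[%classic _ phi) => x).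
  by rewrite /= in_itv/=.
apply: integral_itv_bndo_bndc; apply/measurable_EFinP; exact: measurable_funS mphi.
Qed.

Lemma int_itv_cy (a : R) (phi : R -> R) :
  (\int[leb]_t ((a <= t)%R%:R * phi t)%:E = \int[leb]_(t in `[a, +oo[) (phi t)%:E)%E.
Proof. by apply: int_natrb => x; rewrite /= in_itv/= andbT. Qed.

Lemma measurable_tonelli_inner (F : 'rV[R]_d -> R -> R) :
  measurable_fun setT (fun z : 'rV[R]_d * R => F z.1 z.2) -> (forall h t, 0 <= F h t) ->
  measurable_fun setT (fun h => \int[leb]_t (F h t)%:E)%E.
Proof.
move=> mF F0; apply: (measurable_fun_fubini_tonelli_F (m2 := leb) (fun z => (F z.1 z.2)%:E)) => /=.
  exact/measurable_EFinP.
by move=> z; rewrite lee_fin.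
Qed.

Section homogeneous.
Variable f : 'rV[R]_d -> R.
Hypotheses (mf : measurable_fun setT f) (f0 : forall h, 0 <= f h).
Hypotheses (f00 : f 0 = 0) (fZ : forall t h, 0 < t -> f (t *: h) = f h).

(** For 0 < |h| < 1, |h|^-beta is 1 plus the integral of beta t^(beta-1) over 1 <= t < 1/|h|. After
    Tonelli, the layer at t is an integral over the ball of radius 1/t, which homogeneity rescales
    to t^-d times the integral over the unit ball; the remaining integral in t is beta/(d-beta), and
    1 + beta/(d-beta) is the stated factor. *)
Lemma int_homogeneous_powR (beta : R) : 0 < beta < d%:R ->
  (\int[lam]_h (f h * ((enorm h < 1)%R%:R * enorm h `^ (- beta)))%:E =
   (d%:R / (d%:R - beta))%:E * \int[lam]_h (f h * (enorm h < 1)%R%:R)%:E)%E.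
Proof.
move=> /andP[b0 bd].
pose B h (t : R) := f h * (((1 <= t)%R && (t * enorm h < 1)%R)%:R * (beta * t `^ (beta - 1))).
have B0 h t : 0 <= B h t by rewrite !mulr_ge0// ?powR_ge0// ltW.
have mB : measurable_fun setT (fun z : 'rV[R]_d * R => B z.1 z.2) by rewrite /B; mfun.
set I0 := (\int[lam]_h (f h * (enorm h < 1)%R%:R)%:E)%E.
have I00 : (0 <= I0)%E by apply: int_ge0 => h; rewrite mulr_ge0.
transitivity (\int[lam]_h ((f h * (enorm h < 1)%R%:R)%:E + \int[leb]_t (B h t)%:E))%E.
  apply: eq_integral => h _.
  (* At the origin the layers fill the whole half-line t >= 1 and their integral diverges; [f 0 = 0]
     discards this point. *)
  have [->|h0] := eqVneq h 0.
    by rewrite f00 !mul0r add0e integral0_eq// => t _; rewrite /B f00 mul0r.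
  have eh0 := enorm_gt0 h0.
  rewrite ge0_intZl//; [|mfun|by move=> t; rewrite !mulr_ge0// ?powR_ge0// ltW].
  have [h1|h1] := ltP (enorm h) 1; last first.
    rewrite integral0_eq ?mule0 ?mulr0 ?mul0r ?mulr0 ?adde0// => t _.
    case: andP => [[t1]|]; rewrite ?mul0r//.
    by rewrite ltNge (le_trans h1)// ler_peMl// ltW.
  under eq_integral do rewrite -ltr_pdivlMr// mul1r.
  have h1' : 1 <= (enorm h)^-1 by rewrite invf_ge1// ltW.
  rewrite int_itv_co//; last by mfun.
  rewrite integral_powR//.
  rewrite -EFinM -EFinD; congr EFin.
  rewrite -powR_inv1 ?ltW// -powRrM mulN1r/=; ring.
rewrite ge0_integralD//=; last 4 first.
- by move=> h _; rewrite lee_fin mulr_ge0.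
- by mfun.
- by move=> h _; apply: int_ge0.
- exact: measurable_tonelli_inner.
rewrite tonelli// -/I0.
pose p := d%:R - beta; have p0 : 0 < p by rewrite subr_gt0.
transitivity (I0 + \int[leb]_t (I0 * ((beta / p)%:E * ((1 <= t)%R%:R * (p * t `^ (- p - 1)))%:E)))%E.
  congr (_ + _)%E; apply: eq_integral => t _.
  have [t1|t1] := leP 1 t; last first.
    rewrite !mul0r !mule0 integral0_eq// => h _.
    by rewrite /B leNgt t1 !mul0r mulr0.
  have t0 : 0 < t by exact: lt_le_trans t1.
  have -> : I0 = ((t ^+ d)%:E *
      \int[lam]_h (f (t *: h) * (enorm (t *: h) < 1)%R%:R)%:E)%E.
    rewrite /I0 (@ge0_int_scale t (fun h => f h * (enorm h < 1)%R%:R))//; first by mfun.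
    by move=> h; rewrite mulr_ge0.
  under eq_integral => h _.
    rewrite /B t1/= (_ : _ * _ = (beta * t `^ (beta - 1)) *
      (f (t *: h) * (enorm (t *: h) < 1)%R%:R)); last first.
      by rewrite fZ// enormZ gtr0_norm//; ring.
    over.
  rewrite ge0_intZl//; last 3 first.
  - by rewrite mulr_ge0 ?powR_ge0// ltW.
  - by mfun.
  - by move=> h; rewrite mulr_ge0.
  rewrite (muleC (_ * _)%E) muleA -!EFinM; congr (_%:E * _)%E.
  rewrite mul1r mulrA (mulrVK (unitf_gt0 p0)) -mulrA; congr (_ * _).
  rewrite -powR_mulrn ?ltW// -powRD; last by rewrite (gt_eqF t0) implybT.
  by congr (_ `^ _); rewrite /p; ring.
rewrite ge0_integralZl//; last 2 first.
- by apply: emeasurable_funM => //; mfun.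
- move=> t _; rewrite -EFinM lee_fin !mulr_ge0// ?invr_ge0 ?powR_ge0// ltW//.
rewrite ge0_integralZl_EFin//; last 3 first.
- by move=> t _; rewrite lee_fin !mulr_ge0// ?powR_ge0// ltW.
- by mfun.
- by rewrite divr_ge0// ltW.
rewrite int_itv_cy integral_powRy// powR1 mule1.
have bp0 : 0 <= beta / p by rewrite divr_ge0// ltW.
have -> : (I0 + I0 * (beta / p)%:E = I0 * (1 + beta / p)%:E)%E.
  by rewrite EFinD ge0_muleDr ?mule1// lee_fin.
rewrite muleC; congr (_%:E * _)%E.
by rewrite /p; field; rewrite subr_eq0 gt_eqF.
Qed.

Lemma int_inv_co (a b : R) : 0 < a -> a <= b ->
  (\int[leb]_t (((a <= t) && (t < b))%R%:R * t^-1)%:E = (ln b - ln a)%:E)%E.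
Proof.
move=> a0 ab; rewrite int_itv_co//; first exact: integral_inv.
by mfun.
Qed.

End homogeneous.
End polar.

Section polar.
Context (R : realType) (d : nat).
Local Notation lam := (@lebesgue_rV R d).
Local Notation leb := (@lebesgue_measure R).
Variable f : 'rV[R]_d -> R.
Hypotheses (mf : measurable_fun setT f) (f0 : forall h, 0 <= f h).
Hypotheses (f00 : f 0 = 0) (fZ : forall t h, 0 < t -> f (t *: h) = f h).

(* Both sides equal the integral of [f h * d * ln (k h / enorm h)] over
   [enorm h < k h], computed by layering in two different ways. *)
Lemma int_homogeneous_star (k : 'rV[R]_d -> R) : (0 < d)%N -> measurable_fun setT k ->
  (forall h, h != 0 -> 0 < k h) -> (forall t h, 0 < t -> k (t *: h) = k h) ->
  (\int[lam]_h (f h * (enorm h < k h)%R%:R)%:E =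
   \int[lam]_h (f h * ((enorm h < 1)%R%:R * k h ^+ d))%:E)%E.
Proof.
move=> d_gt0 mk k0 kZ.
have [p pE] : {p : R | p = d%:R} by exists d%:R.
have p0 : 0 < p by rewrite pE ltr0n.
have powp t : 0 < t -> t `^ (- p - 1) = (t ^+ d)^-1 * t^-1.
  move=> t0; rewrite powRD; last by rewrite (gt_eqF t0) implybT.
  by rewrite powR_inv1 ?ltW// powRN pE powR_mulrn ?ltW.
(* The logarithm of [k h / enorm h] is the integral of 1/t over [1, k h / |h|) as well as over [1 /
   k h, 1 / |h|): [X] and [Y] are these two layerings. *)
pose X h t := f h * (((1 <= t)%R && (t < k h / enorm h)%R)%:R * t^-1).
pose Y h t := f h * ((((k h)^-1 <= t)%R && (t < (enorm h)^-1)%R)%:R * t^-1).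
have mX : measurable_fun setT (fun z : 'rV[R]_d * R => X z.1 z.2) by rewrite /X; mfun.
have mY : measurable_fun setT (fun z : 'rV[R]_d * R => Y z.1 z.2) by rewrite /Y; mfun.
have kV0 h : h != 0 -> 0 < (k h)^-1 by move=> h0; rewrite invr_gt0 k0.
have X0 h t : 0 <= X h t.
  apply: mulr_ge0 => //; case: andP => [[t1 _]|_]; last by rewrite mul0r.
  by rewrite mul1r invr_ge0 (le_trans _ t1).
have Y0 h t : 0 <= Y h t.
  have [->|h0] := eqVneq h 0; first by rewrite /Y f00 mul0r.
  apply: mulr_ge0 => //; case: andP => [[t1 _]|_]; last by rewrite mul0r.
  by rewrite mul1r invr_ge0 (le_trans _ t1)// ltW// kV0.
(* Replacing [h] by [t *: h] shows that the layer of [X] at t is t^(-d-1) times the left-hand side,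
   and d t^(-d-1) has integral 1 over t >= 1. *)
transitivity (p%:E * \int[lam]_h \int[leb]_t (X h t)%:E)%E.
  rewrite (tonelli lam leb mX X0).
  transitivity (p%:E * \int[leb]_t ((\int[lam]_h (f h * (enorm h < k h)%R%:R)%:E) *
      (p^-1 * ((1 <= t)%R%:R * (p * t `^ (- p - 1))))%:E))%E.
    have : (0 <= \int[lam]_h (f h * (enorm h < k h)%R%:R)%:E)%E.
      by apply: int_ge0 => h; rewrite mulr_ge0.
    move: (\int[lam]_h _)%E => J J0.
    have mT : measurable_fun setT (fun t : R => (1 <= t)%R%:R * (p * t `^ (- p - 1))) by mfun.
    have T0 t : 0 <= (1 <= t)%R%:R * (p * t `^ (- p - 1)).
      by rewrite mulr_ge0// mulr_ge0 ?powR_ge0// ltW.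
    rewrite ge0_integralZl.
    - rewrite ge0_intZl ?invr_ge0 ?(ltW p0)//.
      rewrite int_itv_cy integral_powRy// powR1 mule1.
      by rewrite muleC -muleA -EFinM mulVf ?gt_eqF// mule1.
    - exact: measurableT.
    - by apply/measurable_EFinP/measurable_funM.
    - by move=> t _; rewrite lee_fin mulr_ge0// invr_ge0 ltW.
    - exact: J0.
  apply: congr1; apply: eq_integral => t _; apply/esym.
  have [t1|t1] := leP 1 t; last first.
    rewrite !mul0r !mulr0 !mule0 integral0_eq// => h _.
    by rewrite /X leNgt t1 !mul0r mulr0.
  have t0 : 0 < t by exact: lt_le_trans t1.
  under [LHS]eq_integral => h _.
    rewrite /X t1/= (_ : _ * _ = t^-1 * (f (t *: h) * (enorm (t *: h) < k (t *: h))%R%:R)); last first.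
      rewrite fZ// kZ// enormZ gtr0_norm//.
      have [->|h0] := eqVneq h 0; first by rewrite f00 !mul0r mulr0.
      by rewrite ltr_pdivlMr ?enorm_gt0//; ring.
    over.
  rewrite ge0_intZl//; last 3 first.
  - by rewrite invr_ge0 ltW.
  - by mfun.
  - by move=> h; rewrite mulr_ge0.
  rewrite (@ge0_integral_scale _ _ t (fun h => (f h * (enorm h < k h)%R%:R)%:E))//; last 2 first.
  - by mfun.
  - by move=> h; rewrite lee_fin mulr_ge0.
  rewrite muleA -EFinM [LHS]muleC; congr (_ * _%:E)%E.
  by rewrite mul1r mulKf ?gt_eqF// powp// mulrC.
transitivity (p%:E * \int[lam]_h \int[leb]_t (Y h t)%:E)%E.
  congr (_ * _)%E; apply: eq_integral => h _; have [->|h0] := eqVneq h 0.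
    by rewrite /X /Y f00; under eq_integral do rewrite mul0r;
       under [RHS]eq_integral do rewrite mul0r.
  have eh0 := enorm_gt0 h0; have kh0 := k0 _ h0.
  have [hk|hk] := leP (k h) (enorm h).
    transitivity (0 : \bar R)%E; [|apply/esym]; apply: integral0_eq => t _.
      rewrite /X; case: andP => [[t1 t2]|]; last by rewrite mul0r mulr0.
      by have := le_lt_trans t1 t2; rewrite ltr_pdivlMr// mul1r ltNge hk.
    rewrite /Y; case: andP => [[t1 t2]|]; last by rewrite mul0r mulr0.
    by have := le_lt_trans t1 t2; rewrite ltf_pV2 ?posrE// ltNge hk.
  rewrite /X /Y.
  have pX t : 0 <= ((1 <= t)%R && (t < k h / enorm h)%R)%:R * t^-1.
    case: andP => [[t1 _]|_]; last by rewrite mul0r.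
    by rewrite mul1r invr_ge0 (le_trans _ t1).
  have pY t : 0 <= (((k h)^-1 <= t)%R && (t < (enorm h)^-1)%R)%:R * t^-1.
    case: andP => [[t1 _]|_]; last by rewrite mul0r.
    by rewrite mul1r invr_ge0 (le_trans _ t1)// ltW// kV0.
  rewrite ge0_intZl//; last by mfun.
  rewrite [RHS]ge0_intZl//; last by mfun.
  congr (_ * _)%E.
  rewrite int_inv_co//; last by rewrite ler_pdivlMr// mul1r ltW.
  rewrite int_inv_co ?kV0//; last by rewrite lef_pV2 ?posrE// ltW.
  by rewrite ln1 ln_div ?posrE// !lnV ?posrE//; congr EFin; ring.
rewrite (tonelli lam leb mY Y0).
(* Rescaling by t turns |h| < 1/t into the unit ball and leaves the density t^(-d-1) on t >= 1/k(h),
   whose integral times d is k(h)^d. *)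
pose W h t := f h * ((enorm h < 1)%R%:R * (((k h)^-1 <= t)%R%:R * t `^ (- p - 1))).
have W0 h t : 0 <= W h t by rewrite !mulr_ge0// ?powR_ge0.
have mW : measurable_fun setT (fun z : 'rV[R]_d * R => W z.1 z.2) by rewrite /W; mfun.
have WI h : (0 <= \int[leb]_t (W h t)%:E)%E by exact: int_ge0.
have mWI := measurable_tonelli_inner mW W0.
transitivity (p%:E * \int[leb]_t \int[lam]_h (W h t)%:E)%E.
  apply: congr1; apply: eq_integral => t _.
  have [t0|t0] := leP t 0.
    transitivity (0 : \bar R)%E; [|apply/esym]; apply: integral0_eq => h _.
      have [->|h0] := eqVneq h 0; first by rewrite /Y f00 mul0r.
      by rewrite /Y leNgt (le_lt_trans t0 (kV0 _ h0)) !mul0r mulr0.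
    have [->|h0] := eqVneq h 0; first by rewrite /W f00 mul0r.
    by rewrite /W [_ <= t]leNgt (le_lt_trans t0 (kV0 _ h0)) !mul0r !mulr0.
  pose g h := f h * ((enorm h < 1)%R%:R * ((k h)^-1 <= t)%R%:R).
  have mg : measurable_fun setT g by rewrite /g; mfun.
  have g0 h : 0 <= g h by rewrite !mulr_ge0.
  transitivity (\int[lam]_h (t `^ (- p - 1) * g h)%:E)%E; last first.
    by apply: eq_integral => h _; rewrite /W /g; congr EFin; ring.
  rewrite ge0_intZl ?powR_ge0//.
  transitivity (\int[lam]_h (t^-1 * g (t *: h))%:E)%E.
    apply: eq_integral => h _; rewrite /Y /g fZ// kZ// enormZ gtr0_norm//.
    have [->|h0] := eqVneq h 0; first by rewrite f00 !mul0r mulr0.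
    rewrite -[in RHS]ltr_pdivlMr ?enorm_gt0// mul1r -mulnb natrM.
    by congr EFin; ring.
  rewrite ge0_intZl// ?invr_ge0 ?ltW//; last by mfun.
  rewrite (@ge0_integral_scale _ _ t (fun h => (g h)%:E))//; last by mfun.
  rewrite muleA -!EFinM; congr (_%:E * _)%E.
  by rewrite powp// mulrC.
rewrite -(tonelli lam leb mW W0).
rewrite -ge0_integralZl_EFin.
- apply: eq_integral => h _.
  have [->|h0] := eqVneq h 0.
    by rewrite f00 mul0r integral0_eq ?mule0// => t _; rewrite /W f00 mul0r.
  rewrite /W ge0_intZl//; last 2 first.
  - by mfun.
  - by move=> t; rewrite !mulr_ge0// powR_ge0.
  rewrite ge0_intZl//; last 2 first.
  - by mfun.
  - by move=> t; rewrite !mulr_ge0// powR_ge0.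
  rewrite muleCA; rewrite [in RHS]EFinM; congr (_ * _)%E.
  rewrite muleCA EFinM; congr (_ * _)%E.
  rewrite -ge0_intZl//; last 3 first.
  - exact: ltW.
  - by mfun.
  - by move=> t; rewrite !mulr_ge0// powR_ge0.
  under eq_integral do rewrite mulrCA.
  rewrite int_itv_cy integral_powRy ?kV0//.
  by rewrite powRN pE powR_mulrn ?invr_ge0 ?ltW ?k0// exprVn invrK.
- exact: measurableT.
- by move=> h _; exact: WI.
- exact: mWI.
- exact: ltW.
Qed.

End polar.

(** * The spherical average *)

Section direction.
Context (R : realType) (n : nat).
Local Notation d := n.+1.
Local Notation lam := (@lebesgue_rV R d).
Local Notation leb := (@lebesgue_measure R).
Implicit Types (a b h x : 'rV[R]_d).

Definition dir h : 'rV[R]_d := (enorm h)^-1 *: h.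

Lemma measurable_dir d' (T : measurableType d') (f : T -> 'rV[R]_d) :
  measurable_fun setT f -> measurable_fun setT (fun t => dir (f t)).
Proof. by move=> mf; rewrite /dir; mfun. Qed.

Lemma dir0 : dir 0 = 0.
Proof. by rewrite /dir scaler0. Qed.

Lemma dirZ t h : 0 < t -> dir (t *: h) = dir h.
Proof.
move=> t0; rewrite /dir enormZ gtr0_norm// scalerA invfM mulrAC mulVf ?mul1r//.
by rewrite gt_eqF.
Qed.

Lemma dot_dir a h : dot a (dir h) = dot a h / enorm h.
Proof. by rewrite dotZr mulrC. Qed.

Lemma enorm_dir h : h != 0 -> enorm (dir h) = 1.
Proof.
move=> /enorm_gt0 h0; rewrite enormZ ger0_norm ?invr_ge0 ?enorm_ge0//.
by rewrite mulVf// gt_eqF.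
Qed.

Lemma enorm_dir_le1 h : enorm (dir h) <= 1.
Proof.
by have [->|h0] := eqVneq h 0; [rewrite dir0 enorm0|rewrite enorm_dir].
Qed.

Lemma dot_dir_le a h : `|dot a (dir h)| <= enorm a.
Proof.
apply: le_trans (dot_le_enorm _ _) _.
by rewrite ler_piMr ?enorm_ge0// enorm_dir_le1.
Qed.

Lemma dir_refl w h : dir (refl w h) = refl w (dir h).
Proof.
rewrite /dir enorm_refl /refl dotZr scalerBr !scalerA; congr (_ - _ *: _).
by ring.
Qed.

Definition axis (i : 'I_d) : 'rV[R]_d := delta_mx 0 i.

Lemma dot_axis i x : dot (axis i) x = x 0 i.
Proof.
rewrite /dot (bigD1 i)//= big1 ?addr0; last first.
  by move=> j ji; rewrite mxE eqxx (negbTE ji) mul0r.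
by rewrite mxE !eqxx mul1r.
Qed.

Lemma enorm_axis i : enorm (axis i) = 1.
Proof. by rewrite /enorm dot_axis mxE !eqxx sqrtr1. Qed.

Lemma measurable_set0V : measurable [set (0 : 'rV[R]_d)].
Proof.
rewrite (_ : [set 0] = (@enorm R d) @^-1` [set 0]).
  by apply: measurable_preimage => //; mfun.
apply/seteqP; split => x /=; [by move=> ->; rewrite enorm0|exact: enorm_eq0].
Qed.

(** The origin is invariant under the dilation by 2, which multiplies measures by 2^-d with d
    positive; the measure of the origin is finite, so it is 0. *)
Lemma lebesgue_rV_set0 : lam [set 0] = 0%E.
Proof.
have m0 := measurable_set0V.
have := @lebesgue_rV_diag R d (fun=> 2) [set 0] (fun=> ltr0Sn _ _) m0.
rewrite (_ : diagV _ @^-1` _ = [set 0]); last first.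
  apply/seteqP; split => x /= x0; apply/rowP => i; rewrite mxE.
    by move/rowP: x0 => /(_ i); rewrite !mxE => /eqP; rewrite mulf_eq0 pnatr_eq0/= => /eqP.
  by rewrite x0 mxE mulr0.
have /fineK <- : lam [set 0] \is a fin_num.
  rewrite ge0_fin_numE//; apply: le_lt_trans (lebesgue_rV_ball_lty d 1).
  apply: le_measure; rewrite ?inE//; first exact: measurable_ballV.
  by move=> _ ->; rewrite /ballV/= enorm0.
rewrite prodr_const card_ord -EFinM => -[] /eqP; rewrite -subr_eq0 -{1}[fine _]mul1r -mulrBl.
rewrite mulf_eq0 => /orP[|/eqP -> //]; rewrite subr_eq0 => /eqP e.
have : (2^-1 : R) ^+ d < 1 by rewrite exprn_ilt1// invf_lt1// ltr1n.
by rewrite -e ltxx.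
Qed.

Lemma int_ball_refl w (g : 'rV[R]_d -> R) : measurable_fun setT g -> (forall h, 0 <= g h) ->
  (\int[lam]_h (g (refl w h) * (enorm h < 1)%R%:R)%:E =
   \int[lam]_h (g h * (enorm h < 1)%R%:R)%:E)%E.
Proof.
move=> mg g0.
rewrite -(@ge0_integral_refl _ _ w (fun h => (g h * (enorm h < 1)%R%:R)%:E)).
- by apply: eq_integral => h _; rewrite enorm_refl.
- by mfun.
- by move=> h; rewrite lee_fin mulr_ge0.
Qed.

Lemma int_ball (r : R) : (\int[lam]_h ((enorm h < r)%R%:R)%:E = lam (ballV d r))%E.
Proof.
rewrite -[in RHS](setIT (ballV d r)) -integral_indic//; last exact: measurable_ballV.
by apply: eq_integral => h _; rewrite indicE /ballV mem_setE.
Qed.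

Lemma int_ball_neq0 : (\int[lam]_h ((h != 0)%:R * (enorm h < 1)%R%:R)%:E = (alpha R d)%:E)%E.
Proof.
rewrite -alphaE -int_ball.
have m0 : measurable [set (0 : 'rV[R]_d)] by exact: measurable_set0V.
rewrite [RHS](@ge0_negligible_integral _ _ _ _ _ [set (0 : 'rV[R]_d)])//; last 2 first.
- by mfun.
- by apply: lebesgue_rV_set0.
apply: int_natrb => h /=; split; first by case=> _ /eqP.
by move=> /eqP.
Qed.

(** Reflections exchanging two axes make the value independent of the coordinate, and the d values
    add up to [alpha] because [dir h] is a unit vector for [h != 0]. The infinite case has to be
    excluded before dividing by d. *)
Lemma int_ball_dir_coord i :
  (\int[lam]_h ((dir h 0 i) ^+ 2 * (enorm h < 1)%R%:R)%:E = (alpha R d / d%:R)%:E)%E.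
Proof.
have mg j : measurable_fun setT (fun h : 'rV[R]_d => dir h 0 j ^+ 2).
  by apply: measurable_funX; apply: measurable_rV_comp; apply: measurable_dir.
have E j : (\int[lam]_h ((dir h 0 j) ^+ 2 * (enorm h < 1)%R%:R)%:E =
   \int[lam]_h ((dir h 0 i) ^+ 2 * (enorm h < 1)%R%:R)%:E)%E.
  rewrite -(int_ball_refl (axis j - axis i) (mg j)); last by move=> h; rewrite sqr_ge0.
  apply: eq_integral => h _; rewrite dir_refl -(dot_axis j) -(dot_axis i).
  by rewrite -dot_refll refl_swap// !enorm_axis.
have : (\sum_(j < d) \int[lam]_h ((dir h 0 j) ^+ 2 * (enorm h < 1)%R%:R)%:E = (alpha R d)%:E)%E.
  rewrite -ge0_integral_sum//; last 2 first.
  - by move=> j; mfun; apply: measurable_dir.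
  - by move=> j h _; rewrite lee_fin mulr_ge0// sqr_ge0.
  rewrite -int_ball_neq0; apply: eq_integral => h _.
  rewrite sumEFin -mulr_suml; congr (_ * _)%:E.
  rewrite (_ : \sum_(j < d) _ = enorm (dir h) ^+ 2); last first.
    by rewrite sqr_enorm; apply: eq_bigr => j _; rewrite expr2.
  have [->|h0] := eqVneq h 0; first by rewrite dir0 enorm0 expr0n.
  by rewrite enorm_dir// expr1n.
rewrite (eq_bigr _ (fun j _ => E j)).
clear E; have : (0 <= \int[lam]_h ((dir h 0 i) ^+ 2 * (enorm h < 1)%R%:R)%:E)%E.
  by apply: int_ge0 => h; rewrite mulr_ge0// sqr_ge0.
move: (\int[lam]_h _)%E => -[r| |]; rewrite ?lee_fin//= => r0.
  by rewrite sumEFin sumr_const card_ord => -[<-]; rewrite -[r *+ _]mulr_natr mulfK.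
rewrite big_ord_recl addye//; apply/eqP => s0.
suff : (0 <= \sum_(i < n) (+oo : \bar R))%E by rewrite s0.
exact: sume_ge0.
Qed.

(* The change of variables scaling the coordinate 0 by the square root of
   [1 + tau ^+ 2] maps the Euclidean ball to the ellipsoid [q < 1]. *)
Lemma int_ball_dir0 (tau : R) :
  (\int[lam]_h ((dir h 0 0) ^+ 2 *
      (1 + tau ^+ 2 * (dir h 0 0) ^+ 2) `^ (- (d.+2%:R / 2)) * (enorm h < 1)%R%:R)%:E =
   ((1 + tau ^+ 2) `^ (- (3 / 2)) * (alpha R d / d%:R))%:E)%E.
Proof.
pose q h := dot h h + tau ^+ 2 * h 0 0 ^+ 2.
have q0 h : 0 <= q h by rewrite addr_ge0 ?dot_ge0// mulr_ge0 ?sqr_ge0.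
have qgt0 h : h != 0 -> 0 < q h.
  move=> h0; rewrite /q; apply: ltr_wpDr; first by rewrite mulr_ge0 ?sqr_ge0.
  by rewrite -sqr_enorm exprn_gt0// enorm_gt0.
have qZ t h : q (t *: h) = t ^+ 2 * q h.
  by rewrite /q dotZl dotZr mxE; ring.
have mq : measurable_fun setT q by rewrite /q; mfun.
(* With these choices 1 + tau^2 (dir h)_0^2 = k(h)^-2, so the power in the integrand is k^(d+2): the
   factor k^2 turns (dir h)_0^2 into [f h], and k^d is the density for which [int_homogeneous_star]
   gives the domain |h| < k(h), that is q(h) < 1. *)
pose f h := h 0 0 ^+ 2 / q h.
pose k h := enorm h / Num.sqrt (q h).
have mf : measurable_fun setT f by rewrite /f; mfun.
have mk : measurable_fun setT k by rewrite /k; mfun.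
have f0 h : 0 <= f h by rewrite divr_ge0 ?sqr_ge0.
have f00 : f 0 = 0 by rewrite /f mxE expr0n mul0r.
have fZ t h : 0 < t -> f (t *: h) = f h.
  by move=> t0; rewrite /f qZ mxE exprMn -mulf_div mulfV ?mul1r// gt_eqF// exprn_gt0.
have kZ t h : 0 < t -> k (t *: h) = k h.
  move=> t0; rewrite /k qZ enormZ sqrtrM ?sqr_ge0// sqrtr_sqr -mulf_div.
  by rewrite mulfV ?mul1r// gt_eqF// normr_gt0 gt_eqF.
have k0 h : h != 0 -> 0 < k h.
  by move=> h0; rewrite divr_gt0 ?enorm_gt0// sqrtr_gt0 qgt0.
transitivity (\int[lam]_h (f h * ((enorm h < 1)%R%:R * k h ^+ d))%:E)%E.
  apply: eq_integral => h _; congr EFin.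
  have [->|h0] := eqVneq h 0; first by rewrite f00 dir0 mxE expr0n/= !mul0r.
  rewrite [RHS]mulrA [RHS]mulrAC; congr (_ * _).
  have eh0 := enorm_gt0 h0; have qh0 := qgt0 _ h0.
  have sq0 : 0 < Num.sqrt (q h) by rewrite sqrtr_gt0.
  have kE : k h ^+ 2 = enorm h ^+ 2 / q h.
    by rewrite /k exprMn exprVn [X in _ / X]sqr_sqrtr.
  have -> : dir h 0 0 ^+ 2 = h 0 0 ^+ 2 / enorm h ^+ 2.
    by rewrite mxE exprMn exprVn mulrC.
  have -> : 1 + tau ^+ 2 * (h 0 0 ^+ 2 / enorm h ^+ 2) = (k h)^-1 ^+ 2.
    rewrite exprVn kE invf_div {1}/q -sqr_enorm; field.
    by rewrite gt_eqF.
  rewrite -[(k h)^-1 ^+ 2]powR_mulrn ?invr_ge0 ?(ltW (k0 _ h0))// -powRrM mulrN mulrCA mulfV// mulr1.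
  rewrite powR_invn ?invr_ge0 ?(ltW (k0 _ h0))// exprVn invrK.
  have -> : k h ^+ n.+3 = k h ^+ d * k h ^+ 2 by rewrite -exprD addn2.
  rewrite kE /f; field.
  by rewrite !gt_eqF.
rewrite -(int_homogeneous_star mf f0 f00 fZ (ltn0Sn n) mk k0 kZ).
pose g h := f h * (q h < 1)%R%:R.
have mg : measurable_fun setT g by rewrite /g; mfun.
have g0 h : 0 <= g h by rewrite mulr_ge0.
transitivity (\int[lam]_h (g h)%:E)%E.
  apply: eq_integral => h _; rewrite /g; have [->|h0] := eqVneq h 0.
    by rewrite f00 !mul0r.
  rewrite /k ltr_pdivlMr ?sqrtr_gt0 ?qgt0// -[X in (_ < X)%R]mulr1.
  by rewrite ltr_pM2l ?enorm_gt0// -[X in (_ < X)%R]sqrtr1 ltr_sqrt.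
have p0 : 0 < 1 + tau ^+ 2 by rewrite ltr_wpDr ?sqr_ge0.
have sp0 : 0 < Num.sqrt (1 + tau ^+ 2) by rewrite sqrtr_gt0.
(* Shrinking the coordinate 0 by this factor turns the quadratic form [q] into the squared Euclidean
   norm. *)
pose c (i : 'I_d) : R := if i == 0 then (Num.sqrt (1 + tau ^+ 2))^-1 else 1.
have c0 i : 0 < c i by rewrite /c; case: ifP; rewrite ?invr_gt0.
have cE h : q (diagV c h) = dot h h.
  rewrite /q /dot !big_ord_recl !mxE /c eqxx.
  under eq_bigr do rewrite !mxE /= !mul1r.
  rewrite addrAC; congr (_ + _).
  rewrite -expr2 exprMn exprVn sqr_sqrtr ?ltW// expr2.
  by field; rewrite gt_eqF.
transitivity (((Num.sqrt (1 + tau ^+ 2))^-1)%:E * \int[lam]_h (g (diagV c h))%:E)%E.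
  rewrite (@ge0_integral_diag _ _ c (fun h => (g h)%:E))//; last by mfun.
  rewrite muleA -EFinM [X in (_ * X)%:E](_ : _ = Num.sqrt (1 + tau ^+ 2)).
    by rewrite mulVf ?gt_eqF// mul1e.
  rewrite big_ord_recl big1 ?mulr1 /c/= ?eqxx ?invrK//.
  by move=> i _; rewrite invr1.
transitivity (((Num.sqrt (1 + tau ^+ 2))^-1)%:E * \int[lam]_h
    ((1 + tau ^+ 2)^-1 * (dir h 0 0 ^+ 2 * (enorm h < 1)%R%:R))%:E)%E.
  congr (_ * _)%E; apply: eq_integral => h _; congr EFin.
  rewrite /g /f cE mxE /c eqxx mulrA; congr (_ * _).
    by rewrite -sqr_enorm mxE !exprMn !exprVn sqr_sqrtr ?ltW//; ring.
  by congr (_%:R); apply/esym; rewrite /enorm -[X in (_ < X)%R]sqrtr1 ltr_sqrt.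
rewrite ge0_intZl ?invr_ge0 ?(ltW p0)//; last 2 first.
- by mfun; apply: measurable_dir.
- by move=> h; rewrite mulr_ge0// sqr_ge0.
(* The exponent 3/2 is 1/2 from the Jacobian plus 1 from the rescaling of the squared coordinate in
   [f]. *)
rewrite int_ball_dir_coord -!EFinM; congr EFin; rewrite [LHS]mulrA; congr (_ * _).
rewrite -powR12_sqrt ?ltW// -powRN -[X in _ * X = _]powR_inv1 ?ltW// -powRD; last first.
  by rewrite (gt_eqF p0) implybT.
by congr (_ `^ _); field.
Qed.

End direction.

(** * The kernel G_s *)

Section unit_interval.
Context (R : realType).
Local Notation leb := (@lebesgue_measure R).
Local Notation I := (`[0, 1]%classic : set (measurableTypeR R)).

Lemma lebesgue_unit_itv : leb I = 1%E.
Proof. by rewrite [LHS]lebesgue_measure_itv/= lte_fin ltr01 oppr0 adde0. Qed.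

Lemma integrable_unit_itv (f : R -> R) M : measurable_fun setT f ->
  (forall r, 0 <= r <= 1 -> `|f r| <= M) -> leb.-integrable I (EFin \o f).
Proof.
move=> mf fM; apply: measurable_bounded_integrable => //.
- by rewrite [X in (X < _)%E]lebesgue_unit_itv ltry.
- exact: measurable_funS mf.
- exists M; split; first exact: num_real.
  by move=> x Mx r /=; rewrite in_itv/= => rI; exact: le_trans (fM _ rI) (ltW Mx).
Qed.

Lemma Rint_unit_dist (f g : R -> R) M c :
  measurable_fun setT f -> (forall r, 0 <= r <= 1 -> `|f r| <= M) ->
  measurable_fun setT g -> (forall r, 0 <= r <= 1 -> `|g r| <= M) ->
  (forall r, 0 <= r <= 1 -> `|f r - g r| <= c) ->
  `|\int[leb]_(r in I) f r - \int[leb]_(r in I) g r| <= c.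
Proof.
move=> mf fM mg gM fgc.
have if_ := integrable_unit_itv mf fM; have ig := integrable_unit_itv mg gM.
have mfg : measurable_fun setT (fun r => f r - g r) by mfun.
have ifg := integrable_unit_itv mfg fgc.
rewrite -RintegralB//; apply: le_trans (le_normr_Rintegral _ ifg) _ => //.
have -> : c = \int[leb]_(r in I) c by rewrite Rintegral_cst// [X in fine X]lebesgue_unit_itv mulr1.
apply: le_Rintegral => //.
- exact: integrable_norm.
- exact: (@integrable_unit_itv _ `|c|).
Qed.

End unit_interval.

Section Gtilde.
Context (R : realType) (d : nat).
Local Notation leb := (@lebesgue_measure R).
Implicit Types (p s x y r : R).

Lemma onep_sqr_ge1 x r : 1 <= 1 + x ^+ 2 * r ^+ 2.
Proof. by rewrite lerDl mulr_ge0// sqr_ge0. Qed.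

Lemma powRN_le1 p (X : R) : 0 <= p -> 1 <= X -> X `^ (- p) <= 1.
Proof.
move=> p0 X1; rewrite powRN invf_le1 ?powR_gt0 ?(lt_le_trans _ X1)//.
by rewrite -(powRr0 X) ler_powR.
Qed.

Lemma powRN_bound p x r : 0 <= p -> `|(1 + x ^+ 2 * r ^+ 2) `^ (- p)| <= 1.
Proof.
by move=> p0; rewrite ger0_norm ?powR_ge0// powRN_le1// onep_sqr_ge1.
Qed.

Lemma measurable_Gtilde_integrand p x :
  measurable_fun setT (fun r => (1 + x ^+ 2 * r ^+ 2) `^ (- p)).
Proof. by mfun. Qed.

Lemma exponent_ge0 s : 0 <= s -> 0 <= (d%:R + 1 + 2 * s) / 2.
Proof. by move=> s0; rewrite divr_ge0// !addr_ge0// mulr_ge0. Qed.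

Lemma EFin_Gtilde s x : 0 <= s ->
  ((Gtilde d s x)%:E = \int[leb]_(r in `[0%R, 1%R])
    ((1 + x ^+ 2 * r ^+ 2) `^ (- ((d%:R + 1 + 2 * s) / 2)))%:E)%E.
Proof.
move=> s0; rewrite /Gtilde /Rintegral fineK//; apply: integrable_fin_num => //.
apply: (@integrable_unit_itv _ _ 1); first exact: measurable_Gtilde_integrand.
by move=> r _; apply: powRN_bound; exact: exponent_ge0.
Qed.

Lemma Gtilde_ge0 s x : 0 <= Gtilde d s x.
Proof. by apply: Rintegral_ge0 => r _; exact: powR_ge0. Qed.

Lemma Gtilde_le1 s x : 0 <= s -> Gtilde d s x <= 1.
Proof.
move=> s0; rewrite -lee_fin EFin_Gtilde// -(@lebesgue_unit_itv R).
rewrite -[leRHS]mul1e -integral_cst//=; apply: ge0_le_integral => //.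
- by move=> r _; rewrite lee_fin powR_ge0.
- apply/measurable_EFinP; apply: measurable_funS (measurable_Gtilde_integrand _ _) => //.
- by move=> r _; rewrite lee_fin powRN_le1 ?exponent_ge0 ?onep_sqr_ge1.
Qed.

Lemma GtildeN s x : Gtilde d s (- x) = Gtilde d s x.
Proof. by rewrite /Gtilde; apply: eq_Rintegral => r _; rewrite sqrrN. Qed.

Lemma measurable_Gtilde s : 0 <= s -> measurable_fun setT (Gtilde d s).
Proof.
move=> s0; apply/measurable_EFinP.
pose p := (d%:R + 1 + 2 * s) / 2.
rewrite (_ : EFin \o Gtilde d s = fun x => (\int[leb]_r
   (((0 <= r) && (r <= 1))%R%:R * (1 + x ^+ 2 * r ^+ 2) `^ (- p))%:E)%E).
  apply: (measurable_fun_fubini_tonelli_F (m2 := leb)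
    (fun z : R * R => (((0 <= z.2) && (z.2 <= 1))%R%:R *
      (1 + z.1 ^+ 2 * z.2 ^+ 2) `^ (- p))%:E)) => /=.
    by mfun.
  by move=> z; rewrite lee_fin mulr_ge0// powR_ge0.
apply/funext => x /=; rewrite EFin_Gtilde// -/p.
by apply/esym/int_natrb => r; rewrite /= in_itv.
Qed.

(** The difference is X^-a (1 - X^-(b-a)), and 1 - X^-(b-a) is at most (b-a) ln X. The logarithm is
    absorbed by the power in front, as ln X <= X^a / a, and 1/a <= 2 makes the bound uniform in
    X. *)
Lemma powR_sub_le a b (X : R) : 2^-1 <= a -> a <= b -> 1 <= X ->
  `|X `^ (- a) - X `^ (- b)| <= 2 * (b - a).
Proof.
move=> a2 ab X1; have X0 : 0 < X by exact: lt_le_trans X1.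
have a0 : 0 < a by exact: lt_le_trans a2.
have e : X `^ (- b) = X `^ (- a) * X `^ (- (b - a)).
  by rewrite -powRD ?(gt_eqF X0) ?implybT//; congr (_ `^ _); ring.
have -> : X `^ (- a) - X `^ (- b) = X `^ (- a) * (1 - X `^ (- (b - a))) by rewrite e; ring.
have le1 : X `^ (- (b - a)) <= 1 by rewrite powRN_le1// subr_ge0.
rewrite ger0_norm; last by rewrite mulr_ge0 ?powR_ge0// subr_ge0.
have lb : 1 - X `^ (- (b - a)) <= (b - a) * ln X.
  rewrite /powR gt_eqF// lerBlDr -lerBlDl mulNr; exact: expR_ge1Dx.
apply: le_trans (ler_wpM2l (powR_ge0 _ _) lb) _.
rewrite mulrCA [leRHS]mulrC; apply: ler_wpM2l; first by rewrite subr_ge0.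
have : ln X <= X `^ a / a.
  rewrite ler_pdivlMr// mulrC -ln_powR; apply/ltW/ln_sublinear.
  exact: powR_gt0.
move=> lnX; apply: le_trans (ler_wpM2l (powR_ge0 _ _) lnX) _.
rewrite mulrA -powRD ?(gt_eqF X0) ?implybT// addNr powRr0 div1r.
by rewrite invf_ple ?posrE.
Qed.

(** The two exponents are at least 1/2 and differ by (1-2s)/2. Uniformity in [x] matters because
    difference quotients are unbounded. *)
Lemma Gtilde_sub_le s x : 0 <= s <= 2^-1 ->
  `|Gtilde d s x - Gtilde d 2^-1 x| <= 1 - 2 * s.
Proof.
move=> /andP[s0 s2].
apply: (@Rint_unit_dist _ _ _ 1).
- exact: measurable_Gtilde_integrand.
- by move=> r _; apply: powRN_bound; exact: exponent_ge0.
- exact: measurable_Gtilde_integrand.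
- by move=> r _; apply: powRN_bound; exact: exponent_ge0.
move=> r _; apply: le_trans (powR_sub_le _ _ (onep_sqr_ge1 x r)) _.
- by move: (ler0n R d) s0; move: (d%:R) => D; lra.
- by move: (ler0n R d) s2; move: (d%:R) => D; lra.
- by move: (ler0n R d); move: (d%:R) => D; lra.
Qed.

(** Mean value theorem: with X = 1 + t^2 r^2 the derivative in t is X^-p (1 - 2 p t^2 r^2 / X),
    where both X^-p and t^2 r^2 / X lie between 0 and 1. *)
Lemma mul_powRN_lipschitz p r x y : 0 <= p -> 0 <= r <= 1 ->
  `|x * (1 + x ^+ 2 * r ^+ 2) `^ (- p) - y * (1 + y ^+ 2 * r ^+ 2) `^ (- p)|
    <= (1 + 2 * p) * `|x - y|.
Proof.
move=> p0 r01.
pose X t : R := 1 + t ^+ 2 * r ^+ 2.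
pose f t : R := t * X t `^ (- p).
pose df t : R := X t `^ (- p) * (1 - 2 * p * (t ^+ 2 * r ^+ 2) / X t).
wlog xy : x y / x <= y.
  move=> H; have [/H//|/ltW/H] := leP x y.
  by rewrite [X in X <= _]distrC [`|y - x|]distrC.
have dX (t : R) : is_derive t 1 X (2 * t * r ^+ 2).
  rewrite /X; apply: is_derive_eq.
  by rewrite /GRing.scale/=; ring.
have X1 t : 1 <= X t by exact: onep_sqr_ge1.
have X0 t : 0 < X t by exact: lt_le_trans (X1 t).
have dfE (t : R) : is_derive t 1 f (df t).
  have dXp := is_derive1_comp (is_derive1_powR (- p) (X0 t)) (dX t).
  have -> : f = (id : R -> R) * ((fun z => z `^ (- p)) \o X) by apply/funext.
  apply: is_derive_eq.
  rewrite /df powRD; last by rewrite (gt_eqF (X0 t)) implybT.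
  by rewrite powR_inv1 ?ltW// /GRing.scale/=; ring.
have dfb t : `|df t| <= 1 + 2 * p.
  rewrite /df normrM -[leRHS]mul1r; apply: ler_pM => //.
    by rewrite ger0_norm ?powR_ge0// powRN_le1.
  have q0 : 0 <= t ^+ 2 * r ^+ 2 / X t <= 1.
    apply/andP; split.
      by apply: divr_ge0; [apply: mulr_ge0; exact: sqr_ge0|exact: ltW].
    by rewrite ler_pdivrMr// mul1r /X lerDr.
  rewrite -[X in _ - X]mulrA; set z := (X in _ * X); move: q0; rewrite -/z => /andP[z0 z1].
  apply: le_trans (ler_normB _ _) _; rewrite normr1 lerD2l.
  have pp : 0 <= 2 * p by apply: mulr_ge0.
  by rewrite ger0_norm; [exact: ler_piMr|exact: mulr_ge0 pp z0].
have [c _ fE] : exists2 c, c \in `[x, y] & f y - f x = df c * (y - x).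
  apply: MVT_segment => //.
  apply: continuous_subspaceT => z.
  by apply/differentiable_continuous/derivable1_diffP; apply: ex_derive.
rewrite distrC -/(X x) -/(X y) -/(f x) -/(f y) fE normrM distrC ler_wpM2r//.
Qed.

Lemma Gtilde_lipschitz s x y : 0 <= s ->
  `|x * Gtilde d s x - y * Gtilde d s y| <= (d%:R + 2 + 2 * s) * `|x - y|.
Proof.
move=> s0; have p0 := exponent_ge0 s0.
have int_G t : leb.-integrable (`[0%R, 1%R] : set (measurableTypeR R))
    (EFin \o fun r => (1 + t ^+ 2 * r ^+ 2) `^ (- ((d%:R + 1 + 2 * s) / 2))).
  apply: (@integrable_unit_itv _ _ 1); first exact: measurable_Gtilde_integrand.
  by move=> r _; exact: powRN_bound.
rewrite /Gtilde -!RintegralZl//.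
apply: (@Rint_unit_dist _ _ _ (Num.max `|x| `|y|)).
- by apply: measurable_funM => //; exact: measurable_Gtilde_integrand.
- move=> r _; rewrite normrM le_max; apply/orP; left.
  by rewrite ler_piMr// powRN_bound.
- by apply: measurable_funM => //; exact: measurable_Gtilde_integrand.
- move=> r _; rewrite normrM le_max; apply/orP; right.
  by rewrite ler_piMr// powRN_bound.
- move=> r r01; apply: le_trans (mul_powRN_lipschitz _ _ p0 r01) _.
  rewrite ler_wpM2r// mulrCA divff// mulr1.
  by move: (d%:R) => D; lra.
Qed.

Lemma mul_Gtilde_le s x : 0 <= s -> `|x * Gtilde d s x| <= `|x|.
Proof.
by move=> s0; rewrite normrM ler_piMr// ger0_norm ?Gtilde_ge0// Gtilde_le1.
Qed.

End Gtilde.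

Section sphere_average.
Context (R : realType) (n : nat).
Local Notation d := n.+1.
Local Notation lam := (@lebesgue_rV R d).
Local Notation leb := (@lebesgue_measure R).
Implicit Types (a b h x : 'rV[R]_d).

Lemma int_itv_cc (u v : R) (phi : R -> R) :
  (\int[leb]_t (((u <= t) && (t <= v))%R%:R * phi t)%:E =
   \int[leb]_(t in `[u, v]) (phi t)%:E)%E.
Proof. by apply: int_natrb => x; rewrite /= in_itv. Qed.

Lemma integral_powR32 (tau : R) :
  (\int[leb]_(r in `[0%R, 1%R]) ((1 + (r * tau) ^+ 2) `^ (- (3 / 2)))%:E =
   ((1 + tau ^+ 2) `^ (- 2^-1))%:E)%E.
Proof.
pose X (r : R) : R := 1 + (r * tau) ^+ 2.
have X0 r : 0 < X r by rewrite /X ltr_wpDr ?sqr_ge0.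
have dX (r : R) : is_derive r 1 X (2 * r * tau ^+ 2).
  by rewrite /X; apply: is_derive_eq; rewrite /GRing.scale/=; ring.
have E1 : (1 + tau ^+ 2) `^ (- 2^-1) = 1 * X 1 `^ (- 2^-1) - 0 * X 0 `^ (- 2^-1).
  by rewrite mul0r subr0 mul1r /X mul1r.
rewrite E1.
apply: (@FTC2_is_derive _ _ (fun r => r * X r `^ (- 2^-1))) => // r _.
- have dXp := is_derive1_comp (is_derive1_powR (- 2^-1) (X0 r)) (dX r).
  have -> : (fun r => r * X r `^ (- 2^-1)) = (id : R -> R) * ((fun z => z `^ (- 2^-1)) \o X).
    by apply/funext.
  apply: is_derive_eq; rewrite /GRing.scale/=.
  rewrite (_ : - (3 / 2) = - 2^-1 - 1); last by field.
  rewrite -/(X r) (_ : X r `^ (- 2^-1) = X r `^ (- 2^-1 - 1) * X r).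
    by set Y := X r `^ _; rewrite (_ : X r = 1 + (r * tau) ^+ 2)//; field.
  rewrite -[Z in _ * Z]powRr1 ?(ltW (X0 r))// -powRD ?(gt_eqF (X0 r)) ?implybT//.
  by rewrite subrK.
- have dXp := is_derive1_comp (is_derive1_powR (- (3 / 2)) (X0 r)) (dX r).
  by apply/differentiable_continuous/derivable1_diffP; apply: ex_derive.
Qed.

(** A reflection carries [a] to |a| times the axis 0, and Tonelli moves the integral over r that
    defines the kernel outside. At s = 1/2 the exponent is (d+2)/2, the one treated by
    [int_ball_dir0], applied with tau = r |a|; it remains to integrate (1 + r^2 |a|^2)^(-3/2) over
    the unit interval. *)
Lemma int_ball_diag_identity a :
  (\int[lam]_h (dot a (dir h) ^+ 2 * Gtilde d 2^-1 (dot a (dir h)) * (enorm h < 1)%R%:R)%:E =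
   (alpha R d / d%:R * (dot a a / Num.sqrt (1 + enorm a ^+ 2)))%:E)%E.
Proof.
have mG : measurable_fun setT (@Gtilde R d 2^-1) by apply: measurable_Gtilde.
have mD : measurable_fun setT (@dir R n) by apply: measurable_dir.
have h20 : 0 <= 2^-1 :> R by [].
set tau := enorm a.
have refl_a : refl (a - tau *: axis R 0) a = tau *: axis R (0 : 'I_d).
  by apply: refl_swap; rewrite enormZ enorm_axis mulr1 ger0_norm// enorm_ge0.
rewrite -(@int_ball_refl _ _ (a - tau *: axis R 0)
  (fun h => dot a (dir h) ^+ 2 * Gtilde d 2^-1 (dot a (dir h)))); last 2 first.
- by mfun.
- by move=> h; rewrite mulr_ge0 ?sqr_ge0 ?Gtilde_ge0.
have dE h : dot a (dir (refl (a - tau *: axis R 0) h)) = tau * dir h 0 0.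
  by rewrite dir_refl -dot_refll refl_a dotZl dot_axis.
under eq_integral do rewrite dE.
pose p : R := d.+2%:R / 2.
have pE : (d%:R + 1 + 2 * 2^-1) / 2 = p :> R.
  by rewrite /p mulfV// -!natr1 -addrA.
transitivity (\int[lam]_h \int[leb]_r
   (((0 <= r) && (r <= 1))%R%:R * (tau ^+ 2 *
     (dir h 0 0 ^+ 2 * (1 + (r * tau) ^+ 2 * dir h 0 0 ^+ 2) `^ (- p) * (enorm h < 1)%R%:R)))%:E)%E.
  apply: eq_integral => h _.
  rewrite int_itv_cc.
  rewrite mulrAC EFinM EFin_Gtilde// pE.
  rewrite -ge0_integralZl_EFin//; last 3 first.
  - by move=> r _; rewrite lee_fin powR_ge0.
  - by apply/measurable_EFinP; apply: measurable_funS (measurable_Gtilde_integrand _ _).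
  - by rewrite mulr_ge0// sqr_ge0.
  apply: eq_integral => r _; rewrite -EFinM; congr EFin.
  rewrite (_ : (tau * dir h 0 0) ^+ 2 * r ^+ 2 = (r * tau) ^+ 2 * dir h 0 0 ^+ 2); first by ring.
  by ring.
rewrite (tonelli lam leb); last 2 first.
- by rewrite /p; mfun.
- move=> h r; apply: mulr_ge0 => //; apply: mulr_ge0; first exact: sqr_ge0.
  apply: mulr_ge0 => //; apply: mulr_ge0; [exact: sqr_ge0|exact: powR_ge0].
transitivity (\int[leb]_r (((0 <= r) && (r <= 1))%R%:R *
    (tau ^+ 2 * (alpha R d / d%:R) * (1 + (r * tau) ^+ 2) `^ (- (3 / 2))))%:E)%E.
  apply: eq_integral => r _.
  rewrite ge0_intZl//; last 2 first.
  - by mfun.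
  - move=> h; apply: mulr_ge0; first exact: sqr_ge0.
    apply: mulr_ge0 => //; apply: mulr_ge0; [exact: sqr_ge0|exact: powR_ge0].
  rewrite ge0_intZl ?sqr_ge0//; last 2 first.
  - by mfun.
  - move=> h; apply: mulr_ge0 => //; apply: mulr_ge0; [exact: sqr_ge0|exact: powR_ge0].
  by rewrite int_ball_dir0 -!EFinM; congr EFin; ring.
rewrite int_itv_cc.
have c0 : 0 <= tau ^+ 2 * (alpha R d / d%:R).
  by rewrite mulr_ge0 ?sqr_ge0// divr_ge0// ltW// alpha_gt0.
transitivity ((tau ^+ 2 * (alpha R d / d%:R))%:E *
  \int[leb]_(r in `[0%R, 1%R]) ((1 + (r * tau) ^+ 2) `^ (- (3 / 2)))%:E)%E.
  under eq_integral do rewrite EFinM.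
  rewrite ge0_integralZl_EFin//.
  - by move=> r _; rewrite lee_fin powR_ge0.
  - by apply/measurable_EFinP; apply: measurable_funTS; mfun.
rewrite integral_powR32 -EFinM powRN powR12_sqrt; last by rewrite addr_ge0// sqr_ge0.
by congr EFin; rewrite -sqr_enorm -/tau; ring.
Qed.

Lemma measurable_bounded_int_ball (f : 'rV[R]_d -> R) M : measurable_fun setT f ->
  (forall h, `|f h| <= M) ->
  lam.-integrable setT (fun h => (f h * (enorm h < 1)%R%:R)%:E).
Proof.
move=> mf fM; apply/integrableP; split; first by mfun.
apply: le_lt_trans (_ : (\int[lam]_h (M * (enorm h < 1)%R%:R)%:E < +oo)%E).
  apply: ge0_le_integralT => h; first exact: abse_ge0.
  by rewrite lee_fin normrM normr_nat ler_wpM2r.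
have M0 : 0 <= M by apply: le_trans (fM 0).
rewrite ge0_intZl//; last by mfun.
by rewrite int_ball lte_mul_pinfty// lebesgue_rV_ball_lty.
Qed.

Lemma integral_comp d1 d2 (T1 : measurableType d1) (T2 : measurableType d2)
    (m1 : {measure set T1 -> \bar R}) (m2 : {measure set T2 -> \bar R})
    (phi : T1 -> T2) (f : T2 -> \bar R) :
  measurable_fun setT phi ->
  (forall A, measurable A -> m1 (phi @^-1` A) = m2 A)%E ->
  measurable_fun setT f -> (\int[m1]_x f (phi x) = \int[m2]_y f y)%E.
Proof.
move=> mphi phiE mf; rewrite integralE [RHS]integralE.
congr (_ - _)%E.
- rewrite -[RHS](ge0_integral_comp mphi phiE (measurable_funepos mf) (funepos_ge0 f)).
  by apply: eq_integral => x _; rewrite !funeposE.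
- rewrite -[RHS](ge0_integral_comp mphi phiE (measurable_funeneg mf) (funeneg_ge0 f)).
  by apply: eq_integral => x _; rewrite !funenegE.
Qed.

(** The reflection along [b] fixes [a] and reverses [b], so the integrand is odd under a map
    preserving the measure and the ball. Integrability is needed to conclude from I = - I in the
    extended reals. *)
Lemma int_ball_orth a b : dot a b = 0 ->
  (\int[lam]_h (dot a (dir h) * Gtilde d 2^-1 (dot a (dir h)) * dot b (dir h) *
     (enorm h < 1)%R%:R)%:E = 0)%E.
Proof.
move=> ab; set g := fun h : 'rV[R]_d => _.
have h20 : 0 <= 2^-1 :> R by [].
have mG : measurable_fun setT (@Gtilde R d 2^-1) by apply: measurable_Gtilde.
have mD : measurable_fun setT (@dir R n) by apply: measurable_dir.
have ig : lam.-integrable setT g.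
  apply: (@measurable_bounded_int_ball _ (enorm a * enorm b)); first by mfun.
  move=> h; rewrite normrM ler_pM ?dot_dir_le//.
  by apply: le_trans (mul_Gtilde_le d _ h20) _; exact: dot_dir_le.
have gN h : g (refl b h) = (- g h)%E.
  rewrite /g enorm_refl dir_refl -!dot_refll refl_self refl_orth; last by rewrite dotC.
  by rewrite dotNl mulrN mulNr EFinN.
have : (\int[lam]_h g h = - \int[lam]_h g h)%E.
  rewrite -[RHS]integralN; last exact: integrable_add_def.
  rewrite -(@integral_comp _ _ _ _ lam lam (refl b) g).
  - by apply: eq_integral => h _; rewrite gN.
  - exact: measurable_refl.
  - by move=> A mA; exact: lebesgue_rV_refl.
  - exact: measurable_int ig.
have : (\int[lam]_h g h)%E \is a fin_num by exact: integrable_fin_num.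
case: (\int[lam]_h g h)%E => // r _ -[] /eqP; rewrite -addr_eq0 -mulr2n.
by rewrite mulrn_eq0/= => /eqP ->.
Qed.

Lemma int_ball_identity a b :
  (\int[lam]_h (dot a (dir h) * Gtilde d 2^-1 (dot a (dir h)) * dot b (dir h) *
     (enorm h < 1)%R%:R)%:E =
   (alpha R d / d%:R * (dot a b / Num.sqrt (1 + enorm a ^+ 2)))%:E)%E.
Proof.
have [a0|a0] := eqVneq (dot a a) 0.
  rewrite (dot_eq0 a0) dot0l mul0r mulr0 integral0_eq// => h _.
  by rewrite dot0l !mul0r.
have h20 : 0 <= 2^-1 :> R by [].
have mG : measurable_fun setT (@Gtilde R d 2^-1) by apply: measurable_Gtilde.
have mD : measurable_fun setT (@dir R n) by apply: measurable_dir.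
(* Orthogonal decomposition of [b] along [a]: the parallel part is the diagonal identity, and the
   orthogonal part contributes 0. *)
pose c := dot a b / dot a a; pose b' := b - c *: a.
have ab' : dot a b' = 0 by rewrite /b' dotBr dotZr /c divfK// subrr.
have bE : b = c *: a + b' by rewrite /b' addrC subrK.
transitivity (\int[lam]_h ((c%:E * (dot a (dir h) ^+ 2 * Gtilde d 2^-1 (dot a (dir h)) * (enorm h < 1)%R%:R)%:E) +
   (dot a (dir h) * Gtilde d 2^-1 (dot a (dir h)) * dot b' (dir h) *
     (enorm h < 1)%R%:R)%:E))%E.
  apply: eq_integral => h _; rewrite -EFinM -EFinD; congr EFin.
  by rewrite [in LHS]bE dotDl dotZl; ring.
have bnd h : `|dot a (dir h) * Gtilde d 2^-1 (dot a (dir h))| <= enorm a.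
  by apply: le_trans (mul_Gtilde_le d _ h20) _; exact: dot_dir_le.
have i1 : lam.-integrable setT (fun h =>
    (dot a (dir h) ^+ 2 * Gtilde d 2^-1 (dot a (dir h)) * (enorm h < 1)%R%:R)%:E).
  apply: (@measurable_bounded_int_ball _ (enorm a * enorm a)); first by mfun.
  by move=> h; rewrite expr2 -mulrA normrM ler_pM ?dot_dir_le.
have i2 : lam.-integrable setT (fun h =>
    (dot a (dir h) * Gtilde d 2^-1 (dot a (dir h)) * dot b' (dir h) * (enorm h < 1)%R%:R)%:E).
  apply: (@measurable_bounded_int_ball _ (enorm a * enorm b')); first by mfun.
  by move=> h; rewrite normrM ler_pM ?dot_dir_le.
rewrite integralD//; last exact: integrableZl.
rewrite integralZl// int_ball_orth// adde0 int_ball_diag_identity -EFinM.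
have s0 : Num.sqrt (1 + enorm a ^+ 2) != 0.
  by rewrite gt_eqF// sqrtr_gt0 ltr_wpDr// sqr_ge0.
by congr EFin; rewrite /c; field; rewrite s0 a0 nat1r pnatr_eq0.
Qed.

End sphere_average.

(** * Singular weights *)

Section weight.
Context (R : realType) (n : nat).
Local Notation d := n.+1.
Local Notation lam := (@lebesgue_rV R d).
Local Notation leb := (@lebesgue_measure R).
Implicit Types (s : R) (h x : 'rV[R]_d).

(* The singular weight that remains once the increments of the functions are
   replaced by difference quotients. *)
Definition weight s h : R :=
  Cds d s * (enorm h ^+ 2 / enorm h `^ (d%:R + 1 + 2 * s)).

Lemma Cds_gt0 s : s < 2^-1 -> 0 < Cds d s.
Proof. by move=> s2; rewrite divr_gt0 ?alpha_gt0//; lra. Qed.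

Lemma weight_ge0 s h : s < 2^-1 -> 0 <= weight s h.
Proof.
move=> s2; apply: mulr_ge0; first exact/ltW/Cds_gt0.
by apply: divr_ge0; [exact: sqr_ge0|exact: powR_ge0].
Qed.

Lemma measurable_weight s : measurable_fun setT (weight s).
Proof. by rewrite /weight; mfun. Qed.

Lemma weightE s h : h != 0 -> weight s h = Cds d s * enorm h `^ (- (n%:R + 2 * s)).
Proof.
move=> h0; have eh0 := enorm_gt0 h0; rewrite /weight; congr (_ * _).
rewrite -powR_mulrn ?ltW// -powRB; last by rewrite (gt_eqF eh0) implybT.
by congr (_ `^ _); rewrite -natr1; ring.
Qed.

(** Away from 0 the weight is C_{d,s} |h|^-beta with beta = d - 1 + 2s. The factor d/(d-beta) =
    d/(1-2s) of [int_homogeneous_powR] cancels the 1 - 2s in C_{d,s}, so the value is the same for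
    all s. *)
Lemma int_weight_homogeneous s (f : 'rV[R]_d -> R) : 0 < s < 2^-1 ->
  measurable_fun setT f -> (forall h, 0 <= f h) -> f 0 = 0 ->
  (forall t h, 0 < t -> f (t *: h) = f h) ->
  (\int[lam]_h (f h * (enorm h < 1)%R%:R * weight s h)%:E =
   (d%:R / alpha R d)%:E * \int[lam]_h (f h * (enorm h < 1)%R%:R)%:E)%E.
Proof.
move=> /andP[s0 s2] mf f0 f00 fZ.
transitivity (\int[lam]_h (Cds d s * (f h * ((enorm h < 1)%R%:R *
    enorm h `^ (- (n%:R + 2 * s)))))%:E)%E.
  apply: eq_integral => h _; congr EFin; have [->|h0] := eqVneq h 0.
    by rewrite f00 !mul0r mulr0.
  by rewrite weightE//; ring.
rewrite ge0_intZl ?(ltW (Cds_gt0 s2))//; last 2 first.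
- by mfun.
- by move=> h; rewrite mulr_ge0// mulr_ge0// powR_ge0.
rewrite (int_homogeneous_powR mf f0 f00 fZ); last first.
  apply/andP; split; first by apply: ltr_wpDl => //; rewrite mulr_gt0.
  by rewrite -[n.+1%:R]natr1 ltrD2l; lra.
rewrite muleA -EFinM; congr (_%:E * _)%E.
rewrite /Cds -[n.+1%:R]natr1 (_ : n%:R + 1 - (n%:R + 2 * s) = 1 - 2 * s); last by ring.
field; rewrite gt_eqF ?alpha_gt0//= gt_eqF//; lra.
Qed.

Lemma int_weight_ball s : 0 < s < 2^-1 ->
  (\int[lam]_h ((enorm h < 1)%R%:R * weight s h)%:E = d%:R%:E)%E.
Proof.
move=> s01; transitivity (\int[lam]_h ((h != 0)%:R * (enorm h < 1)%R%:R * weight s h)%:E)%E.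
  apply: eq_integral => h _; have [->|h0] := eqVneq h 0; last by rewrite mul1r.
  by rewrite /weight enorm0 expr0n !mul0r !mulr0.
have mn : measurable_fun setT (fun h : 'rV[R]_d => (h != 0)%:R : R).
  rewrite (_ : (fun _ => _) = fun h => (0 < enorm h)%R%:R); first by mfun.
  apply/funext => h; have [->|h0] := eqVneq h 0; first by rewrite enorm0 ltxx.
  by rewrite enorm_gt0.
rewrite int_weight_homogeneous//; last 2 first.
- by rewrite eqxx.
- by move=> t h t0; rewrite scaler_eq0 gt_eqF.
by rewrite int_ball_neq0 -EFinM divfK// gt_eqF// alpha_gt0.
Qed.

Lemma int_ball_radius r : 0 < r ->
  (\int[lam]_h ((enorm h < r)%R%:R)%:E = (r ^+ d * alpha R d)%:E)%E.
Proof.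
move=> r0; rewrite (@ge0_int_scale _ _ r (fun h => (enorm h < r)%R%:R))//; last by mfun.
rewrite EFinM -alphaE -int_ball; congr (_ * _)%E; apply: eq_integral => h _.
by rewrite enormZ gtr0_norm// -[X in (_ < X)%R]mulr1 ltr_pM2l.
Qed.

(** Layering with p = d+1: |h|^-p is the integral of p t^(-p-1) over t >= |h|. The layer at t lies
    in the open ball of radius 2t, of measure (2t)^d alpha, and t^-2 has integral 1 over t >= 1; the
    constant is p 2^d alpha. *)
Lemma far_mass_ex : exists2 C : R, 0 <= C &
  (\int[lam]_h ((1 <= enorm h)%R%:R * enorm h `^ (- (d%:R + 1)))%:E <= C%:E)%E.
Proof.
exists (d.+1%:R * 2 ^+ d * alpha R d).
  by rewrite !mulr_ge0// ltW// alpha_gt0.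
pose p : R := d%:R + 1.
have p0 : 0 < p by rewrite /p addr_gt0.
pose X h t := (1 <= t)%R%:R * ((enorm h < 2 * t)%R%:R * (p * t `^ (- p - 1))).
have X0 h t : 0 <= X h t.
  by rewrite mulr_ge0// mulr_ge0// mulr_ge0 ?powR_ge0// ltW.
have mX : measurable_fun setT (fun z : 'rV[R]_d * R => X z.1 z.2) by rewrite /X; mfun.
apply: le_trans (_ : (\int[lam]_h \int[leb]_t (X h t)%:E <= _)%E).
  apply: ge0_le_integralT => h.
    by rewrite lee_fin mulr_ge0// powR_ge0.
  have [h1|h1] := leP 1 (enorm h); last by rewrite mul0r int_ge0.
  rewrite mul1r -integral_powRy ?(lt_le_trans ltr01 h1)// -int_itv_cy.
  apply: ge0_le_int => t; first by rewrite mulr_ge0// mulr_ge0 ?powR_ge0// ltW.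
  have [ht|ht] := leP (enorm h) t; last by rewrite mul0r.
  rewrite /X (le_trans h1 ht) (_ : enorm h < 2 * t) ?mul1r//.
  by rewrite (le_lt_trans ht)// ltr_pMl ?ltr1n// (lt_le_trans _ ht)// (lt_le_trans _ h1).
rewrite (tonelli lam leb mX X0).
rewrite [X in (X <= _)%E](_ : _ = \int[leb]_t ((2 ^+ d * alpha R d * p) *
    ((1 <= t)%R%:R * (1 * t `^ (- 1 - 1))))%:E)%E; last first.
  apply: eq_integral => t _.
  have [t1|t1] := leP 1 t; last first.
    rewrite mul0r mulr0 integral0_eq// => h _.
    by rewrite /X leNgt t1 mul0r.
  have t0 : 0 < t by exact: lt_le_trans t1.
  under eq_integral => h _ do rewrite /X t1 mul1r mulrC.
  rewrite ge0_intZl//; last 2 first.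
  - by rewrite mulr_ge0 ?powR_ge0// ltW.
  - by mfun.
  rewrite int_ball_radius ?mulr_gt0// -EFinM; congr EFin.
  have -> : (- 1 - 1 : R) = (- p - 1) + d%:R by rewrite /p; ring.
  rewrite [t `^ (_ + d%:R)]powRD; last by rewrite (gt_eqF t0) implybT.
  rewrite powR_mulrn ?ltW// exprMn /=; ring.
rewrite ge0_intZl//; last 3 first.
- by rewrite !mulr_ge0// ltW// alpha_gt0.
- by mfun.
- by move=> t; rewrite mulr_ge0// mulr_ge0 ?powR_ge0.
rewrite int_itv_cy integral_powRy// powR1 mule1 lee_fin /p natr1.
by rewrite mulrC mulrA.
Qed.

(* The weights have bounded mass and concentrate at [0] as [s] tends to 1/2. *)
Lemma cvg_int_weight (E : 'rV[R]_d -> \bar R) (M : R) :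
  measurable_fun setT E -> (forall h, 0 <= E h)%E ->
  (forall h, enorm h < 1 -> (E h <= M%:E)%E) ->
  (forall e, 0 < e -> exists2 del, 0 < del & forall h, enorm h < del -> (E h <= e%:E)%E) ->
  forall e, 0 < e -> exists2 eta, 0 < eta & forall s, 2^-1 - eta < s < 2^-1 ->
    (\int[lam]_h (E h * ((enorm h < 1)%R%:R * weight s h)%:E) <= e%:E)%E.
Proof.
move=> mE E0 EM Ecvg e e0.
have [del del0 Edel] : exists2 del, 0 < del &
    forall h, enorm h < del -> (E h <= (e / (2 * d%:R))%:E)%E.
  by apply: Ecvg; rewrite divr_gt0// mulr_gt0.
have M0 : 0 <= M.
  by have := EM 0; rewrite enorm0 ltr01 => /(_ isT); rewrite -lee_fin; apply: le_trans.
(* For del <= |h| < 1 the weight is at most (1-2s)/alpha times the power -d of min(del, 1); with the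
   bound [M] on [E], the contribution of these h is of order (1-2s) A. *)
pose A : R := M * (Num.min del 1) `^ (- d%:R).
have A0 : 0 <= A by rewrite mulr_ge0// powR_ge0.
(* The bound 1/4 keeps s positive; the other one makes (1-2s) A at most e/2. The other half of e is
   the value e/(2d) near the origin times the total mass d. *)
exists (Num.min (4^-1) (e / (4 * (A + 1)))).
  rewrite lt_min; apply/andP; split; first by [].
  by rewrite divr_gt0// mulr_gt0// ltr_wpDl.
move=> s /andP[s1 s2].
have s14 : 4^-1 < s.
  have : Num.min 4^-1 (e / (4 * (A + 1))) <= 4^-1 by rewrite ge_min lexx.
  by lra.
have sA : (1 - 2 * s) * A <= e / 2.
  have : Num.min 4^-1 (e / (4 * (A + 1))) <= e / (4 * (A + 1)) by rewrite ge_min lexx orbT.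
  move=> m; have h1 : 1 - 2 * s <= e / (2 * (A + 1)).
    have -> : e / (2 * (A + 1)) = 2 * (e / (4 * (A + 1))).
      by field; rewrite gt_eqF// ltr_wpDl.
    by lra.
  apply: le_trans (_ : (1 - 2 * s) * (A + 1) <= _).
    by rewrite ler_wpM2l ?lerDl//; lra.
  by rewrite -ler_pdivlMr ?ltr_wpDl// -mulrA -invfM.
have s0 : 0 < s by lra.
have w0 h : 0 <= weight s h by rewrite weight_ge0.
have mw := measurable_weight s.
have ed : 0 <= e / (2 * d%:R) by rewrite divr_ge0 ?ltW// mulr_ge0.
have cA : 0 <= (1 - 2 * s) * A / alpha R d.
  by rewrite divr_ge0 ?(ltW (alpha_gt0 _ _))// mulr_ge0//; lra.
apply: le_trans (_ : (\int[lam]_h ((e / (2 * d%:R)) * ((enorm h < 1)%R%:R * weight s h) +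
   (1 - 2 * s) * A / alpha R d * (enorm h < 1)%R%:R)%:E <= _)%E).
  apply: ge0_le_integralT => h.
    by rewrite mule_ge0// lee_fin mulr_ge0.
  have [h1|h1] := ltP (enorm h) 1; last by rewrite !mul0r !mulr0 mule0 addr0.
  rewrite !mul1r mulr1.
  have [hdel|hdel] := ltP (enorm h) del.
    apply: (@le_trans _ _ ((e / (2 * d%:R) * weight s h)%:E)).
      by rewrite [leRHS]EFinM; apply: lee_wpmul2r; [rewrite lee_fin|exact: Edel].
    by rewrite lee_fin lerDl.
  apply: le_trans (lee_wpmul2r _ (EM h h1)) _; first by rewrite lee_fin.
  rewrite -EFinM lee_fin; apply: ler_wpDl; first by rewrite mulr_ge0.
  have eh0 : 0 < enorm h by exact: lt_le_trans del0 hdel.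
  have h0 : h != 0 by apply/eqP => h0; rewrite h0 enorm0 ltxx in eh0.
  set del1 := Num.min del 1.
  have del10 : 0 < del1 by rewrite lt_min del0 ltr01.
  have del1h : del1 <= enorm h by rewrite ge_min hdel.
  rewrite weightE// /Cds /A -/del1.
  rewrite (_ : (1 - 2 * s) * (M * del1 `^ (- d%:R)) / alpha R d =
    M * ((1 - 2 * s) / alpha R d * del1 `^ (- d%:R))); last by ring.
  apply: ler_wpM2l => //; apply: ler_wpM2l.
    by apply: divr_ge0; [lra|rewrite ltW// alpha_gt0].
  apply: le_trans (_ : enorm h `^ (- d%:R) <= _).
    apply: ger_powR; first by rewrite eh0 ltW.
    by rewrite lerN2 -[n.+1%:R]natr1 lerD2l; lra.
  rewrite !powRN lef_pV2 ?posrE ?powR_gt0//.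
  by apply: ge0_ler_powR => //; rewrite nnegrE ltW.
rewrite ge0_intD//; last 4 first.
- by mfun.
- by mfun.
- by move=> h; rewrite mulr_ge0// mulr_ge0.
- by move=> h; rewrite mulr_ge0.
rewrite ge0_intZl//; last 2 first.
- by mfun.
- by move=> h; rewrite mulr_ge0.
rewrite int_weight_ball ?s0//.
rewrite ge0_intZl//; last by mfun.
rewrite int_ball alphaE -!EFinM -EFinD lee_fin divfK ?gt_eqF ?alpha_gt0//.
rewrite (_ : e / (2 * d%:R) * d%:R = e / 2); last by field.
by rewrite [leRHS]splitr lerD2l.
Qed.

End weight.

(** * Taylor expansion of test functions *)

Section taylor.
Context (R : realType) (d : nat).
Implicit Types (f : 'rV[R]_d -> R) (x y z h : 'rV[R]_d) (i : 'I_d).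
Local Notation e_ i := (delta_mx 0 i : 'rV[R]_d).

Definition grad f x : 'rV[R]_d := \row_i partial i f x.

Lemma MVT_partial f i y (t c M : R) :
  (forall z, derivable f z (e_ i)) ->
  (forall r, `|r| <= `|t| -> `|partial i f (y + r *: e_ i) - c| <= M) ->
  `|f (y + t *: e_ i) - f y - c * t| <= M * `|t|.
Proof.
move=> df.
pose g (r : R) := f (y + r *: e_ i).
have dg (r : R) : is_derive r 1 g (partial i f (y + r *: e_ i)).
  have E : (fun k : R => k^-1 *: (g (k *: 1 + r) - g r)) =
      (fun k : R => k^-1 *: (f (k *: e_ i + (y + r *: e_ i)) - f (y + r *: e_ i))).
    apply/funext => k; rewrite /g; congr (_ *: (f _ - _)).
    by rewrite [_ *: 1]mulr1 scalerDl addrCA.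
  split; first by rewrite /derivable E; exact: df.
  by rewrite /derive E.
have cg : continuous g.
  by move=> r; apply/differentiable_continuous/derivable1_diffP; apply: ex_derive.
have key a b : a <= b -> exists2 r, a <= r <= b & g b - g a = partial i f (y + r *: e_ i) * (b - a).
  move=> ab; have [r rab E] := MVT_segment ab (fun r _ => dg r) (continuous_subspaceT cg).
  by exists r => //; move: rab; rewrite in_itv.
move=> bnd.
suff [r rt E] : exists2 r, `|r| <= `|t| & g t - g 0 = partial i f (y + r *: e_ i) * t.
  have -> : f (y + t *: e_ i) - f y - c * t = (partial i f (y + r *: e_ i) - c) * t.
    by rewrite mulrBl -E /g scale0r addr0.
  by rewrite normrM ler_wpM2r// bnd.
have [t0|t0] := leP 0 t.
  have [r /andP[r0 rt] E] := key _ _ t0; exists r; last by rewrite E subr0.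
  by rewrite !ger0_norm.
have [r /andP[r0 rt] E] := key _ _ (ltW t0); exists r.
  by rewrite (ler0_norm rt) (ltr0_norm t0) lerN2.
by rewrite -opprB E sub0r mulrN opprK.
Qed.

(** Smoothness is expressed by partial derivatives only, so the increment is telescoped along a path
    that switches on the coordinates of [h] one by one ([P k] has the first k of them) and stays in
    the box. The vector [c] is free: it is the gradient for the expansion itself and 0 for bounding
    the variation of a partial derivative. *)
Lemma box_increment_le f x h (c : 'rV[R]_d) (rho M : R) :
  (forall i z, derivable f z (e_ i)) -> (forall i, `|h 0 i| <= rho) ->
  (forall i z, (forall j, `|z 0 j - x 0 j| <= rho) -> `|partial i f z - c 0 i| <= M) ->
  `|f (x + h) - f x - dot c h| <= M * \sum_i `|h 0 i|.
Proof.
move=> df hrho bnd.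
pose P (k : nat) : 'rV[R]_d := \row_j (if (j < k)%N then h 0 j else 0).
suff H k : (k <= d)%N -> `|f (x + P k) - f x - \sum_(j < d | (j < k)%N) c 0 j * h 0 j|
    <= M * \sum_(j < d | (j < k)%N) `|h 0 j|.
  have := H d (leqnn d).
  have -> : P d = h by apply/rowP => j; rewrite mxE ltn_ord.
  rewrite (eq_bigl xpredT); last by move=> j; rewrite ltn_ord.
  by rewrite [X in _ <= _ * X](eq_bigl xpredT)// => j; rewrite ltn_ord.
elim: k => [_|k IH kd].
  have -> : P 0%N = 0 by apply/rowP => j; rewrite !mxE ltn0.
  by rewrite !big_pred0// addr0 !subrr normr0 mulr0.
pose i : 'I_d := Ordinal kd.
have PS : x + P k.+1 = x + P k + h 0 i *: e_ i.
  apply/rowP => j; rewrite !mxE eqxx/= ltnS.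
  have [->|ji] := eqVneq j i; first by rewrite leqnn ltnn mulr1 addr0.
  rewrite mulr0 addr0 leq_eqVlt (_ : (j == k :> nat) = false)//.
  by apply/negbTE; apply: contra ji => /eqP jk; apply/eqP/val_inj.
have sumS (F : 'I_d -> R) : \sum_(j < d | (j < k.+1)%N) F j = F i + \sum_(j < d | (j < k)%N) F j.
  rewrite (bigD1 i)//=; congr (_ + _); apply: eq_bigl => j.
  rewrite ltnS; have [->|ji] := eqVneq j i; first by rewrite andbF ltnn.
  rewrite andbT leq_eqVlt (_ : (j == k :> nat) = false)//.
  by apply/negbTE; apply: contra ji => /eqP jk; apply/eqP/val_inj.
rewrite !sumS mulrDr.
have -> : f (x + P k.+1) - f x - (c 0 i * h 0 i + \sum_(j < d | (j < k)%N) c 0 j * h 0 j) =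
  (f (x + P k + h 0 i *: e_ i) - f (x + P k) - c 0 i * h 0 i) +
  (f (x + P k) - f x - \sum_(j < d | (j < k)%N) c 0 j * h 0 j) by rewrite PS; ring.
apply: le_trans (ler_normD _ _) _; apply: lerD; last exact/IH/ltnW.
apply: MVT_partial => // r rh; apply: bnd => j.
rewrite !mxE eqxx/=.
have -> : forall a b e : R, a + b + e - a = b + e by move=> *; ring.
have [ji|ji] := eqVneq j i.
  by rewrite ji/= ltnn add0r mulr1; exact: le_trans rh _.
rewrite mulr0 addr0; case: ifP => // _; rewrite normr0.
exact: le_trans (hrho i).
Qed.

Lemma partial_eq0 f i (S : set 'rV[R]_d) : closed S ->
  (forall x, ~ S x -> f x = 0) -> forall x, ~ S x -> partial i f x = 0.
Proof.
move=> cS f0 x Sx; rewrite /partial (@near_eq_derive _ _ _ _ (cst 0)) ?derive_cst//.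
have : open_nbhs x (~` S) by split => //; exact: closed_openC.
move=> /open_nbhs_nbhs; apply: filterS => y; exact: f0.
Qed.

Lemma compact_supp_bounded f (S : set 'rV[R]_d) : compact S -> continuous f ->
  (forall x, ~ S x -> f x = 0) -> exists2 M, 0 <= M & forall x, `|f x| <= M.
Proof.
move=> cS cf f0.
have : compact (f @` S) by apply: continuous_compact => //; exact: continuous_subspaceT.
move=> /compact_bounded[M [_ MP]].
exists (`|M| + 1); first by rewrite addr_ge0.
move=> x; have [Sx|Sx] := pselect (S x).
  apply: (MP (`|M| + 1)); last by exists x.
  by rewrite (le_lt_trans (ler_norm M))// ltrDl.
by rewrite f0// normr0 addr_ge0.
Qed.

Lemma test_function_ext f : test_function setT f ->
  closed (supp f) /\ forall x, ~ supp f x -> f x = 0.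
Proof.
move=> _; split; first exact: closed_closure.
move=> x sx; apply: contra_notP sx => /eqP fx; exact: subset_closure.
Qed.

Lemma continuous_partial f i : smooth f -> continuous (partial i f).
Proof. by move=> /(_ [:: i])[]. Qed.

Lemma derivable_smooth f i x : smooth f -> derivable f x (e_ i).
Proof. by move=> /(_ [::])[_]; apply. Qed.

Lemma smooth_partial f i : smooth f -> smooth (partial i f).
Proof. by move=> sf s; have := sf (rcons s i); rewrite foldr_rcons. Qed.

Lemma measurable_test_function f : test_function setT f -> measurable_fun setT f.
Proof. by move=> [sf _ _]; apply: continuous_measurable_rV; exact: (sf [::]).1. Qed.

Lemma measurable_grad f : test_function setT f -> measurable_fun setT (grad f).
Proof.
move=> [sf _ _]; apply: measurable_fun_rVP => i; under eq_fun do rewrite mxE.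
by apply: continuous_measurable_rV; exact: continuous_partial.
Qed.

(** [box_increment_le] is used twice: on the partial derivatives, whose own partial derivatives are
    bounded by compactness of the support, and then on [f]. The indicator of a set of finite measure
    is what makes the remainder square integrable. *)
Lemma test_function_taylor f : test_function setT f ->
  exists (K : R) (S : set 'rV[R]_d), [/\ 0 <= K, measurable S,
    (lebesgue_rV d S < +oo)%E &
    forall x h, enorm h <= 1 ->
      `|f (x + h) - f x - dot (grad f x) h| <= K * enorm h ^+ 2 * \1_S x].
Proof.
move=> tf; have [sf cpt _] := tf; have [cl f0] := test_function_ext tf.
have [M M0 fM] : exists2 M, 0 <= M & forall i j x, `|partial j (partial i f) x| <= M.
  have /choice[m mP] (ij : 'I_d * 'I_d) : exists m : R, 0 <= m /\
      forall x, `|partial ij.2 (partial ij.1 f) x| <= m.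
    have [||m m0 mP] := @compact_supp_bounded (partial ij.2 (partial ij.1 f)) _ cpt; last by exists m.
      exact/continuous_partial/smooth_partial.
    by apply: partial_eq0 => //; exact: partial_eq0.
  exists (\sum_ij m ij); first by apply: sumr_ge0 => ij _; have [] := mP ij.
  move=> i j x; rewrite (bigD1 (i, j))//=.
  have [_ /(_ x) h] := mP (i, j); apply: le_trans h _; rewrite lerDl.
  by apply: sumr_ge0 => ij _; have [] := mP ij.
have [r [_ rP]] := compact_bounded cpt.
pose r0 := `|r| + 1.
have supp_r0 x : supp f x -> forall i, `|x 0 i| <= r0.
  move=> sx i; have : `|x| <= r0 by apply: rP sx; rewrite (le_lt_trans (ler_norm r))// ltrDl.
  apply: le_trans; rewrite /Num.norm/= mx_normrE.
  exact: (le_trans _ (le_bigmax _ _ (0, i))).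
(* Each use of the box estimate costs a factor d, the sum of the |h_i| being at most d |h|. The
   margin 2 ensures that for x outside the box and |h| <= 1 both x and x + h miss the support. *)
exists (M * d%:R ^+ 2), (boxV (fun=> r0 + 2)); split.
- by rewrite mulr_ge0// exprn_ge0.
- exact: measurable_boxV.
- rewrite lebesgue_rV_box ?ltry// => _; rewrite /r0; by rewrite !addr_ge0.
move=> x h h1.
have sum_le : \sum_i `|h 0 i| <= d%:R * enorm h.
  apply: le_trans (_ : \sum_(i < d) enorm h <= _).
    by apply: ler_sum => i _; exact: coord_le_enorm.
  by rewrite sumr_const card_ord mulr_natl.
have [xS|xS] := pselect (boxV (fun=> r0 + 2) x); last first.
  have [i xi] : exists i, r0 + 2 <= `|x 0 i|.
    apply: contra_notP xS => /forallNP xi i; rewrite ltNge; apply/negP; exact: xi.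
  have nsx : ~ supp f x.
    move=> /supp_r0 /(_ i) => xr; move: (le_trans xi xr); rewrite /r0; lra.
  have nsxh : ~ supp f (x + h).
    move=> /supp_r0 /(_ i); rewrite mxE => xr.
    have hi := le_trans (coord_le_enorm h i) h1.
    have : `|x 0 i| <= `|x 0 i + h 0 i| + `|h 0 i|.
      by have := ler_normB (x 0 i + h 0 i) (h 0 i); rewrite addrK.
    by move: xi xr hi; rewrite /r0; lra.
  have -> : grad f x = 0 by apply/rowP => j; rewrite !mxE (partial_eq0 _ cl f0).
  by rewrite (f0 _ nsx) (f0 _ nsxh) dot0l !subr0 normr0 indicE memNset ?mulr0.
rewrite indicE mem_set// mulr1.
apply: (@le_trans _ _ (M * d%:R * enorm h * \sum_i `|h 0 i|)).
  apply: (@box_increment_le _ _ _ _ (enorm h)) => [i z||i z zx].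
  - exact: derivable_smooth.
  - exact: coord_le_enorm.
  rewrite mxE.
  have := @box_increment_le (partial i f) x (z - x) 0 (enorm h) M.
  rewrite dot0l subr0 (_ : x + (z - x) = z); last by rewrite addrC subrK.
  move=> H.
  apply: le_trans (H _ _ _) _.
  - by move=> j y; exact/derivable_smooth/smooth_partial.
  - by move=> j; rewrite !mxE.
  - by move=> j y _; rewrite mxE subr0.
  rewrite -mulrA ler_wpM2l//.
  apply: le_trans (_ : \sum_(j < d) enorm h <= _).
    by apply: ler_sum => j _; rewrite !mxE.
  by rewrite sumr_const card_ord mulr_natl.
rewrite (_ : M * d%:R ^+ 2 * enorm h ^+ 2 = M * d%:R * enorm h * (d%:R * enorm h)); last by ring.
by rewrite ler_wpM2l// !mulr_ge0// enorm_ge0.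
Qed.

End taylor.

(** * Difference quotients in L^2 *)

Section squares.
Context (R : realType) (d : nat).
Local Notation lam := (@lebesgue_rV R d).
Implicit Types (f g r psi : 'rV[R]_d -> R) (P Q : 'rV[R]_d -> 'rV[R]_d) (h x : 'rV[R]_d).

Definition sqint f : \bar R := (\int[lam]_x (f x ^+ 2)%:E)%E.

Definition sqintV P : \bar R := (\int[lam]_x (enorm (P x) ^+ 2)%:E)%E.

Definition incr f h x : R := f (x + h) - f x.

Lemma sqint_ge0 f : (0 <= sqint f)%E.
Proof. by apply: int_ge0 => x; exact: sqr_ge0. Qed.

Lemma sqintV_ge0 P : (0 <= sqintV P)%E.
Proof. by apply: int_ge0 => x; exact: sqr_ge0. Qed.

Lemma sqrD_le (a b : R) : (a + b) ^+ 2 <= 2 * a ^+ 2 + 2 * b ^+ 2.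
Proof.
rewrite -subr_ge0 (_ : _ - _ = (a - b) ^+ 2); first exact: sqr_ge0.
by ring.
Qed.

Lemma le_sqint (c : R) f g : 0 <= c -> measurable_fun setT g ->
  (forall x, `|f x| <= c * `|g x|) -> (sqint f <= (c ^+ 2)%:E * sqint g)%E.
Proof.
move=> c0 mg fg; rewrite -ge0_intZl//; last 3 first.
- exact: sqr_ge0.
- by mfun.
- by move=> x; exact: sqr_ge0.
apply: ge0_le_int => x; first exact: sqr_ge0.
rewrite -[f x ^+ 2]real_normK ?num_real// -[g x ^+ 2]real_normK ?num_real// -exprMn.
by rewrite ler_sqr// nnegrE// mulr_ge0.
Qed.

Lemma sqint_dot_le P h : measurable_fun setT P ->
  (sqint (fun x => dot (P x) h) <= (enorm h ^+ 2)%:E * sqintV P)%E.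
Proof.
move=> mP; apply: le_sqint; [exact: enorm_ge0|by mfun|] => x.
by rewrite mulrC (ger0_norm (enorm_ge0 _)); exact: dot_le_enorm.
Qed.

Lemma sqintD_le f g : measurable_fun setT f -> measurable_fun setT g ->
  (sqint (fun x => f x + g x)%R <= 2%:E * sqint f + 2%:E * sqint g)%E.
Proof.
move=> mf mg; have sq0 (r : R) : 0 <= r ^+ 2 := sqr_ge0 r.
rewrite -!ge0_intZl//; [|by mfun|by mfun].
rewrite -ge0_intD//; try by mfun.
- by apply: ge0_le_int => // x; exact: sqrD_le.
- by move=> x; rewrite mulr_ge0.
- by move=> x; rewrite mulr_ge0.
Qed.

Lemma sqintVD_le P Q : measurable_fun setT P -> measurable_fun setT Q ->
  (sqintV (fun x => P x + Q x)%R <= 2%:E * sqintV P + 2%:E * sqintV Q)%E.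
Proof.
move=> mP mQ; have sq0 (r : R) : 0 <= r ^+ 2 := sqr_ge0 r.
rewrite -!ge0_intZl//; [|by mfun|by mfun].
rewrite -ge0_intD//; try by mfun.
- apply: ge0_le_int => // x; rewrite !sqr_enorm.
  rewrite -subr_ge0 (_ : _ - _ = dot (P x - Q x) (P x - Q x)); first exact: dot_ge0.
  by rewrite !(dotBl, dotBr, dotDl, dotDr) (dotC (Q x) (P x)); ring.
- by move=> x; rewrite mulr_ge0.
- by move=> x; rewrite mulr_ge0.
Qed.

Lemma sqint_translate f h : measurable_fun setT f -> sqint (fun x => f (x + h)) = sqint f.
Proof.
move=> mf; apply: (@ge0_integral_translate R d h (fun x => (f x ^+ 2)%:E)).
  by mfun.
by move=> x; rewrite lee_fin sqr_ge0.
Qed.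

Lemma measurable_incr f h : measurable_fun setT f -> measurable_fun setT (incr f h).
Proof. by move=> mf; rewrite /incr; mfun. Qed.

Lemma sqint_incr_le f h : measurable_fun setT f -> (sqint (incr f h) <= 4%:E * sqint f)%E.
Proof.
move=> mf; have mfh : measurable_fun setT (fun x => f (x + h)) by mfun.
have mfN : measurable_fun setT (fun x => - f x) by mfun.
apply: le_trans (sqintD_le mfh mfN) _; rewrite (sqint_translate _ mf).
have -> : sqint (fun x => - f x) = sqint f.
  by apply: eq_integral => x _; rewrite sqrrN.
by rewrite -ge0_muleDl// -EFinD lee_wpmul2r ?sqint_ge0// lee_fin; lra.
Qed.

Lemma sqint_incr_double f h : measurable_fun setT f ->
  (sqint (incr f (2 *: h)) <= 4%:E * sqint (incr f h))%E.
Proof.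
move=> mf; have mi := measurable_incr h mf.
have mih : measurable_fun setT (fun x => incr f h (x + h)) by mfun.
rewrite (_ : incr f (2 *: h) = fun x => incr f h (x + h) + incr f h x); last first.
  by apply/funext => x; rewrite /incr scaler_nat mulr2n addrA addrA subrK.
apply: le_trans (sqintD_le mih mi) _; rewrite (sqint_translate _ mi).
by rewrite -ge0_muleDl// -EFinD lee_wpmul2r ?sqint_ge0// lee_fin; lra.
Qed.

Lemma sqint_incr_pow f h m : measurable_fun setT f ->
  (sqint (incr f h) <= (4 ^+ m)%:E * sqint (incr f ((2 ^- m) *: h)))%E.
Proof.
move=> mf; elim: m => [|m IH]; first by rewrite invr1 scale1r mul1e.
apply: le_trans IH _; rewrite exprSr EFinM -muleA lee_wpmul2l ?lee_fin ?exprn_ge0//.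
have -> : 2 ^- m *: h = 2 *: (2 ^- m.+1 *: h).
  by rewrite scalerA exprS invfM mulrA mulfV// mul1r.
exact: sqint_incr_double.
Qed.

(* Stands for smooth compactly supported functions, with the advantage of
   being evidently stable under differences. *)
Definition taylor_expandable psi P : Prop :=
  [/\ measurable_fun setT psi, measurable_fun setT P &
   exists (K : R) (S : set 'rV[R]_d), [/\ 0 <= K, measurable S, (lam S < +oo)%E &
    forall x h, enorm h <= 1 ->
      `|psi (x + h) - psi x - dot (P x) h| <= K * enorm h ^+ 2 * \1_S x]].

Lemma test_function_expandable psi : test_function setT psi ->
  taylor_expandable psi (grad psi).
Proof.
move=> tpsi; split; [exact: measurable_test_function|exact: measurable_grad|].
exact: test_function_taylor.
Qed.

Lemma taylor_expandableB psi P phi Q : taylor_expandable psi P -> taylor_expandable phi Q ->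
  taylor_expandable (fun x => psi x - phi x) (fun x => P x - Q x).
Proof.
move=> [mpsi mP [K [S [K0 mS Soo KS]]]] [mphi mQ [L [T [L0 mT Too LT]]]].
split; [by mfun|by mfun|exists (K + L), (S `|` T)]; split.
- exact: addr_ge0.
- exact: measurableU.
- by apply: le_lt_trans (measureU2 _ mS mT) _; rewrite lte_add_pinfty.
move=> x h h1; rewrite dotBl.
have -> : psi (x + h) - phi (x + h) - (psi x - phi x) - (dot (P x) h - dot (Q x) h) =
  (psi (x + h) - psi x - dot (P x) h) - (phi (x + h) - phi x - dot (Q x) h) by ring.
apply: le_trans (ler_normB _ _) _; rewrite !mulrDl.
apply: lerD; [apply: le_trans (KS _ _ h1) _|apply: le_trans (LT _ _ h1) _];
  (apply: ler_wpM2l; first by rewrite mulr_ge0// sqr_ge0);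
  by rewrite !indicE in_setU ler_nat; case: (x \in S); case: (x \in T).
Qed.

Lemma taylor_sqint psi P : taylor_expandable psi P ->
  exists2 A : R, 0 <= A & forall h, enorm h <= 1 ->
    (sqint (fun x => incr psi h x - dot (P x) h)%R <= (A * enorm h ^+ 4)%:E)%E.
Proof.
move=> [mpsi mP [K [S [K0 mS Soo KS]]]].
have lS : lam S = (fine (lam S))%:E by rewrite fineK// ge0_fin_numE.
exists (K ^+ 2 * fine (lam S)) => [|h h1].
  by rewrite mulr_ge0 ?sqr_ge0// fine_ge0.
apply: le_trans (_ : ((K * enorm h ^+ 2) ^+ 2)%:E * sqint (\1_S) <= _)%E.
  apply: le_sqint; first by rewrite mulr_ge0// sqr_ge0.
    exact: measurable_indic.
  by move=> x; rewrite (ger0_norm (_ : 0 <= \1_S x)) ?KS// indicE ler0n.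
have -> : sqint \1_S = lam S.
  rewrite -[in RHS](setIT S) -integral_indic//; apply: eq_integral => x _.
  by rewrite indicE; case: (x \in S); rewrite ?expr1n ?expr0n.
by rewrite lS -EFinM lee_fin exprMn -exprM mulrAC.
Qed.

(** For small k the integral is at most 2 |k|^2 times that of |P|^2, plus a remainder of order
    |k|^4. At k = 2^-m h the factor 4^m from the doubling inequality exactly restores |h|^2 in the
    main term, and a factor 4^-m is left on the remainder. *)
Lemma taylor_sqint_incr psi P h : taylor_expandable psi P ->
  (sqint (incr psi h) <= (2 * enorm h ^+ 2)%:E * sqintV P)%E.
Proof.
move=> tpsi; have [mpsi mP _] := tpsi; have [A A0 hA] := taylor_sqint tpsi.
have small k : enorm k <= 1 -> (sqint (incr psi k) <=
    (2 * enorm k ^+ 2)%:E * sqintV P + (2 * A * enorm k ^+ 4)%:E)%E.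
  move=> k1; have mi := measurable_incr k mpsi.
  rewrite (_ : incr psi k = fun x => dot (P x) k + (incr psi k x - dot (P x) k)); last first.
    by apply/funext => x; rewrite addrC subrK.
  apply: le_trans (sqintD_le _ _) _; [by mfun|by mfun|].
  apply: leeD; first by rewrite EFinM -muleA lee_wpmul2l// sqint_dot_le.
  by rewrite -mulrA EFinM lee_wpmul2l// hA.
apply/lee_addgt0Pr => e e0.
(* The first entry brings 2^-m h into the unit ball, where the expansion is available; the second
   pushes the remainder below e. *)
pose c := Num.max (enorm h) (2 * A * enorm h ^+ 4 / e).
have c0 : 0 <= c by rewrite le_max enorm_ge0.
have [m cm] : exists m : nat, c <= 2 ^+ m.
  exists (Num.bound c); apply: (le_trans (ltW (archi_boundP c0))).
  by rewrite -natrX ler_nat ltnW// ltn_expl.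
have m0 : 0 < 2 ^+ m :> R by rewrite exprn_gt0.
have ek : enorm (2 ^- m *: h) = enorm h / 2 ^+ m.
  by rewrite enormZ ger0_norm ?invr_ge0 ?ltW// mulrC.
apply: le_trans (sqint_incr_pow h m mpsi) _.
apply: le_trans (lee_wpmul2l _ (small _ _)) _.
- by rewrite lee_fin exprn_ge0.
- by rewrite ek ler_pdivrMr// mul1r (le_trans _ cm)// le_max lexx.
have N0 := sqintV_ge0 P.
rewrite ge0_muleDr; last 2 first.
- by rewrite mule_ge0// lee_fin mulr_ge0// sqr_ge0.
- by rewrite lee_fin mulr_ge0 ?exprn_ge0 ?enorm_ge0// mulr_ge0.
have -> : 4 ^+ m = (2 ^+ m) ^+ 2 :> R by rewrite -exprM mulnC exprM; congr (_ ^+ _); ring.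
rewrite muleA -!EFinM ek.
have : 1 <= 2 ^+ m :> R by rewrite exprn_ege1// ler1n.
move: (2 ^+ m) m0 cm => q q0 cq q1; apply: leeD.
  rewrite lee_wpmul2r// lee_fin (_ : q ^+ 2 * (2 * (enorm h / q) ^+ 2) = 2 * enorm h ^+ 2)//.
  by field; rewrite gt_eqF.
rewrite lee_fin (_ : q ^+ 2 * (2 * A * (enorm h / q) ^+ 4) = 2 * A * enorm h ^+ 4 / q ^+ 2); last by field; rewrite gt_eqF.
rewrite ler_pdivrMr ?exprn_gt0// [leRHS]mulrC -ler_pdivrMr//.
apply: le_trans (_ : c <= _); first by rewrite le_max lexx orbT.
apply: le_trans cq _; by rewrite expr2; apply: ler_peMl => //; exact: ltW.
Qed.
End squares.

(** * Density and the bound on increments in H^1 *)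

Section approximable.
Context (R : realType) (d : nat).
Local Notation lam := (@lebesgue_rV R d).
Implicit Types (u psi : 'rV[R]_d -> R) (Du P Q : 'rV[R]_d -> 'rV[R]_d) (h x : 'rV[R]_d).

(** The trace of H^1_0 membership used by the estimates. Finiteness of the norms is kept apart, so
    that the notion is stable under subtraction of an expandable pair, for which no integrability is
    recorded. *)
Definition approximable u Du : Prop :=
  [/\ measurable_fun setT u, measurable_fun setT Du &
   forall e, 0 < e -> exists phi P, [/\ taylor_expandable phi P,
     (sqint (fun x => u x - phi x)%R <= e%:E)%E &
     (sqintV (fun x => Du x - P x)%R <= e%:E)%E]].

Lemma sqintVE P : measurable_fun setT P ->
  (sqintV P = \sum_(i < d) sqint (fun x => P x 0 i)%R)%E.
Proof.
move=> mP; rewrite /sqint -ge0_integral_sum//; last 2 first.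
- by move=> i; mfun.
- by move=> i x _; rewrite lee_fin sqr_ge0.
apply: eq_integral => x _; rewrite sqr_enorm /dot sumEFin; congr EFin.
Qed.

Lemma Lnorm2_sqint (f : 'rV[R]_d -> R) :
  ('N[lam]_2%:E[(fun x => (f x)%:E)] `^ 2 = sqint f)%E.
Proof.
rewrite poweR_Lnorm//; apply: eq_integral => x _.
by rewrite abse_EFin poweR_EFin powR_mulrn// real_normK ?num_real.
Qed.

Lemma Lnorm2_le (f : 'rV[R]_d -> R) (e : R) : 0 <= e ->
  ('N[lam]_2%:E[(fun x => (f x)%:E)] < e%:E)%E -> (sqint f <= (e ^+ 2)%:E)%E.
Proof.
move=> e0 /ltW fe; rewrite -Lnorm2_sqint -powR_mulrn// -poweR_EFin.
by apply: gt0_ler_poweR => //; rewrite in_itv/= leey ?Lnorm_ge0// lee_fin e0.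
Qed.

Lemma Lfun2_measurable (f : 'rV[R]_d -> R) : f \in Lfun lam 2%:E -> measurable_fun setT f.
Proof. by rewrite inE => /andP[+ _]; rewrite inE. Qed.

Lemma Lfun2_sqint (f : 'rV[R]_d -> R) : f \in Lfun lam 2%:E -> (sqint f < +oo)%E.
Proof.
move=> /Lfun2_integrable_sqr /integrableP[_]; apply: le_lt_trans.
by apply: ge0_le_integralT => x /=; rewrite ?lee_fin ?sqr_ge0// ler_norm.
Qed.

Lemma sobolev_H10_approximable (Lambda : set 'rV[R]_d) u Du :
  sobolev_H10 Lambda u Du ->
  [/\ approximable u Du, (sqint u < +oo)%E & (sqintV Du < +oo)%E].
Proof.
move=> [[uL DuL _] [phi [tphi cu cDu]]].
have mu := Lfun2_measurable uL.
have mDu : measurable_fun setT Du.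
  by apply: measurable_fun_rVP => i; exact: Lfun2_measurable (DuL i).
split; [|exact: Lfun2_sqint|]; last first.
  rewrite sqintVE//; apply: lte_sum_pinfty => i _; exact: Lfun2_sqint (DuL i).
(* The d components of the gradient contribute r^2 = e/(d+1) each; d+1 rather than d keeps the
   quotient meaningful for d = 0. *)
split=> // e e0; pose r := Num.sqrt (e / d.+1%:R).
have ed0 : 0 < e / d.+1%:R by rewrite divr_gt0.
have r0 : 0 < r by rewrite sqrtr_gt0.
have r2 : r ^+ 2 = e / d.+1%:R by rewrite sqr_sqrtr// ltW.
have : \forall k \near \oo,
    ('N[lam]_2%:E[(fun x => (u x - phi k x)%:E)] < r%:E)%E /\
    forall i, ('N[lam]_2%:E[(fun x => (Du x ord0 i - partial i (phi k) x)%:E)] < r%:E)%E.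
  have r0E : (0 < r%:E)%E by rewrite lte_fin.
  have h1 : \forall k \near \oo,
    ('N[lam]_2%:E[(fun x => (u x - phi k x)%:E)] < r%:E)%E.
    exact: (cu _ (open_ereal_lt' r0E)).
  have h2 : \forall k \near \oo, forall i,
    ('N[lam]_2%:E[(fun x => (Du x ord0 i - partial i (phi k) x)%:E)] < r%:E)%E.
    by apply: filter_forall => i; exact: (cDu i _ (open_ereal_lt' r0E)).
  by apply: filterS2 h1 h2 => k.
move=> [k _ /(_ k (leqnn k))] [uk Duk].
exists (phi k), (grad (phi k)).
have tk : test_function setT (phi k) by have [sk ck _] := tphi k; split.
split; first exact: test_function_expandable.
  apply: le_trans (Lnorm2_le (ltW r0) uk) _; rewrite r2 lee_fin ler_pdivrMr//.
  by apply: ler_peMr; [exact: ltW|rewrite ler1n].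
have mg : measurable_fun setT (grad (phi k)) by exact: measurable_grad.
rewrite sqintVE; last by mfun.
apply: le_trans (_ : (\sum_(i < d) (r ^+ 2)%:E <= _)%E).
  apply: lee_sum => i _; apply: le_trans (Lnorm2_le (ltW r0) (Duk i)).
  by apply: ge0_le_int => x; rewrite ?sqr_ge0// !mxE.
rewrite sumEFin lee_fin sumr_const card_ord r2 -[X in X <= _]mulr_natr.
rewrite mulrAC ler_pdivrMr// ler_wpM2l ?ler_nat//; exact: ltW.
Qed.

Lemma approximableB u Du psi P : approximable u Du -> taylor_expandable psi P ->
  approximable (fun x => u x - psi x) (fun x => Du x - P x).
Proof.
move=> [mu mDu uP] tpsi; have [mpsi mP _] := tpsi.
split; [by mfun|by mfun|] => e /uP [phi [Q [tphi ue Due]]].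
exists (fun x => phi x - psi x), (fun x => Q x - P x); split.
- exact: taylor_expandableB.
- by apply: le_trans ue; apply: ge0_le_int => x; rewrite ?sqr_ge0// opprB addrA subrK.
- apply: le_trans Due; apply: ge0_le_int => x; rewrite ?sqr_ge0//.
  by rewrite (_ : _ - _ - _ = Du x - Q x)// opprB addrA subrK.
Qed.

(** The constant is 8 = 2 * 2 * 2: splitting u = phi + (u - phi), the bound for [phi], and |P|^2
    compared with |Du|^2. The increment of u - phi is only bounded by its L^2 norm, without a factor
    |h|^2, which suffices since [phi] may depend on [h]: all errors add up to t (8 |h|^2 + 8). *)
Lemma approximable_incr u Du h : approximable u Du ->
  (sqint (incr u h) <= (8 * enorm h ^+ 2)%:E * sqintV Du)%E.
Proof.
move=> [mu mDu uP]; apply/lee_addgt0Pr => e e0.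
have c0 : 0 < 8 * enorm h ^+ 2 + 8 by rewrite ltr_wpDl// mulr_ge0// sqr_ge0.
have [phi [P [tphi ue Due]]] := uP (e / (8 * enorm h ^+ 2 + 8)) (divr_gt0 e0 c0).
set t := e / _ in ue Due.
have [mphi mP _] := tphi.
have mr : measurable_fun setT (fun x => u x - phi x) by mfun.
have E : incr u h = fun x => incr phi h x + incr (fun x => u x - phi x) h x.
  by apply/funext => x; rewrite /incr; ring.
rewrite E; have m1 := measurable_incr h mphi; have m2 := measurable_incr h mr.
apply: le_trans (sqintD_le m1 m2) _.
have DuN : (sqintV P <= 2%:E * sqintV Du + 2%:E * t%:E)%E.
  have EP : P = fun x => Du x + (P x - Du x) by apply/funext => x; rewrite addrC subrK.
  rewrite [leLHS](_ : _ = sqintV (fun x => Du x + (P x - Du x))); last by rewrite -EP.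
  apply: le_trans (sqintVD_le _ _) _; [by mfun|by mfun|].
  rewrite leeD2l// lee_wpmul2l//; apply: le_trans Due.
  apply: ge0_le_int => x; rewrite ?sqr_ge0//.
  by rewrite -(enormN (Du x - P x)) opprB.
have N0 := sqintV_ge0 Du.
have t0 : 0 < t by rewrite divr_gt0.
apply: le_trans (_ : (2%:E * ((2 * enorm h ^+ 2)%:E * (2%:E * sqintV Du + 2%:E * t%:E)) +
    2%:E * (4%:E * t%:E) <= _)%E).
  apply: leeD; apply: lee_wpmul2l => //.
    apply: le_trans (taylor_sqint_incr _ tphi) _; apply: lee_wpmul2l => //.
    by rewrite lee_fin mulr_ge0// sqr_ge0.
  by apply: le_trans (sqint_incr_le _ mr) _; exact: lee_wpmul2l.
rewrite -EFinM ge0_muleDr; last 2 first.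
- exact: mule_ge0.
- by rewrite lee_fin mulr_ge0// ltW.
rewrite ge0_muleDr; last 2 first.
- by apply: mule_ge0; [rewrite lee_fin mulr_ge0// sqr_ge0|exact: mule_ge0].
- by rewrite -EFinM lee_fin; apply: mulr_ge0; [rewrite mulr_ge0// sqr_ge0|rewrite mulr_ge0// ltW].
rewrite !muleA -!EFinM -addeA -EFinD.
rewrite (_ : 2 * (2 * enorm h ^+ 2) * 2 = 8 * enorm h ^+ 2); last by ring.
rewrite (_ : _ + _ = t * (8 * enorm h ^+ 2 + 8)); last by ring.
by rewrite divfK// gt_eqF.
Qed.

End approximable.

(** * Difference quotients against directional derivatives *)

Section defect.
Context (R : realType) (n : nat).
Local Notation d := n.+1.
Local Notation lam := (@lebesgue_rV R d).
Implicit Types (u psi : 'rV[R]_d -> R) (Du P Q : 'rV[R]_d -> 'rV[R]_d) (h x : 'rV[R]_d).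

(** Since division by 0 yields 0, both [quot] and [slope] vanish at [h = 0], and the estimates below
    include that point. *)
Definition quot u h x : R := incr u h x / enorm h.

Definition slope Du h x : R := dot (Du x) (dir h).

Definition defect u Du h : \bar R := sqint (fun x => quot u h x - slope Du h x).

Lemma measurable_quot2 u : measurable_fun setT u ->
  measurable_fun setT (fun z : 'rV[R]_d * 'rV[R]_d => quot u z.1 z.2).
Proof. by move=> mu; rewrite /quot /incr; mfun. Qed.

Lemma measurable_slope2 Du : measurable_fun setT Du ->
  measurable_fun setT (fun z : 'rV[R]_d * 'rV[R]_d => slope Du z.1 z.2).
Proof.
move=> mDu; have mD : measurable_fun setT (@dir R n) by apply: measurable_dir.
by rewrite /slope; mfun.
Qed.

Lemma measurable_quot u h : measurable_fun setT u -> measurable_fun setT (quot u h).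
Proof. by move=> mu; rewrite /quot /incr; mfun. Qed.

Lemma measurable_slope Du h : measurable_fun setT Du -> measurable_fun setT (slope Du h).
Proof. by move=> mDu; rewrite /slope; mfun. Qed.

Lemma measurable_int2 (f : 'rV[R]_d * 'rV[R]_d -> R) : measurable_fun setT f ->
  (forall z, 0 <= f z) -> measurable_fun setT (fun h => \int[lam]_x (f (h, x))%:E)%E.
Proof.
move=> mf f0.
apply: (measurable_fun_fubini_tonelli_F (m2 := lam) (fun z => (f z)%:E)) => /=.
  exact/measurable_EFinP.
by move=> z; rewrite lee_fin.
Qed.

Lemma measurable_defect u Du : measurable_fun setT u -> measurable_fun setT Du ->
  measurable_fun setT (defect u Du).
Proof.
move=> /measurable_quot2 mq /measurable_slope2 ms.
apply: (@measurable_int2 (fun z => (quot u z.1 z.2 - slope Du z.1 z.2) ^+ 2)).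
  by apply: measurable_funX; exact: measurable_funB.
by move=> z; exact: sqr_ge0.
Qed.

Lemma sqint_quot_le u h (c : \bar R) : measurable_fun setT u -> (0 <= c)%E ->
  (sqint (incr u h) <= (enorm h ^+ 2)%:E * c)%E -> (sqint (quot u h) <= c)%E.
Proof.
move=> mu c0 uc; have mi := measurable_incr h mu.
have eh := enorm_ge0 h.
apply: le_trans (_ : ((enorm h)^-1 ^+ 2)%:E * sqint (incr u h) <= _)%E.
  apply: le_sqint => //; first by rewrite invr_ge0.
  by move=> x; rewrite normrM mulrC (ger0_norm (_ : 0 <= (enorm h)^-1)) ?invr_ge0.
apply: le_trans (lee_wpmul2l _ uc) _; first by rewrite lee_fin sqr_ge0.
rewrite muleA -EFinM -exprMn -[leRHS]mul1e lee_wpmul2r// lee_fin.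
have [->|h0] := eqVneq (enorm h) 0; first by rewrite mulr0 expr0n ler01.
by rewrite mulVf// expr1n.
Qed.

Lemma sqint_slope_le Du h : measurable_fun setT Du -> (sqint (slope Du h) <= sqintV Du)%E.
Proof.
move=> mDu; apply: le_trans (sqint_dot_le _ mDu) _.
rewrite -[leRHS]mul1e lee_wpmul2r ?sqintV_ge0// lee_fin.
by apply: exprn_ile1; [exact: enorm_ge0|exact: enorm_dir_le1].
Qed.

Lemma sqint_opp (f : 'rV[R]_d -> R) : sqint (fun x => - f x) = sqint f.
Proof. by apply: eq_integral => x _; rewrite sqrrN. Qed.

(** 18 = 2 * 8 + 2, from [approximable_incr] for the quotient and Cauchy-Schwarz for the slope. *)
Lemma defect_le u Du h : approximable u Du -> (defect u Du h <= 18%:E * sqintV Du)%E.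
Proof.
move=> au; have [mu mDu _] := au.
have mq := measurable_quot h mu; have ms := measurable_slope h mDu.
apply: le_trans (sqintD_le mq _) _; first by mfun.
rewrite sqint_opp.
have -> : (18%:E * sqintV Du = 2%:E * (8%:E * sqintV Du) + 2%:E * sqintV Du)%E.
  by rewrite muleA -EFinM -ge0_muleDl// -EFinD; congr (_%:E * _)%E; ring.
apply: leeD; last by rewrite lee_wpmul2l ?sqint_slope_le.
apply: lee_wpmul2l => //; apply: sqint_quot_le => //.
  by rewrite mule_ge0 ?sqintV_ge0.
by rewrite muleA -EFinM mulrC approximable_incr.
Qed.

Lemma defect_taylor psi P : taylor_expandable psi P ->
  exists2 A : R, 0 <= A & forall h, enorm h <= 1 ->
    (defect psi P h <= (A * enorm h)%:E)%E.
Proof.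
move=> tpsi; have [mpsi mP _] := tpsi; have [A A0 hA] := taylor_sqint tpsi.
exists A => // h h1; have eh := enorm_ge0 h.
apply: le_trans (_ : (((enorm h)^-1 ^+ 2)%:E *
    sqint (fun x => incr psi h x - dot (P x) h)%R <= _)%E).
  apply: le_sqint; [by rewrite invr_ge0|rewrite /incr; by mfun|] => x.
  rewrite /quot /slope dot_dir -mulrBl normrM mulrC.
  by rewrite (ger0_norm (_ : 0 <= (enorm h)^-1)) ?invr_ge0.
apply: le_trans (lee_wpmul2l _ (hA _ h1)) _; first by rewrite lee_fin sqr_ge0.
rewrite -EFinM lee_fin; have [->|h0] := eqVneq (enorm h) 0.
  by rewrite invr0 expr0n !mul0r mulr0.
rewrite (_ : (enorm h)^-1 ^+ 2 * (A * enorm h ^+ 4) = A * (enorm h * enorm h)); last by field.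
by rewrite ler_wpM2l// ler_piMr.
Qed.

Lemma defectD_le u Du psi P h : measurable_fun setT u -> measurable_fun setT Du ->
  measurable_fun setT psi -> measurable_fun setT P ->
  (defect u Du h <= 2%:E * defect psi P h +
    2%:E * defect (fun x => u x - psi x)%R (fun x => Du x - P x)%R h)%E.
Proof.
move=> mu mDu mpsi mP.
have mr : measurable_fun setT (fun x => u x - psi x) by mfun.
have mDr : measurable_fun setT (fun x => Du x - P x) by mfun.
have mq1 := measurable_quot h mpsi; have ms1 := measurable_slope h mP.
have mq2 := measurable_quot h mr; have ms2 := measurable_slope h mDr.
apply: le_trans (sqintD_le _ _); last 2 first.
- exact: measurable_funB.
- exact: measurable_funB.
apply: ge0_le_int => x; first exact: sqr_ge0.
rewrite le_eqVlt; apply/orP; left; apply/eqP; congr (_ ^+ 2).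
by rewrite /quot /incr /slope dotBl; ring.
Qed.

Lemma defect_small u Du e : approximable u Du -> 0 < e ->
  exists2 del, 0 < del & forall h, enorm h < del -> (defect u Du h <= e%:E)%E.
Proof.
move=> au e0; have [mu mDu uP] := au.
(* 72 = 4 * 18: the uniform bound [defect_le] on the remainder, doubled by [defectD_le], then costs
   e/2. *)
have [psi [P [tpsi _ Due]]] := uP (e / 72) (divr_gt0 e0 (ltr0Sn _ _)).
have [mpsi mP _] := tpsi; have [A A0 hA] := defect_taylor tpsi.
exists (Num.min 1 (e / (4 * (A + 1)))).
  by rewrite lt_min ltr01 divr_gt0// mulr_gt0// ltr_wpDl.
move=> h; rewrite lt_min => /andP[h1 he].
apply: le_trans (defectD_le h mu mDu mpsi mP) _.
have -> : (e%:E = 2%:E * (e / 4)%:E + 2%:E * (18 * (e / 72))%:E)%E.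
  by rewrite -!EFinM -EFinD; congr EFin; field.
apply: leeD; apply: lee_wpmul2l => //.
  apply: le_trans (hA h (ltW h1)) _; rewrite lee_fin.
  apply: le_trans (_ : (A + 1) * enorm h <= _).
    by rewrite ler_wpM2r ?enorm_ge0// lerDl.
  rewrite mulrC -ler_pdivlMr ?ltr_wpDl// ltW// (lt_le_trans he)//.
  by rewrite invfM mulrA.
apply: le_trans (defect_le h (approximableB au tpsi)) _.
by rewrite EFinM lee_wpmul2l.
Qed.

Definition escape (Omega : set 'rV[R]_d) (g : 'rV[R]_d -> R) h : \bar R :=
  (\int[lam]_x (\1_Omega x * \1_(~` Omega) (x + h)%R * g x)%:E)%E.

Lemma indic01 (T : Type) (D : set T) (x : T) : 0 <= (\1_D x : R) <= 1.
Proof. by rewrite indicE; case: (x \in D); rewrite ?lexx ?ler01. Qed.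

Section escape.
Variables (Omega : set 'rV[R]_d) (g : 'rV[R]_d -> R).
Hypotheses (oO : open Omega) (mg : measurable_fun setT g) (g0 : forall x, 0 <= g x).

Let mO : measurable Omega. Proof. exact: open_measurable_rV. Qed.
Let mOc : measurable (~` Omega). Proof. exact: measurableC. Qed.

Lemma measurable_escape : measurable_fun setT (escape Omega g).
Proof.
apply: (@measurable_int2 (fun z => \1_Omega z.2 * \1_(~` Omega) (z.2 + z.1) * g z.2)).
  by mfun.
by move=> z; rewrite mulr_ge0// mulr_ge0.
Qed.

Lemma escape_le h : (escape Omega g h <= \int[lam]_x (g x)%:E)%E.
Proof.
apply: ge0_le_int => x.
  by rewrite mulr_ge0// mulr_ge0.
by rewrite ler_piMl.
Qed.

Let core k := ~` \bigcup_(y in ~` Omega) ball y (k.+1%:R^-1 : R).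

Let mcore k : measurable (core k).
Proof.
apply: measurableC; apply: open_measurable_rV; apply: bigcup_open => y _.
exact: ball_open.
Qed.

(** A shift shorter than 1/(k+1) cannot leave Omega from [core k], the set of points whose sup-norm
    distance to the complement is at least 1/(k+1). As Omega is open these sets exhaust it, and
    dominated convergence with majorant [g] applies to what they leave out. *)
Lemma escape_small e : (\int[lam]_x (g x)%:E < +oo)%E -> 0 < e ->
  exists2 del, 0 < del & forall h, enorm h < del -> (escape Omega g h <= e%:E)%E.
Proof.
move=> goo e0.
pose f k x : \bar R := (\1_Omega x * \1_(~` core k) x * g x)%:E.
have mf k : measurable_fun setT (f k).
  have mc := mcore k; have mcc := measurableC mc; rewrite /f; by mfun.
have fcvg x : setT x -> f k x @[k --> \oo] --> (cst 0 x : \bar R).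
  move=> _; apply: cvg_near_cst.
  have [xO|xO] := pselect (Omega x); last first.
    by near=> k; rewrite /f indicE memNset// !mul0r.
  have /nbhs_ballP[r /= r0 rO] := open_nbhs_nbhs (conj oO xO).
  near=> k; rewrite /f [\1_(~` _) x]indicE memNset ?mulr0 ?mul0r//.
  move=> /contrapT [y yO] /ball_sym xy; apply: yO; apply: rO.
  apply: le_ball xy; apply: ltW; near: k; exact: (near_infty_natSinv_lt (PosNum r0)).
have ig : lam.-integrable setT (fun x => (g x)%:E).
  apply/integrableP; split; first exact/measurable_EFinP.
  apply: le_lt_trans goo; apply: ge0_le_integralT => x //.
  by rewrite gee0_abs// lee_fin.
have fg k x : setT x -> (`|f k x| <= (g x)%:E)%E.
  move=> _; rewrite lee_fin normrM (ger0_norm (g0 x)) ler_piMl//.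
  have /andP[a0 a1] := @indic01 _ Omega x; have /andP[b0 b1] := @indic01 _ (~` core k) x.
  by rewrite ger0_norm ?mulr_ge0// -[leRHS]mulr1 ler_pM.
have := @dominated_cvg _ _ _ lam setT measurableT f (cst 0%E) _ mf fcvg
   (fun x _ => erefl : (g x)%:E \is a fin_num) ig fg.
rewrite integral_cst// mul0e.
have e0E : (0 < e%:E)%E by rewrite lte_fin.
move=> /(_ _ (open_ereal_lt' e0E))[k _ /(_ k (leqnn k))] /= fke.
exists (k.+1%:R^-1); first by rewrite invr_gt0.
move=> h hk; apply: le_trans (ltW fke); apply: ge0_le_integralT => x.
  by rewrite lee_fin mulr_ge0// mulr_ge0.
rewrite lee_fin ler_wpM2r// ler_wpM2l//.
rewrite !indicE ler_nat; case: (boolP (x + h \in ~` Omega)) => // /set_mem xhO.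
rewrite mem_set// => -[]; exists (x + h) => //.
rewrite -ball_normE /ball_/= addrAC subrr add0r.
apply: le_lt_trans hk; rewrite /Num.norm/= mx_normrE.
apply: bigmax_le => [|[i j] _]; first exact: enorm_ge0.
by rewrite (ord1 i); exact: coord_le_enorm.
Unshelve. all: by end_near.
Qed.

End escape.

End defect.

(** Keeping the nonnegative weight [c] outside the positive and negative parts allows identities for
    nonnegative homogeneous functions to be applied to each part. *)
Lemma integral_posneg dT (T : measurableType dT) (R : realType) (mu : {measure set T -> \bar R})
    (g c : T -> R) : (forall x, 0 <= c x) ->
  (\int[mu]_x (g x * c x)%:E =
   \int[mu]_x (Num.max (g x) 0 * c x)%:E - \int[mu]_x (Num.max (- g x) 0 * c x)%:E)%E.
Proof.
move=> c0; rewrite integralE; congr (_ - _)%E; apply: eq_integral => x _.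
  by rewrite funeposE -EFin_max maxr_pMl// mul0r.
by rewrite funenegE -EFinN -EFin_max maxr_pMl// mul0r mulNr.
Qed.

(** * Comparison of the nonlocal and local densities *)

Section local_limit.
Context (R : realType) (n : nat).
Local Notation d := n.+1.
Local Notation lam := (@lebesgue_rV R d).
Implicit Types (s : R) (a b h x : 'rV[R]_d).

Lemma int_weight_homogeneous_comp s (f : 'rV[R]_d -> R) (g : R -> R) : 0 < s < 2^-1 ->
  measurable_fun setT f -> f 0 = 0 -> (forall t h, 0 < t -> f (t *: h) = f h) ->
  measurable_fun setT g -> (forall r, 0 <= g r) -> g 0 = 0 ->
  (\int[lam]_h (g (f h) * ((enorm h < 1)%R%:R * weight s h))%:E =
   (d%:R / alpha R d)%:E * \int[lam]_h (g (f h) * (enorm h < 1)%R%:R)%:E)%E.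
Proof.
move=> s01 mf f0 fZ mg g0 g00; under eq_integral do rewrite mulrA.
apply: (@int_weight_homogeneous R n s (fun h => g (f h))) => //; first by mfun.
- by rewrite f0.
- by move=> t h t0; rewrite fZ.
Qed.

Lemma int_weight_homogeneous_signed s (f : 'rV[R]_d -> R) M : 0 < s < 2^-1 ->
  measurable_fun setT f -> (forall h, `|f h| <= M) -> f 0 = 0 ->
  (forall t h, 0 < t -> f (t *: h) = f h) ->
  (\int[lam]_h (f h * ((enorm h < 1)%R%:R * weight s h))%:E =
   (d%:R / alpha R d)%:E * \int[lam]_h (f h * (enorm h < 1)%R%:R)%:E)%E.
Proof.
move=> s01 mf fM f0 fZ; have /andP[s0 s2] := s01.
have w0 h : 0 <= weight s h := weight_ge0 h s2.
have mpos : measurable_fun setT (fun r : R => Num.max r 0) by apply: measurable_maxr.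
have mneg : measurable_fun setT (fun r : R => Num.max (- r) 0).
  by apply: measurable_maxr => //; mfun.
have pos0 (r : R) : 0 <= Num.max r 0 by rewrite le_max lexx orbT.
have neg0 (r : R) : 0 <= Num.max (- r) 0 by rewrite le_max lexx orbT.
rewrite integral_posneg; last by move=> h; rewrite mulr_ge0.
rewrite [X in (_ * X)%E]integral_posneg//.
rewrite (int_weight_homogeneous_comp s01 mf f0 fZ mpos pos0) ?maxxx//.
rewrite (int_weight_homogeneous_comp s01 mf f0 fZ mneg neg0) ?oppr0 ?maxxx//.
have fin (g : R -> R) : measurable_fun setT g -> (forall r, `|g r| <= `|r|) ->
    (\int[lam]_h (g (f h) * (enorm h < 1)%R%:R)%:E)%E \is a fin_num.
  move=> mg gr; apply: integrable_fin_num => //.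
  apply: (@measurable_bounded_int_ball _ _ _ M); first by mfun.
  by move=> h; apply: le_trans (gr _) (fM h).
have mulB (r : R) (x y : \bar R) : x \is a fin_num ->
    (r%:E * x - r%:E * y = r%:E * (x - y))%E.
  by move=> xfin; rewrite muleBr// fin_num_adde_defr.
apply: mulB; apply: (fin (fun r => Num.max r 0) mpos) => r.
by rewrite ger0_norm// ge_max ler_norm normr_ge0.
Qed.

Lemma int_weight_identity s a b : 0 < s < 2^-1 ->
  (\int[lam]_h (dot a (dir h) * Gtilde d 2^-1 (dot a (dir h)) * dot b (dir h) *
     ((enorm h < 1)%R%:R * weight s h))%:E =
   (dot a b / Num.sqrt (1 + enorm a ^+ 2))%:E)%E.
Proof.
move=> s01; have h20 : 0 <= 2^-1 :> R by [].
have mG : measurable_fun setT (@Gtilde R d 2^-1) by apply: measurable_Gtilde.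
have mD : measurable_fun setT (@dir R n) by apply: measurable_dir.
rewrite (@int_weight_homogeneous_signed s (fun h => dot a (dir h) *
  Gtilde d 2^-1 (dot a (dir h)) * dot b (dir h)) (enorm a * enorm b))//.
- rewrite int_ball_identity -EFinM; congr EFin; move: (dot a b / _) => q.
  by field; rewrite nat1r pnatr_eq0/= gt_eqF// alpha_gt0.
- by mfun.
- move=> h; rewrite normrM ler_pM ?dot_dir_le//.
  by apply: le_trans (mul_Gtilde_le d _ h20) _; exact: dot_dir_le.
- by rewrite dir0 dotC dot0l !mul0r.
- by move=> t h t0; rewrite dirZ.
Qed.

End local_limit.

(** * The substitution y = x + h *)

Section shear.
Context (R : realType) (d : nat).
Local Notation lam := (@lebesgue_rV R d).

Definition shear (z : 'rV[R]_d * 'rV[R]_d) := (z.1, z.1 + z.2).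

Lemma measurable_shear : measurable_fun setT shear.
Proof. by rewrite /shear; mfun. Qed.

Lemma shear_preserving A : measurable A ->
  ((lam \x lam) (shear @^-1` A) = (lam \x lam) A)%E.
Proof.
move=> mA; have mS := measurable_shear.
have intE B : measurable B ->
    ((lam \x lam) B = \int[lam]_x \int[lam]_y (\1_B (x, y) : R)%:E)%E.
  move=> mB; rewrite -[in LHS](setIT B) -integral_indic//.
  by apply: (@ge0_integral_prod _ _ _ _ R lam lam (\1_B)) => //; exact: measurable_indic.
rewrite (intE _ mA) intE; last exact: measurable_preimage.
apply: eq_integral => x _.
have := @ge0_integral_translate R d x (fun y => (\1_A (x, y) : R)%:E).
move=> <-.
- by apply: eq_integral => y _; congr EFin; rewrite !indicE /shear/= [y + x]addrC.
- apply/measurable_EFinP; apply: measurable_indic_comp => //; by mfun.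
- by move=> y; rewrite lee_fin.
Qed.

Lemma integral_shear (f : 'rV[R]_d * 'rV[R]_d -> \bar R) : measurable_fun setT f ->
  (\int[lam \x lam]_z f z = \int[lam \x lam]_z f (shear z))%E.
Proof.
move=> mf; symmetry; apply: (@integral_comp _ _ _ _ _ (lam \x lam)%E (lam \x lam)%E shear f) => //.
- exact: measurable_shear.
- exact: shear_preserving.
Qed.

End shear.

(** * Pointwise comparison of the fluxes *)

Section densities.
Context (R : realType) (n : nat).
Local Notation d := n.+1.
Local Notation lam := (@lebesgue_rV R d).
Implicit Types (s e eta p q : R) (a b h x : 'rV[R]_d) (z : 'rV[R]_d * 'rV[R]_d).

Definition flux s p q : R := p * Gtilde d s p * q.

Lemma young eta p q : 0 < eta -> `|p| * `|q| <= eta * p ^+ 2 + eta^-1 * q ^+ 2.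
Proof.
move=> eta0; rewrite -(real_normK (num_real p)) -(real_normK (num_real q)).
have P0 := normr_ge0 p; have Q0 := normr_ge0 q.
move: `|p| `|q| P0 Q0 => P Q P0 Q0.
have i0 : 0 < eta^-1 by rewrite invr_gt0.
rewrite -subr_ge0.
have -> : eta * P ^+ 2 + eta^-1 * Q ^+ 2 - P * Q = eta * (P - Q / (2 * eta)) ^+ 2 + 3 / 4 * (eta^-1 * Q ^+ 2).
  by field; rewrite gt_eqF.
by rewrite addr_ge0// mulr_ge0 ?sqr_ge0 ?mulr_ge0 ?sqr_ge0// ltW.
Qed.

Lemma flux_le s p q : 0 <= s -> `|flux s p q| <= p ^+ 2 + q ^+ 2.
Proof.
move=> s0; rewrite normrM.
apply: le_trans (_ : `|p| * `|q| <= _); first by rewrite ler_wpM2r ?mul_Gtilde_le.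
by have := @young 1 p q ltr01; rewrite invr1 !mul1r.
Qed.

(** The slopes [p'], [q'] do not become small, so their squares need a small coefficient, while the
    squared differences tolerate a large one because their integrals tend to 0 with h. Young's
    inequality with parameter [eta] arranges this in the mixed products. *)
Lemma flux_dist_le s eta p q p' q' : 0 <= s <= 2^-1 -> 0 < eta <= 1 ->
  `|flux s p q - flux 2^-1 p' q'| <=
    (1 - 2 * s + (d%:R + 3) * eta) * (p' ^+ 2 + q' ^+ 2) +
    (3 * (d%:R + 3) / eta) * ((p - p') ^+ 2 + (q - q') ^+ 2).
Proof.
move=> s01 /andP[eta0 eta1]; have /andP[s0 s2] := s01.
have h20 : 0 <= 2^-1 :> R by [].
pose a := p - p'; pose b := q - q'; pose L : R := d%:R + 3.
have L3 : 3 <= L by rewrite lerDr.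
(* Three successive changes: the kernel from s to 1/2, the first argument from p to p' by the
   Lipschitz bound, the second from q to q'. *)
have -> : flux s p q - flux 2^-1 p' q' = p * (Gtilde d s p - Gtilde d 2^-1 p) * q
   + (p * Gtilde d 2^-1 p - p' * Gtilde d 2^-1 p') * q + p' * Gtilde d 2^-1 p' * b.
  rewrite /flux /b; move: (Gtilde d s p) (Gtilde d 2^-1 p) (Gtilde d 2^-1 p') => g g1 g2.
  by ring.
have e1 : `|p * (Gtilde d s p - Gtilde d 2^-1 p) * q| <= (1 - 2 * s) * (p' ^+ 2 + q' ^+ 2) + (a ^+ 2 + b ^+ 2).
  rewrite 2!normrM; apply: le_trans (_ : `|p| * (1 - 2 * s) * `|q| <= _).
    by rewrite ler_wpM2r// ler_wpM2l// Gtilde_sub_le.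
  apply: le_trans (_ : (1 - 2 * s) * (p' ^+ 2 + q' ^+ 2 + (a ^+ 2 + b ^+ 2)) <= _); last first.
    rewrite mulrDr lerD2l ler_piMl ?addr_ge0 ?sqr_ge0//; lra.
  rewrite mulrAC mulrC ler_wpM2l//; first by lra.
  have pq : 2 * (`|p| * `|q|) <= p ^+ 2 + q ^+ 2.
    rewrite -(real_normK (num_real p)) -(real_normK (num_real q)) -subr_ge0.
    by rewrite (_ : _ - _ = (`|p| - `|q|) ^+ 2) ?sqr_ge0//; ring.
  have pE : p ^+ 2 <= 2 * p' ^+ 2 + 2 * a ^+ 2.
    by rewrite (_ : p = p' + a) ?sqrD_le// /a addrC subrK.
  have qE : q ^+ 2 <= 2 * q' ^+ 2 + 2 * b ^+ 2.
    by rewrite (_ : q = q' + b) ?sqrD_le// /b addrC subrK.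
  by lra.
have e2 : `|(p * Gtilde d 2^-1 p - p' * Gtilde d 2^-1 p') * q| <=
    L * (eta * q' ^+ 2 + eta^-1 * a ^+ 2 + (a ^+ 2 + b ^+ 2)).
  rewrite normrM; apply: le_trans (_ : L * `|a| * `|q| <= _).
    rewrite ler_wpM2r//; apply: le_trans (Gtilde_lipschitz d p p' h20) _.
    by rewrite (_ : d%:R + 2 + 2 * 2^-1 = L)// /L; field.
  rewrite -mulrA ler_wpM2l//; first by lra.
  apply: le_trans (_ : `|q'| * `|a| + `|a| * `|b| <= _).
    rewrite [`|q'| * _]mulrC -mulrDr ler_wpM2l//.
    by rewrite (_ : q = q' + b) ?ler_normD// /b addrC subrK.
  apply: lerD; first exact: young.
  by have := @young 1 a b ltr01; rewrite invr1 !mul1r.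
have e3 : `|p' * Gtilde d 2^-1 p' * b| <= eta * p' ^+ 2 + eta^-1 * b ^+ 2.
  rewrite normrM; apply: le_trans (_ : `|p'| * `|b| <= _); last exact: young.
  by rewrite ler_wpM2r// mul_Gtilde_le.
apply: le_trans (ler_normD _ _) _; apply: le_trans (lerD (ler_normD _ _) (lexx _)) _.
apply: le_trans (lerD (lerD e1 e2) e3) _.
rewrite -/a -/b -/L; move: (sqr_ge0 a) (sqr_ge0 b) (sqr_ge0 p') (sqr_ge0 q').
move: (a ^+ 2) (b ^+ 2) (p' ^+ 2) (q' ^+ 2) => A B P Q A0 B0 P0 Q0.
have i1 : 1 <= eta^-1 by rewrite invf_ge1.
move: (eta^-1) i1 => i i1.
have L1 : 1 <= L by lra.
have Li1 : 1 <= L * i by rewrite mulr_ege1.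
have iA0 : A <= i * A by rewrite ler_peMl.
have iB0 : B <= i * B by rewrite ler_peMl.
have eP : eta * P <= L * (eta * P) by apply: ler_peMl => //; rewrite mulr_ge0// ltW.
have L0 : 0 <= L by lra.
have LA : A <= L * i * A by rewrite ler_peMl.
have LA' : L * A <= L * (i * A) by rewrite ler_wpM2l.
have LB : B <= L * i * B by rewrite ler_peMl.
have LB' : L * B <= L * (i * B) by rewrite ler_wpM2l.
have LB'' : i * B <= L * (i * B) by rewrite ler_peMl// mulr_ge0//; lra.
lra.
Qed.

End densities.

(** * Densities of the form and of its limit *)

Section densities.
Context (R : realType) (n : nat).
Local Notation d := n.+1.
Local Notation lam := (@lebesgue_rV R d).
Implicit Types (s : R) (h x : 'rV[R]_d) (z : 'rV[R]_d * 'rV[R]_d).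
Variable Omega : set 'rV[R]_d.

Definition local_density (Du Dv : 'rV[R]_d -> 'rV[R]_d) s z : R :=
  \1_Omega z.1 * (flux n 2^-1 (slope Du z.2 z.1) (slope Dv z.2 z.1) *
    ((enorm z.2 < 1)%R%:R * weight s z.2)).

(** The first factor is the indicator of [QOmega Omega] at (x, x + h), split according to whether x
    lies in Omega; only the first summand has a counterpart in [local_density]. *)
Definition form_density (u v : 'rV[R]_d -> R) s z : R :=
  (\1_Omega z.1 + \1_(~` Omega) z.1 * \1_Omega (z.1 + z.2)) *
  (flux n s (quot u z.2 z.1) (quot v z.2 z.1) * weight s z.2).

Hypothesis oO : open Omega.
Let mO : measurable Omega. Proof. exact: open_measurable_rV. Qed.
Let mOc : measurable (~` Omega). Proof. exact: measurableC. Qed.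

Lemma measurable_flux dT (T : measurableType dT) s (f g : T -> R) : 0 <= s ->
  measurable_fun setT f -> measurable_fun setT g ->
  measurable_fun setT (fun t => flux n s (f t) (g t)).
Proof.
move=> s0 mf mg; have mG : measurable_fun setT (@Gtilde R d s) by apply: measurable_Gtilde.
by rewrite /flux; mfun.
Qed.

Lemma measurable_local_density Du Dv s : measurable_fun setT Du -> measurable_fun setT Dv ->
  measurable_fun setT (local_density Du Dv s).
Proof.
move=> mDu mDv; have mw : measurable_fun setT (@weight R n s) by exact: measurable_weight.
have mD : measurable_fun setT (@dir R n) by apply: measurable_dir.
have mf : measurable_fun setT (fun z : 'rV[R]_d * 'rV[R]_d =>
    flux n 2^-1 (slope Du z.2 z.1) (slope Dv z.2 z.1)).
  by apply: measurable_flux => //; rewrite /slope; mfun.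
by rewrite /local_density; mfun.
Qed.

Lemma measurable_form_density u v s : 0 <= s ->
  measurable_fun setT u -> measurable_fun setT v ->
  measurable_fun setT (form_density u v s).
Proof.
move=> s0 mu mv; have mw : measurable_fun setT (@weight R n s) by exact: measurable_weight.
have mf : measurable_fun setT (fun z : 'rV[R]_d * 'rV[R]_d =>
    flux n s (quot u z.2 z.1) (quot v z.2 z.1)).
  by apply: measurable_flux => //; rewrite /quot /incr; mfun.
by rewrite /form_density; mfun.
Qed.

Lemma integrable_local_density Du Dv s : 0 < s < 2^-1 ->
  measurable_fun setT Du -> measurable_fun setT Dv ->
  (sqintV Du < +oo)%E -> (sqintV Dv < +oo)%E ->
  (lam \x lam)%E.-integrable setT (fun z => (local_density Du Dv s z)%:E).
Proof.
move=> s01 mDu mDv Duoo Dvoo; have /andP[s0 s2] := s01.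
have w0 h : 0 <= weight s h := weight_ge0 h s2.
have mw : measurable_fun setT (@weight R n s) by exact: measurable_weight.
have h20 : 0 <= 2^-1 :> R by [].
apply/integrableP; split.
  by apply/measurable_EFinP; exact: measurable_local_density.
pose g x := enorm (Du x) ^+ 2 + enorm (Dv x) ^+ 2.
have g0 x : 0 <= g x by rewrite addr_ge0 ?sqr_ge0.
have mg : measurable_fun setT g by rewrite /g; mfun.
apply: le_lt_trans (_ : (\int[lam \x lam]_z (g z.1 * ((enorm z.2 < 1)%R%:R * weight s z.2))%:E < _)%E).
  apply: ge0_le_integralT => z; first exact: abse_ge0.
  have nw0 : 0 <= (enorm z.2 < 1)%R%:R * weight s z.2 by rewrite mulr_ge0.
  rewrite lee_fin normrM -[leRHS]mul1r; apply: ler_pM => //.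
    by rewrite ger0_norm// indicE lern1 leq_b1.
  rewrite normrM (ger0_norm nw0); apply: ler_wpM2r => //.
  apply: le_trans (flux_le _ _ _ h20) _.
  have sq a h : dot a (dir h) ^+ 2 <= enorm a ^+ 2.
    rewrite -(real_normK (num_real (dot a _))) ler_sqr ?nnegrE ?enorm_ge0//.
    exact: dot_dir_le.
  by apply: lerD; exact: sq.
rewrite ge0_integral_prod; last 2 first.
- by mfun.
- by move=> z; rewrite mulr_ge0// mulr_ge0.
apply: le_lt_trans (_ : (\int[lam]_x (d%:R * g x)%:E < +oo)%E).
  rewrite le_eqVlt; apply/orP; left; apply/eqP; apply: eq_integral => x _.
  rewrite -[LHS]/(\int[lam]_h (g x * ((enorm h < 1)%R%:R * weight s h))%:E)%E ge0_intZl//; last 2 first.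
  - by mfun.
  - by move=> h; rewrite mulr_ge0.
  by rewrite int_weight_ball// -EFinM mulrC.
rewrite ge0_intZl// lte_mul_pinfty//.
rewrite ge0_intD; [exact: lte_add_pinfty|by mfun|by mfun| |] => x; exact: sqr_ge0.
Qed.

Lemma int_local_density Du Dv s : 0 < s < 2^-1 ->
  measurable_fun setT Du -> measurable_fun setT Dv ->
  (sqintV Du < +oo)%E -> (sqintV Dv < +oo)%E ->
  (\int[lam \x lam]_z (local_density Du Dv s z)%:E =
   \int[lam]_(x in Omega) (dot (Du x) (Dv x) / Num.sqrt (1 + enorm (Du x) ^+ 2))%:E)%E.
Proof.
move=> s01 mDu mDv Duoo Dvoo.
rewrite -(integral12_prod_meas1 (integrable_local_density s01 mDu mDv Duoo Dvoo)).
rewrite [RHS]integral_mkcond; apply: eq_integral => x _.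
rewrite patchE -[LHS]/(\int[lam]_h (\1_Omega x * (flux n 2^-1 (slope Du h x) (slope Dv h x) *
    ((enorm h < 1)%R%:R * weight s h)))%:E)%E indicE; case: (x \in Omega); last first.
  by apply: integral0_eq => h _; rewrite mul0r.
rewrite -(int_weight_identity _ _ s01); apply: eq_integral => h _.
by rewrite mul1r.
Qed.

Lemma nonlocal_formE u v s : 0 < s < 2^-1 ->
  measurable_fun setT u -> measurable_fun setT v ->
  (lam \x lam)%E.-integrable setT (fun z => (form_density u v s z)%:E) ->
  nonlocal_form Omega s u u v = (\int[lam \x lam]_z (form_density u v s z)%:E)%E.
Proof.
move=> s01 mu mv iF; have /andP[s0 s2] := s01.
have C0 := Cds_gt0 n s2.
have mG : measurable_fun setT (@Gtilde R d s) by apply: measurable_Gtilde; exact: ltW.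
pose G z : R := (Gtilde d s ((u z.1 - u z.2) / enorm (z.1 - z.2)) *
      ((u z.1 - u z.2) * (v z.1 - v z.2)) /
      enorm (z.1 - z.2) `^ (d%:R + 1 + 2 * s)).
have mQ : measurable (QOmega Omega) by apply: measurableC; exact: measurableX.
pose F z : \bar R := (\1_(QOmega Omega) z * G z)%:E.
have mF : measurable_fun setT F.
  by rewrite /F /G; mfun.
have FE z : F (shear z) = ((Cds d s)^-1 * form_density u v s z)%:E.
  rewrite /F /G /form_density /shear /quot /incr /=; congr EFin.
  have -> : z.1 - (z.1 + z.2) = - z.2 by rewrite opprD addNKr.
  have -> : (\1_(QOmega Omega) (z.1, z.1 + z.2) : R) =
      \1_Omega z.1 + \1_(~` Omega) z.1 * \1_Omega (z.1 + z.2).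
    rewrite !indicE in_setC; have [xO|xO] := boolP (z.1 \in Omega).
      by rewrite mul0r addr0 mem_set// => -[/= + _]; apply; exact: set_mem.
    rewrite mul1r add0r; have [yO|yO] := boolP (z.1 + z.2 \in Omega).
      by rewrite mem_set// => -[/= _]; apply; exact: set_mem.
    rewrite memNset// => nQ; apply: nQ; split => /= /mem_set; exact/negP.
  rewrite enormN /flux /weight.
  have [z0|z0] := eqVneq z.2 0.
    by rewrite z0 !addr0 !subrr !mul0r !mulr0 !mul0r !mulr0.
  have t0 : enorm z.2 != 0 by rewrite gt_eqF// enorm_gt0.
  (* The increments of the form are opposite to those of [quot]; the sign disappears because the
     kernel is even and the increments of u and v are multiplied. *)
  have -> : (u z.1 - u (z.1 + z.2)) / enorm z.2 = - ((u (z.1 + z.2) - u z.1) / enorm z.2).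
    by rewrite -mulNr opprB.
  rewrite GtildeN; move: (Gtilde _ _ _) (enorm z.2 `^ _)^-1 (\1_Omega z.1 + _ : R) => g P c.
  by field; rewrite t0 gt_eqF.
rewrite /nonlocal_form.
transitivity ((Cds d s)%:E * \int[lam \x lam]_z F z)%E.
  congr (_ * _)%E; rewrite integral_mkcond; apply: eq_integral => z _.
  by rewrite patchE /F indicE; case: (z \in QOmega Omega); rewrite ?mul1r ?mul0r.
rewrite (integral_shear mF).
transitivity ((Cds d s)%:E * \int[lam \x lam]_z ((Cds d s)^-1%:E * (form_density u v s z)%:E))%E.
  by congr (_ * _)%E; apply: eq_integral => z _; rewrite FE EFinM.
by rewrite integralZl// muleA -EFinM mulfV ?mul1e// gt_eqF.
Qed.

End densities.

(** * Pointwise and boundary estimates for the difference of densities *)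

Section estimate.
Context (R : realType) (n : nat).
Local Notation d := n.+1.
Local Notation lam := (@lebesgue_rV R d).
Implicit Types (s eta : R) (h x : 'rV[R]_d) (z : 'rV[R]_d * 'rV[R]_d).
Variables (Omega : set 'rV[R]_d) (u v : 'rV[R]_d -> R) (Du Dv : 'rV[R]_d -> 'rV[R]_d).
Hypotheses (oO : open Omega) (au : approximable u Du) (av : approximable v Dv).

Let mO : measurable Omega. Proof. exact: open_measurable_rV. Qed.
Let mOc : measurable (~` Omega). Proof. exact: measurableC. Qed.
Let mu : measurable_fun setT u. Proof. by case: au. Qed.
Let mv : measurable_fun setT v. Proof. by case: av. Qed.
Let mDu : measurable_fun setT Du. Proof. by case: au. Qed.
Let mDv : measurable_fun setT Dv. Proof. by case: av. Qed.

Definition near_weight s h : R := (enorm h < 1)%R%:R * weight s h.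

Definition far_weight s h : R := (1 <= enorm h)%R%:R * weight s h.

Lemma near_weight_ge0 s h : s < 2^-1 -> 0 <= near_weight s h.
Proof. by move=> s2; rewrite mulr_ge0 ?weight_ge0. Qed.

Lemma far_weight_ge0 s h : s < 2^-1 -> 0 <= far_weight s h.
Proof. by move=> s2; rewrite mulr_ge0 ?weight_ge0. Qed.

Lemma measurable_near_weight s : measurable_fun setT (near_weight s).
Proof.
have mw : measurable_fun setT (@weight R n s) by exact: measurable_weight.
by rewrite /near_weight; mfun.
Qed.

Definition sqr_slopes h x : R := slope Du h x ^+ 2 + slope Dv h x ^+ 2.

Definition sqr_quots h x : R := quot u h x ^+ 2 + quot v h x ^+ 2.

Definition sqr_defects h x : R :=
  (quot u h x - slope Du h x) ^+ 2 + (quot v h x - slope Dv h x) ^+ 2.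

(** The first two terms serve x in Omega with |h| < 1, where the fluxes are compared. The third
    serves pairs entering Omega and the fourth |h| >= 1; in these cases the local density is 0 and
    the flux is bounded by squared quotients. *)
Lemma density_dist_le s eta x h : 0 < s < 2^-1 -> 0 < eta <= 1 ->
  `|form_density Omega u v s (x, h) - local_density Omega Du Dv s (x, h)| <=
    near_weight s h * ((1 - 2 * s + (d%:R + 3) * eta) * sqr_slopes h x)
    + near_weight s h * (3 * (d%:R + 3) / eta * sqr_defects h x)
    + near_weight s h * (\1_(~` Omega) x * \1_Omega (x + h) * sqr_quots h x)
    + far_weight s h * sqr_quots h x.
Proof.
move=> s01 eta01; have /andP[s0 s2] := s01; have /andP[eta0 eta1] := eta01.
have w0 : 0 <= weight s h by exact: weight_ge0.
have s01' : 0 <= s <= 2^-1 by rewrite !ltW.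
have sl0 : 0 <= sqr_slopes h x by rewrite addr_ge0 ?sqr_ge0.
have qu0 : 0 <= sqr_quots h x by rewrite addr_ge0 ?sqr_ge0.
have de0 : 0 <= sqr_defects h x by rewrite addr_ge0 ?sqr_ge0.
have pq : `|flux n s (quot u h x) (quot v h x)| <= sqr_quots h x.
  by apply: flux_le; exact: ltW.
have L0 : 0 <= d%:R + 3 :> R by rewrite addr_ge0.
have c10 : 0 <= (1 - 2 * s + (d%:R + 3) * eta) * sqr_slopes h x.
  by rewrite mulr_ge0// addr_ge0 ?mulr_ge0 ?(ltW eta0)//; lra.
have c20 : 0 <= 3 * (d%:R + 3) / eta * sqr_defects h x.
  by rewrite mulr_ge0// divr_ge0 ?mulr_ge0// ltW.
have := flux_dist_le n (quot u h x) (quot v h x) (slope Du h x) (slope Dv h x) s01' eta01.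
rewrite /form_density /local_density /near_weight /far_weight !indicE in_setC /=.
rewrite -/(sqr_slopes h x) -/(sqr_defects h x).
move: (flux n s _ _) (flux n 2^-1 _ _) (_ * sqr_slopes h x) (_ * sqr_defects h x)
  (sqr_quots h x) (weight s h) c10 c20 qu0 w0 pq => F G A B Q W A0 B0 Q0 W0 FQ FG.
have /ler_normlP[f1 f2] : `|F * W| <= Q * W by rewrite normrM (ger0_norm W0) ler_wpM2r.
have /ler_normlP[g1 g2] : `|(F - G) * W| <= (A + B) * W.
  by rewrite normrM (ger0_norm W0) ler_wpM2r.
have QW := mulr_ge0 Q0 W0; have AW := mulr_ge0 A0 W0; have BW := mulr_ge0 B0 W0.
by case: (x \in Omega); case: (x + h \in Omega); case: (ltP (enorm h) 1) => _ /=;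
  apply/ler_normlP; split; lra.
Qed.

Lemma int_sqrD k (f g : 'rV[R]_d -> R) : 0 <= k ->
  measurable_fun setT f -> measurable_fun setT g ->
  (\int[lam]_x (k * (f x ^+ 2 + g x ^+ 2))%:E = k%:E * (sqint f + sqint g))%E.
Proof.
move=> k0 mf mg; have sq0 (r : R) : 0 <= r ^+ 2 := sqr_ge0 r.
rewrite ge0_intZl//; [|by mfun|by move=> x; rewrite addr_ge0].
by rewrite ge0_intD//; mfun.
Qed.

Definition entry h : \bar R :=
  (\int[lam]_x (\1_(~` Omega) x * \1_Omega (x + h)%R * sqr_quots h x)%:E)%E.

Definition defects h : \bar R := (defect u Du h + defect v Dv h)%E.

Definition sqr_grads x : R := enorm (Du x) ^+ 2 + enorm (Dv x) ^+ 2.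

Lemma measurable_sqr_quots h : measurable_fun setT (sqr_quots h).
Proof. by rewrite /sqr_quots /quot /incr; mfun. Qed.

Lemma measurable_entry : measurable_fun setT entry.
Proof.
apply: (@measurable_int2 _ _ (fun z => \1_(~` Omega) z.2 * \1_Omega (z.2 + z.1) * sqr_quots z.1 z.2)).
  by rewrite /sqr_quots /quot /incr; mfun.
by move=> z; rewrite mulr_ge0 ?mulr_ge0// addr_ge0 ?sqr_ge0.
Qed.

Lemma measurable_defects : measurable_fun setT defects.
Proof. by apply: emeasurable_funD; exact: measurable_defect. Qed.

(* Exchanging the two end points of a segment that crosses the boundary. *)
Lemma entryN h : entry (- h) = escape Omega (sqr_quots h) h.
Proof.
have mq := measurable_sqr_quots (- h).
rewrite /entry -(ge0_integral_translate h); last 2 first.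
- by mfun.
- by move=> x; rewrite lee_fin mulr_ge0 ?mulr_ge0// addr_ge0 ?sqr_ge0.
apply: eq_integral => x _; congr EFin; rewrite addrK [X in X * _ = _]mulrC; congr (_ * _).
rewrite /sqr_quots /quot /incr addrK enormN.
by rewrite -(opprB (u x)) -(opprB (v x)) !mulNr !sqrrN.
Qed.

(** The squared quotients depend on h and have no evident common majorant; they are exchanged for
    squared gradients, to which [escape_small] applies, at the cost of the defects. *)
Lemma escape_quots_le h : (escape Omega (sqr_quots h) h <=
  2%:E * escape Omega sqr_grads h + 2%:E * defects h)%E.
Proof.
have mq := measurable_sqr_quots h.
have ms : measurable_fun setT sqr_grads by rewrite /sqr_grads; mfun.
have mqu := measurable_quot h mu; have msu := measurable_slope h mDu.
have mqv := measurable_quot h mv; have msv := measurable_slope h mDv.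
have sq0 (r : R) : 0 <= r ^+ 2 := sqr_ge0 r.
rewrite /defects /defect -int_sqrD//; [|by mfun|by mfun].
rewrite /escape -ge0_intZl//; last 2 first.
- by mfun.
- by move=> x; rewrite mulr_ge0 ?mulr_ge0// addr_ge0.
rewrite -ge0_intD; last 4 first.
- by mfun.
- by mfun.
- by move=> x; rewrite !mulr_ge0// addr_ge0.
- by move=> x; rewrite mulr_ge0// addr_ge0.
apply: ge0_le_int => x; first by rewrite mulr_ge0 ?mulr_ge0// addr_ge0.
have ple (p p' a : R) : p' ^+ 2 <= a ^+ 2 -> p ^+ 2 <= 2 * a ^+ 2 + 2 * (p - p') ^+ 2.
  move=> pa; have -> : p = p' + (p - p') by rewrite addrC subrK.
  apply: le_trans (sqrD_le _ _) _; rewrite (_ : p' + (p - p') - p' = p - p').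
    by rewrite lerD2r ler_wpM2l.
  by rewrite addrC addKr.
have sle P : slope P h x ^+ 2 <= enorm (P x) ^+ 2.
  rewrite -(real_normK (num_real (slope P h x))) ler_sqr ?nnegrE ?enorm_ge0//.
  exact: dot_dir_le.
have q1 := ple (quot u h x) _ _ (sle Du); have q2 := ple (quot v h x) _ _ (sle Dv).
have b : sqr_quots h x <= 2 * sqr_grads x + 2 * ((quot u h x - slope Du h x) ^+ 2 +
   (quot v h x - slope Dv h x) ^+ 2).
  by rewrite /sqr_quots /sqr_grads; lra.
rewrite !indicE; case: (x \in Omega); last by rewrite !mul0r mulr0 add0r mulr_ge0// addr_ge0.
case: (x + h \in ~` Omega); last by rewrite !mulr0 !mul0r mulr0 add0r mulr_ge0// addr_ge0.
by rewrite !mul1r.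
Qed.

End estimate.

(** * Integration of the estimate over x and over h *)

Section outer.
Context (R : realType) (n : nat).
Local Notation d := n.+1.
Local Notation lam := (@lebesgue_rV R d).
Implicit Types (s eta : R) (h x : 'rV[R]_d) (z : 'rV[R]_d * 'rV[R]_d).
Variables (Omega : set 'rV[R]_d) (u v : 'rV[R]_d -> R) (Du Dv : 'rV[R]_d -> 'rV[R]_d).
Hypotheses (oO : open Omega) (au : approximable u Du) (av : approximable v Dv).
Variables (N U : R).
Hypotheses (DN : (sqintV Du + sqintV Dv <= N%:E)%E) (uU : (sqint u + sqint v <= U%:E)%E).

Let mO : measurable Omega. Proof. exact: open_measurable_rV. Qed.
Let mOc : measurable (~` Omega). Proof. exact: measurableC. Qed.
Let mu : measurable_fun setT u. Proof. by case: au. Qed.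
Let mv : measurable_fun setT v. Proof. by case: av. Qed.
Let mDu : measurable_fun setT Du. Proof. by case: au. Qed.
Let mDv : measurable_fun setT Dv. Proof. by case: av. Qed.

Let dist s z := `|form_density Omega u v s z - local_density Omega Du Dv s z|.
Let c1 s eta : R := 1 - 2 * s + (d%:R + 3) * eta.
Let c2 eta : R := 3 * (d%:R + 3) / eta.
Let far_tail h : R := (1 <= enorm h)%R%:R * enorm h `^ (- (d%:R + 1)).

Lemma inner_dist_le s eta h : 0 < s < 2^-1 -> 0 < eta <= 1 ->
  (\int[lam]_x (dist s (x, h))%:E <=
    (c1 s eta * N * near_weight s h)%:E +
    ((c2 eta)%:E * defects u v Du Dv h + entry Omega u v h) * (near_weight s h)%:E +
    (far_weight s h)%:E * (sqint (quot u h) + sqint (quot v h)))%E.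
Proof.
move=> s01 eta01; have /andP[s0 s2] := s01; have /andP[eta0 eta1] := eta01.
have nw0 := near_weight_ge0 h s2; have fw0 := far_weight_ge0 h s2.
have mq := measurable_sqr_quots au av h.
have sq0 (r : R) : 0 <= r ^+ 2 := sqr_ge0 r.
have mqu := measurable_quot h mu; have msu := measurable_slope h mDu.
have mqv := measurable_quot h mv; have msv := measurable_slope h mDv.
have L0 : 0 <= d%:R + 3 :> R by rewrite addr_ge0.
have c10 : 0 <= c1 s eta by rewrite addr_ge0 ?mulr_ge0 ?(ltW eta0)//; lra.
have c20 : 0 <= c2 eta by rewrite divr_ge0 ?mulr_ge0// ltW.
have qu0 x : 0 <= sqr_quots u v h x by rewrite addr_ge0.
have sl0 x : 0 <= sqr_slopes Du Dv h x by rewrite addr_ge0.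
have de0 x : 0 <= sqr_defects u v Du Dv h x by rewrite addr_ge0.
have msl : measurable_fun setT (sqr_slopes Du Dv h) by rewrite /sqr_slopes; mfun.
have mde : measurable_fun setT (sqr_defects u v Du Dv h) by rewrite /sqr_defects; mfun.
move: c10 c20 (fun x => density_dist_le Omega u v Du Dv x h s01 eta01).
rewrite -/(c1 s eta) -/(c2 eta).
move: (c1 s eta) (c2 eta) (near_weight s h) (far_weight s h) nw0 fw0 => k1 k2 nw fw nw0 fw0 k10 k20 pw.
pose f1 x := nw * (k1 * sqr_slopes Du Dv h x).
pose f2 x := nw * (k2 * sqr_defects u v Du Dv h x).
pose f3 x := nw * (\1_(~` Omega) x * \1_Omega (x + h) * sqr_quots u v h x).
pose f4 x := fw * sqr_quots u v h x.
have f10 x : 0 <= f1 x by rewrite mulr_ge0// mulr_ge0.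
have f20 x : 0 <= f2 x by rewrite mulr_ge0// mulr_ge0.
have f30 x : 0 <= f3 x by rewrite mulr_ge0// !mulr_ge0.
have f40 x : 0 <= f4 x by rewrite mulr_ge0.
have mf1 : measurable_fun setT f1 by rewrite /f1; mfun.
have mf2 : measurable_fun setT f2 by rewrite /f2; mfun.
have mf3 : measurable_fun setT f3 by rewrite /f3; mfun.
have mf4 : measurable_fun setT f4 by rewrite /f4; mfun.
apply: le_trans (_ : (\int[lam]_x (f1 x + f2 x + f3 x + f4 x)%:E <= _)%E).
  by apply: ge0_le_int => x; [exact: normr_ge0|exact: pw].
rewrite ge0_intD//; [|by mfun|by move=> x; rewrite !addr_ge0].
rewrite ge0_intD//; [|by mfun|by move=> x; rewrite addr_ge0].
rewrite ge0_intD//.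
apply: leeD; last by rewrite int_sqrD.
rewrite -addeA; apply: leeD.
  rewrite ge0_intZl//; [|by mfun|by move=> x; rewrite mulr_ge0].
  rewrite ge0_intZl//.
  rewrite (_ : k1 * N * nw = nw * (k1 * N)); last by ring.
  rewrite EFinM lee_wpmul2l// EFinM lee_wpmul2l//; apply: le_trans DN.
  rewrite ge0_intD//; [|by mfun|by mfun].
  by apply: leeD; exact: sqint_slope_le.
rewrite muleC ge0_muleDr; last 2 first.
- by rewrite mule_ge0// adde_ge0// sqint_ge0.
- by apply: int_ge0 => x; rewrite !mulr_ge0.
rewrite ge0_intZl//; [|by mfun|by move=> x; rewrite mulr_ge0].
rewrite ge0_intZl//.
rewrite [X in (_ + X <= _)%E]ge0_intZl//; [|by mfun|by move=> x; rewrite !mulr_ge0].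
by rewrite ge0_intD//; mfun.
Qed.

(** Here the crude bound of an increment by 4 times the L^2 integral suffices: the |h|^-2 of the
    squared quotients cancels the |h|^2 of the weight, and for |h| >= 1 the exponent d+1+2s may be
    lowered to d+1, which no longer involves s. *)
Lemma far_dist_le s h : 0 < s < 2^-1 ->
  ((far_weight s h)%:E * (sqint (quot u h) + sqint (quot v h)) <=
   (4 * Cds d s * U * far_tail h)%:E)%E.
Proof.
move=> /andP[s0 s2]; rewrite /far_weight /far_tail.
have C0 := ltW (Cds_gt0 n s2).
have [h1|h1] := leP 1 (enorm h); last by rewrite !mul0r mulr0 mul0e.
have eh0 : 0 < enorm h by exact: lt_le_trans h1.
have quot_le (w : 'rV[R]_d -> R) : measurable_fun setT w ->
    (sqint (quot w h) <= (4 / enorm h ^+ 2)%:E * sqint w)%E.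
  move=> mw; apply: sqint_quot_le => //.
    by rewrite mule_ge0 ?sqint_ge0// lee_fin divr_ge0// sqr_ge0.
  rewrite muleA -EFinM mulrC divfK; first exact: sqint_incr_le.
  by rewrite gt_eqF// exprn_gt0.
rewrite !mul1r; apply: le_trans (_ : ((weight s h)%:E * ((4 / enorm h ^+ 2)%:E * U%:E) <= _)%E).
  rewrite lee_wpmul2l ?lee_fin ?weight_ge0//.
  apply: le_trans (leeD (quot_le _ mu) (quot_le _ mv)) _.
  by rewrite -ge0_muleDr ?sqint_ge0// lee_wpmul2l// lee_fin divr_ge0// sqr_ge0.
rewrite -!EFinM lee_fin /weight powRN.
have U0 : 0 <= U by rewrite -lee_fin; apply: le_trans uU; rewrite adde_ge0 ?sqint_ge0.
set P := enorm h `^ _; set Q := enorm h `^ _.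
have QP : Q <= P by apply: ler_powR => //; rewrite lerDl mulr_ge0// ltW.
have Q0 : 0 < Q by exact: powR_gt0.
have P0 : 0 < P by exact: powR_gt0.
rewrite [leLHS](_ : _ = 4 * Cds d s * U * P^-1); last by field; rewrite !gt_eqF.
apply: ler_wpM2l; first by apply: mulr_ge0 => //; exact: mulr_ge0.
by rewrite lef_pV2 ?posrE.
Qed.

Lemma near_weightN s h : near_weight s (- h) = near_weight s h.
Proof. by rewrite /near_weight /weight enormN. Qed.

(** The exchange of end points sends h to -h, so it applies only under the integral over h, where it
    is harmless because the weight is even. The increase from k to k + 2 is the defect term of
    [escape_quots_le]. *)
Lemma crossing_le s k : 0 < s < 2^-1 -> 0 <= k ->
  (\int[lam]_h ((k%:E * defects u v Du Dv h + entry Omega u v h) * (near_weight s h)%:E) <=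
   \int[lam]_h (((k + 2)%:E * defects u v Du Dv h + 2%:E * escape Omega (sqr_grads Du Dv) h) *
     (near_weight s h)%:E))%E.
Proof.
move=> /andP[s0 s2] k0; have nw0 h : 0 <= near_weight s h := near_weight_ge0 h s2.
have nw0E h : (0 <= (near_weight s h)%:E)%E by rewrite lee_fin.
have mnw : measurable_fun setT (@near_weight R n s) by exact: measurable_near_weight.
have mnwE : measurable_fun setT (fun h => (near_weight s h)%:E) by exact/measurable_EFinP.
have D0 h : (0 <= defects u v Du Dv h)%E by rewrite adde_ge0 ?sqint_ge0.
have en0 h : (0 <= entry Omega u v h)%E.
  by apply: int_ge0 => x; rewrite !mulr_ge0// addr_ge0 ?sqr_ge0.
have es0 h : (0 <= escape Omega (sqr_grads Du Dv) h)%E.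
  by apply: int_ge0 => x; rewrite !mulr_ge0// addr_ge0 ?sqr_ge0.
have mD := measurable_defects au av.
have men := measurable_entry oO au av.
have mg : measurable_fun setT (sqr_grads Du Dv) by rewrite /sqr_grads; mfun.
have mes : measurable_fun setT (escape Omega (sqr_grads Du Dv)).
  by apply: measurable_escape => // x; rewrite addr_ge0 ?sqr_ge0.
have mkD c : measurable_fun setT (fun h => c%:E * defects u v Du Dv h)%E.
  exact: measurable_funeM.
have mM (f : 'rV[R]_d -> \bar R) : measurable_fun setT f ->
    measurable_fun setT (fun h => f h * (near_weight s h)%:E)%E.
  by move=> mf; exact: emeasurable_funM.
under eq_integral do rewrite ge0_muleDl ?mule_ge0//.
rewrite ge0_integralD//; last 4 first.
- by move=> h _; rewrite !mule_ge0.
- exact: mM.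
- by move=> h _; rewrite mule_ge0.
- exact: mM.
rewrite -[X in (_ + X <= _)%E]ge0_integral_opp; last 2 first.
- exact: mM.
- by move=> h; rewrite mule_ge0.
pose T h := ((2%:E * escape Omega (sqr_grads Du Dv) h + 2%:E * defects u v Du Dv h) *
  (near_weight s h)%:E)%E.
have T0 h : (0 <= T h)%E by rewrite mule_ge0// adde_ge0// mule_ge0.
have mT : measurable_fun setT T.
  by apply: mM; apply: emeasurable_funD; [exact: measurable_funeM|exact: mkD].
apply: le_trans (_ : (\int[lam]_h (k%:E * defects u v Du Dv h * (near_weight s h)%:E) +
    \int[lam]_h T h <= _)%E).
  apply: leeD; first exact: lexx.
  apply: ge0_le_integralT => h; first by rewrite mule_ge0.
  by rewrite near_weightN (entryN oO au av) lee_wpmul2r// escape_quots_le.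
rewrite -ge0_integralD//; last 2 first.
- by move=> h _; rewrite !mule_ge0.
- exact: mM.
apply: ge0_le_integralT => h; first by rewrite adde_ge0// !mule_ge0.
rewrite /T -ge0_muleDl ?mule_ge0//; last by rewrite adde_ge0// mule_ge0.
apply: lee_wpmul2r => //.
by rewrite [(k + 2)%:E]EFinD ge0_muleDl// [(2%:E * escape _ _ _ + _)%E]addeC addeA.
Qed.

Lemma integral_dist_le s eta C : 0 < s < 2^-1 -> 0 < eta <= 1 -> 0 <= N -> 0 <= U ->
  (\int[lam]_h (far_tail h)%:E <= C%:E)%E ->
  (\int[lam \x lam]_z (dist s z)%:E <=
    (c1 s eta * N * d%:R)%:E +
    \int[lam]_h (((c2 eta + 2)%:E * defects u v Du Dv h +
       2%:E * escape Omega (sqr_grads Du Dv) h) * (near_weight s h)%:E) +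
    (4 * Cds d s * U * C)%:E)%E.
Proof.
move=> s01 eta01 N0 U0 hC; have /andP[s0 s2] := s01; have /andP[eta0 eta1] := eta01.
have nw0 h : 0 <= near_weight s h := near_weight_ge0 h s2.
have mnw : measurable_fun setT (@near_weight R n s) by exact: measurable_near_weight.
have mnwE : measurable_fun setT (fun h => (near_weight s h)%:E) by exact/measurable_EFinP.
have L0 : 0 <= d%:R + 3 :> R by rewrite addr_ge0.
have c10 : 0 <= c1 s eta by rewrite addr_ge0 ?mulr_ge0 ?(ltW eta0)//; lra.
have c20 : 0 <= c2 eta by rewrite divr_ge0 ?mulr_ge0// ltW.
have C0 := ltW (Cds_gt0 n s2).
have mdist : measurable_fun setT (dist s).
  have mF := measurable_form_density oO (ltW s0) mu mv.
  have mL := measurable_local_density oO s mDu mDv.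
  apply: (measurableT_comp (@normr_measurable _ setT)).
  exact: measurable_funB.
have D0 h : (0 <= defects u v Du Dv h)%E by rewrite adde_ge0 ?sqint_ge0.
have en0 h : (0 <= entry Omega u v h)%E.
  by apply: int_ge0 => x; rewrite !mulr_ge0// addr_ge0 ?sqr_ge0.
have mD := measurable_defects au av.
have men := measurable_entry oO au av.
have mfar : measurable_fun setT far_tail by rewrite /far_tail; mfun.
have far0 h : 0 <= far_tail h by rewrite mulr_ge0// powR_ge0.
rewrite ge0_integral_prod//; last by move=> z; exact: normr_ge0.
rewrite (tonelli lam lam (f := fun x h => dist s (x, h))); last 2 first.
- rewrite (_ : (fun z => _) = dist s)//; by apply/funext => -[].
- by move=> x h; exact: normr_ge0.
pose T1 h := (c1 s eta * N * near_weight s h)%:E.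
pose T2 h := (((c2 eta)%:E * defects u v Du Dv h + entry Omega u v h) * (near_weight s h)%:E)%E.
pose T3 h := (4 * Cds d s * U * far_tail h)%:E.
have T10 h : (0 <= T1 h)%E by rewrite lee_fin mulr_ge0// mulr_ge0.
have T20 h : (0 <= T2 h)%E by rewrite mule_ge0 ?lee_fin// adde_ge0// mule_ge0.
have CU0 : 0 <= 4 * Cds d s * U by rewrite mulr_ge0// mulr_ge0.
have T30 h : (0 <= T3 h)%E by rewrite lee_fin mulr_ge0.
have mT1 : measurable_fun setT T1 by rewrite /T1; mfun.
have mT3 : measurable_fun setT T3 by rewrite /T3; mfun.
have mT2 : measurable_fun setT T2.
  by apply: emeasurable_funM => //; apply: emeasurable_funD => //; exact: measurable_funeM.
apply: le_trans (_ : (\int[lam]_h (T1 h + T2 h + T3 h) <= _)%E).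
  apply: ge0_le_integralT => h; first by apply: int_ge0 => x; exact: normr_ge0.
  apply: le_trans (inner_dist_le h s01 eta01) _.
  by apply: leeD; [exact: lexx|exact: far_dist_le].
rewrite ge0_integralD//; last 2 first.
- by move=> h _; rewrite adde_ge0.
- exact: emeasurable_funD.
apply: leeD; last first.
  by rewrite ge0_intZl// [leRHS]EFinM; apply: lee_wpmul2l.
rewrite ge0_integralD//; apply: leeD; last exact: crossing_le.
rewrite ge0_intZl//; last by rewrite mulr_ge0.
by rewrite int_weight_ball.
Qed.

End outer.

(** * Passage to the limit *)

Section conclusion.
Context (R : realType) (n : nat).
Local Notation d := n.+1.
Local Notation lam := (@lebesgue_rV R d).
Implicit Types (s eta : R) (h x : 'rV[R]_d) (z : 'rV[R]_d * 'rV[R]_d).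
Variables (Omega : set 'rV[R]_d) (u v : 'rV[R]_d -> R) (Du Dv : 'rV[R]_d -> 'rV[R]_d).
Hypotheses (oO : open Omega) (au : approximable u Du) (av : approximable v Dv).
Hypotheses (uoo : (sqint u < +oo)%E) (voo : (sqint v < +oo)%E).
Hypotheses (Duoo : (sqintV Du < +oo)%E) (Dvoo : (sqintV Dv < +oo)%E).

Let mu : measurable_fun setT u. Proof. by case: au. Qed.
Let mv : measurable_fun setT v. Proof. by case: av. Qed.
Let mDu : measurable_fun setT Du. Proof. by case: au. Qed.
Let mDv : measurable_fun setT Dv. Proof. by case: av. Qed.

Lemma near_error_small c e : 0 <= c -> 0 < e ->
  exists2 eta, 0 < eta & forall s, 2^-1 - eta < s < 2^-1 ->
  (\int[lam]_h ((c%:E * defects u v Du Dv h + 2%:E * escape Omega (sqr_grads Du Dv) h) *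
     (near_weight s h)%:E) <= e%:E)%E.
Proof.
move=> c0 e0.
have mg : measurable_fun setT (sqr_grads Du Dv) by rewrite /sqr_grads; mfun.
have g0 x : 0 <= sqr_grads Du Dv x by rewrite addr_ge0 ?sqr_ge0.
have gE : (\int[lam]_x (sqr_grads Du Dv x)%:E = sqintV Du + sqintV Dv)%E.
  by rewrite ge0_intD//; [mfun|mfun|move=> x; exact: sqr_ge0|move=> x; exact: sqr_ge0].
have D0 h : (0 <= defects u v Du Dv h)%E by rewrite adde_ge0 ?sqint_ge0.
have es0 h : (0 <= escape Omega (sqr_grads Du Dv) h)%E.
  by apply: int_ge0 => x; rewrite !mulr_ge0.
have [N NE] : exists N : R, (sqintV Du + sqintV Dv = N%:E)%E.
  exists (fine (sqintV Du + sqintV Dv)); rewrite fineK// ge0_fin_numE.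
    exact: lte_add_pinfty.
  by rewrite adde_ge0 ?sqintV_ge0.
apply: (@cvg_int_weight R n (fun h => c%:E * defects u v Du Dv h +
    2%:E * escape Omega (sqr_grads Du Dv) h)%E (c * (18 * N) + 2 * N)) => //.
- apply: emeasurable_funD; apply: measurable_funeM; first exact: measurable_defects.
  exact: measurable_escape.
- by move=> h; rewrite adde_ge0// mule_ge0.
- move=> h _; rewrite [(c * (18 * N) + 2 * N)%:E]EFinD [(c * _)%:E]EFinM [(2 * N)%:E]EFinM.
  apply: leeD; apply: lee_wpmul2l => //.
    rewrite [(18 * N)%:E]EFinM -NE ge0_muleDr ?sqintV_ge0//.
    by apply: leeD; exact: defect_le.
  by rewrite -NE -gE; exact: escape_le.
(* Two defects with coefficient c and one escape term with coefficient 2, each at most t, add up to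
   t (2c + 2) = r/2. *)
move=> r r0; pose t := r / (2 * (2 * c + 2)).
have t0 : 0 < t by rewrite divr_gt0// mulr_gt0// ltr_wpDl// mulr_ge0.
have [a a0 ha] := defect_small au t0; have [b b0 hb] := defect_small av t0.
have goo : (\int[lam]_x (sqr_grads Du Dv x)%:E < +oo)%E by rewrite gE NE ltry.
have [k k0 hk] := escape_small oO mg g0 goo t0.
exists (Num.min a (Num.min b k)); first by rewrite !lt_min a0 b0.
move=> h; rewrite !lt_min => /and3P[/ha hah /hb hbh /hk hkh].
apply: le_trans (_ : (c%:E * (t%:E + t%:E) + 2%:E * t%:E <= _)%E).
  apply: leeD; apply: lee_wpmul2l => //; exact: leeD.
rewrite -!(EFinM, EFinD) lee_fin (_ : _ + _ = r / 2).
  by rewrite ler_pdivrMr// ler_peMr ?(ltW r0)// ler1n.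
by rewrite /t; field; rewrite gt_eqF// ltr_wpDl// mulr_ge0.
Qed.

Lemma form_density_close e : 0 < e ->
  exists2 eta, 0 < eta & forall s, 2^-1 - eta < s < 2^-1 -> 0 < s /\
  (\int[lam \x lam]_z `|form_density Omega u v s z - local_density Omega Du Dv s z|%:E
     <= e%:E)%E.
Proof.
move=> e0.
pose N := fine (sqintV Du + sqintV Dv); pose U := fine (sqint u + sqint v).
have N0 : 0 <= N by rewrite fine_ge0// adde_ge0 ?sqintV_ge0.
have U0 : 0 <= U by rewrite fine_ge0// adde_ge0 ?sqint_ge0.
have NE : (sqintV Du + sqintV Dv <= N%:E)%E.
  rewrite fineK// ge0_fin_numE; first exact: lte_add_pinfty.
  by rewrite adde_ge0 ?sqintV_ge0.
have UE : (sqint u + sqint v <= U%:E)%E.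
  rewrite fineK// ge0_fin_numE; first exact: lte_add_pinfty.
  by rewrite adde_ge0 ?sqint_ge0.
have [C C0 hC] := far_mass_ex R n.
have al0 := alpha_gt0 R d.
(* [K] collects the factors of eta and of 1 - 2s in the slope and far terms. Four errors receive e/4
   each: two from the slopes, one from defects and crossings, one from the far field. *)
pose K : R := (d%:R + 3) * N * d%:R + 4 * U * C / alpha R d.
have Kt0 : 0 <= (d%:R + 3) * N * d%:R :> R by rewrite mulr_ge0// mulr_ge0// addr_ge0.
have KU0 : 0 <= 4 * U * C / alpha R d by rewrite divr_ge0 ?(ltW al0)// mulr_ge0// mulr_ge0.
have K0 : 0 <= K by rewrite addr_ge0.
pose t := e / (4 * (K + 1)).
have t0 : 0 < t by rewrite divr_gt0// mulr_gt0// ltr_wpDl.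
have Kt : K * t <= e / 4.
  rewrite /t (_ : K * _ = (K / (K + 1)) * (e / 4)); last by field; rewrite gt_eqF// ltr_wpDl.
  by rewrite ler_piMl ?divr_ge0 ?(ltW e0)// ler_pdivrMr ?ltr_wpDl// mul1r lerDl.
(* [eta] is fixed before [del] is obtained: the coefficient of the defects, of order 1/eta, is then
   a constant for [near_error_small]. *)
pose eta := Num.min 1 t.
have eta01 : 0 < eta <= 1 by rewrite lt_min ltr01 t0 ge_min lexx.
have etat : eta <= t by rewrite ge_min lexx orbT.
have /andP[eta0 eta1] := eta01.
have c20 : 0 <= 3 * (d%:R + 3) / eta + 2.
  by rewrite addr_ge0// divr_ge0 ?(ltW eta0)// mulr_ge0// addr_ge0.
have [del del0 hdel] := near_error_small c20 (divr_gt0 e0 (ltr0Sn _ 3)).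
(* The bound 1/4 keeps s positive, and t/2 gives 1 - 2s <= t. *)
exists (Num.min del (Num.min 4^-1 (t / 2))).
  have t20 : 0 < t / 2 by rewrite divr_gt0.
  have i4 : 0 < 4^-1 :> R by [].
  by rewrite !lt_min del0 i4 t20.
move=> s /andP[s1 s2].
have m1 : Num.min del (Num.min 4^-1 (t / 2)) <= del by rewrite ge_min lexx.
have m2 : Num.min del (Num.min 4^-1 (t / 2)) <= 4^-1 by rewrite !ge_min lexx orbT.
have m3 : Num.min del (Num.min 4^-1 (t / 2)) <= t / 2 by rewrite !ge_min lexx !orbT.
have s0 : 0 < s by lra.
have st : 1 - 2 * s <= t by lra.
have sdel : 2^-1 - del < s < 2^-1 by rewrite s2 andbT; lra.
have s01 : 0 < s < 2^-1 by rewrite s0.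
split=> //.
apply: le_trans (integral_dist_le oO au av NE UE s01 eta01 N0 U0 hC) _.
have -> : (e%:E = (e / 4 + e / 4)%:E + (e / 4)%:E + (e / 4)%:E)%E.
  by rewrite -!EFinD; congr EFin; field.
have ND : N * d%:R <= (d%:R + 3) * N * d%:R.
  have d0 : 0 <= d%:R :> R by [].
  rewrite -mulrA; apply: ler_peMl; [exact: mulr_ge0|lra].
apply: leeD; last first.
  rewrite lee_fin; apply: le_trans (_ : K * t <= _) => //.
  apply: le_trans (_ : (4 * U * C / alpha R d) * t <= _).
    rewrite (_ : 4 * Cds d s * U * C = (4 * U * C / alpha R d) * (1 - 2 * s)).
      exact: ler_wpM2l.
    by rewrite /Cds; field; rewrite gt_eqF.
  by rewrite ler_wpM2r ?(ltW t0)// /K lerDr.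
apply: leeD; last exact: hdel.
have Kt' : (d%:R + 3) * N * d%:R * t <= e / 4.
  by apply: le_trans Kt; rewrite ler_wpM2r ?(ltW t0)// /K lerDl.
rewrite lee_fin 2!mulrDl; apply: lerD.
  apply: le_trans Kt'; rewrite -mulrA mulrC ler_pM//; first by rewrite mulr_ge0.
  by lra.
apply: le_trans Kt'.
rewrite (_ : (d%:R + 3) * eta * N * d%:R = (d%:R + 3) * N * d%:R * eta); last by ring.
exact: ler_wpM2l.
Qed.

Lemma nonlocal_form_cvg :
  nonlocal_form Omega s u u v @[s --> (2^-1 : R)^'-] -->
  (\int[lam]_(x in Omega)
     (dot (Du x) (Dv x) / Num.sqrt (1 + enorm (Du x) ^+ 2))%:E)%E.
Proof.
set I := (\int[_]_(x in _) _)%E.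
(* The form is written as I + J with J small, which avoids subtracting extended reals. Its
   integrability follows from that of the local density and of the difference. *)
have close e : 0 < e -> exists2 eta, 0 < eta & forall s, 2^-1 - eta < s < 2^-1 ->
    exists J : \bar R, nonlocal_form Omega s u u v = (I + J)%E /\ (`|J| <= e%:E)%E.
  move=> /form_density_close [eta eta0 he]; exists eta => // s hs.
  have [s0 hse] := he s hs; have /andP[_ s2] := hs.
  have s01 : 0 < s < 2^-1 by rewrite s0.
  pose F z := form_density Omega u v s z; pose L z := local_density Omega Du Dv s z.
  have mF : measurable_fun setT F := measurable_form_density oO (ltW s0) mu mv.
  have mL : measurable_fun setT L := measurable_local_density oO s mDu mDv.
  have iL := integrable_local_density oO s01 mDu mDv Duoo Dvoo.
  have iD : (lam \x lam)%E.-integrable setT (fun z => (F z - L z)%:E).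
    apply/integrableP; split; first by apply/measurable_EFinP; exact: measurable_funB.
    exact: le_lt_trans hse (ltry _).
  have FE z : ((F z)%:E = (L z)%:E + (F z - L z)%:E)%E.
    by rewrite -EFinD addrC subrK.
  have iF : (lam \x lam)%E.-integrable setT (fun z => (F z)%:E).
    rewrite (_ : (fun z => _) = fun z => ((L z)%:E + (F z - L z)%:E)%E); last exact/funext.
    exact: integrableD.
  exists (\int[lam \x lam]_z (F z - L z)%:E)%E; split.
    rewrite (nonlocal_formE oO s01 mu mv iF).
    transitivity (\int[lam \x lam]_z ((L z)%:E + (F z - L z)%:E))%E.
      by apply: eq_integral => z _; exact: FE.
    rewrite integralD//; congr (_ + _)%E.
    exact: int_local_density.
  have mFL : measurable_fun setT (fun z => (F z - L z)%:E).
    by apply/measurable_EFinP; exact: measurable_funB.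
  apply: le_trans (le_abse_integral (lam \x lam)%E measurableT mFL) _.
  exact: hse.
(* I is the integral of the local density for every admissible s, so its finiteness can be read off
   at a single one, s = 1/4. *)
have Ifin : I \is a fin_num.
  have s01 : 0 < (4^-1 : R) < 2^-1 by apply/andP; split; lra.
  rewrite /I -(int_local_density oO s01 mDu mDv Duoo Dvoo).
  apply: integrable_fin_num => //.
  exact: integrable_local_density.
move: Ifin close; move: I => I; case: I => // r _ close.
apply/fine_cvgP; split.
  have [eta eta0 he] := close 1 ltr01.
  near=> s; have [|J [-> Je]] := he s.
    apply/andP; split; near: s; [apply: nbhs_left_gt|exact: nbhs_left_lt].
    by rewrite gtrBl.
  by rewrite fin_numD/= -abse_fin_num ge0_fin_numE// (le_lt_trans Je)// ltry.
apply/cvgrPdist_le => e e0; have [eta eta0 he] := close e e0.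
near=> s; have [|J []] := he s.
  apply/andP; split; near: s; [apply: nbhs_left_gt|exact: nbhs_left_lt].
  by rewrite gtrBl.
move=> /= ->; case: J => [j| |]//=.
by rewrite lee_fin opprD addNKr normrN.
Unshelve. all: by end_near.
Qed.

End conclusion.

Theorem lemma5p11 (R : realType) (d : nat) (hd : (0 < d)%N)
    (Omega Lambda : set 'rV[R]_d)
    (hOmega : bounded_lipschitz_domain Omega)
    (hLambda : bounded_set Lambda) (hsub : Omega `<=` Lambda)
    (u v : 'rV[R]_d -> R) (Du Dv : 'rV[R]_d -> 'rV[R]_d)
    (hu : sobolev_H10 Lambda u Du) (hv : sobolev_H10 Lambda v Dv) :
  nonlocal_form Omega s u u v @[s --> (2^-1 : R)^'-] -->
  (\int[lebesgue_rV d]_(x in Omega)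
     (dot (Du x) (Dv x) / Num.sqrt (1 + enorm (Du x) ^+ 2))%:E)%E.
Proof.
case: d hd Omega Lambda hOmega hLambda hsub u v Du Dv hu hv => // n _ Omega Lambda
  [_ oO _ _ _] _ _ u v Du Dv.
move=> /sobolev_H10_approximable[au uoo Duoo] /sobolev_H10_approximable[av voo Dvoo].
exact: nonlocal_form_cvg.
Qed.
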